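(* For every graph $H$ and every $\gamma > 0$, there exists $C > 0$ such that if $p = p(n) \geq C n^{-1/m_2(H)}$, then asymptotically almost surely every $H$-free subgraph $G' \subseteq G_{n,p}$ with minimum degree $\delta(G') \geq \left(1 - \frac{3}{3\chi(H) - 4} + \gamma\right) p n$ may be made $(\chi(H)-1)$-partite by removing from it at most $\gamma p n^2$ edges.
   Context: $G_{n,p}$ is the binomial random graph on $n$ vertices with edge probability $p$; ''asymptotically almost surely'' means with probability tending to $1$ as $n\to\infty$. $\chi(H)$ is the chromatic number of $H$. The $2$-density is $m_2(H) = \max\{ (e(H')-1)/(v(H')-2) : H' \subseteq H,\ v(H') \geq 3\}$, with $m_2(K_2) = 1/2$. *)

(* Defs.v *)
From HB Require Import structures.
From mathcomp Require Import all_boot all_order all_algebra.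
From mathcomp Require Import all_classical all_reals all_analysis.
Import Order.TTheory GRing.Theory Num.Theory.
Import numFieldNormedType.Exports.

Set Implicit Arguments.
Unset Strict Implicit.
Unset Printing Implicit Defensive.

Local Open Scope classical_set_scope.
Local Open Scope ring_scope.

(* Finite simple graphs whose vertex set is a subset of an ambient finite type
   [T]: graphs on different subsets of [T] live in the same finite type, so a
   subgraph, spanning or not, is again an element of [sgraph T]. *)
Section SimpleGraph.
Variable T : finType.

Definition sgraph_wf (VE : {set T} * {set {set T}}) : bool :=
  [forall e in VE.2, (#|e| == 2)%N && (e \subset VE.1)].

Record sgraph := SGraph {
  sgraph_val : {set T} * {set {set T}};
  _ : sgraph_wf sgraph_val }.

HB.instance Definition _ := [isSub for sgraph_val].
HB.instance Definition _ := [Finite of sgraph by <:].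

Definition verts (G : sgraph) : {set T} := (sgraph_val G).1.
Definition edges (G : sgraph) : {set {set T}} := (sgraph_val G).2.

Definition subgraph (G' G : sgraph) : Prop :=
  verts G' \subset verts G /\ edges G' \subset edges G.

Definition degree (G : sgraph) (v : T) : nat :=
  #|[set e in edges G | v \in e]|.

(* Every degree is smaller than [#|verts G|], so this is the true minimum as
   soon as there is a vertex; the graph without vertices gets 0. *)
Definition min_degree (G : sgraph) : nat :=
  \big[minn/#|verts G|]_(v in verts G) degree G v.

Lemma del_edges_wf (G : sgraph) (F : {set {set T}}) :
  sgraph_wf (verts G, edges G :\: F).
Proof.
case: G => -[V E] wfG; apply/forallP => e; apply/implyP.
by rewrite inE => /andP[_ eE]; have /forallP/(_ e)/implyP/(_ eE) := wfG.
Qed.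

Definition del_edges (G : sgraph) (F : {set {set T}}) : sgraph :=
  SGraph (del_edges_wf G F).

Definition partite (k : nat) (G : sgraph) : Prop :=
  exists2 f : T -> nat,
    (forall v, v \in verts G -> (f v < k)%N) &
    (forall x y, [set x; y]%SET \in edges G -> f x <> f y).

Lemma partite_exists (G : sgraph) : exists k, `[< partite k G >].
Proof.
exists #|T|; apply/asboolP; exists (fun v => enum_rank v : nat).
  by move=> v _; exact: ltn_ord.
move=> x y; case: G => -[V E] wfG /= xyE.
have /forallP/(_ [set x; y]%SET)/implyP/(_ xyE)/andP[] := wfG.
by rewrite cards2 => xy _ /val_inj/enum_rank_inj eqxy; rewrite eqxy eqxx in xy.
Qed.

Definition chi (G : sgraph) : nat := ex_minn (partite_exists G).

(* Outside [K_2] the supremum is over a finite set, hence a maximum.  That set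
   is empty, and its [sup] is then 0, only for the edgeless graphs on at most
   two vertices.  The value is also 0 for one edge plus isolated vertices; in
   both cases [1 / m2 H] is the conventional [1 / 0 = 0]. *)
Definition m2 (R : realType) (H : sgraph) : R :=
  if (#|verts H| == 2)%N && (#|edges H| == 1)%N then 1 / 2
  else sup [set (#|edges H'|%:R - 1) / (#|verts H'|%:R - 2)
             | H' in [set H' : sgraph | subgraph H' H /\ (3 <= #|verts H'|)%N]].

End SimpleGraph.

(* [G] has a subgraph, not necessarily induced, isomorphic to [H]. *)
Definition has_copy (T U : finType) (H : sgraph T) (G : sgraph U) : Prop :=
  exists f : {x : T | x \in verts H} -> U,
    [/\ injective f,
        forall x, f x \in verts G &
        forall x y, [set val x; val y]%SET \in edges H ->
                    [set f x; f y]%SET \in edges G].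

Definition graph_free (T U : finType) (H : sgraph T) (G : sgraph U) : Prop :=
  ~ has_copy H G.

Definition gnp_weight (R : realType) (n : nat) (p : R) (G : sgraph 'I_n) : R :=
  if verts G == [set: 'I_n]%SET
  then p ^+ #|edges G| * (1 - p) ^+ ('C(n, 2) - #|edges G|)
  else 0.

Definition gnp_prob (R : realType) (n : nat) (p : R) (A : set (sgraph 'I_n)) : R :=
  \sum_(G in A) gnp_weight p G.

(* Main.v *)
(* Let r = chi H.  The hypergraph container lemma, applied to the copies of H in
   K_n, puts every H-free graph G' in S + f(S), where the fingerprint S has at
   most o(p n^2) edges, as n^(-1/m_2(H)) is small compared to p, and the dense
   graph f(S) contains few copies of H, hence few copies of K_r.  A union bound
   over S in G(n,p), with weight p^|S|, and over pairs of vertex sets shows that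
   almost surely G(n,p) has at most the expected number of edges, up to
   eta p n^2, in all the relevant parts of all the containers.  So the minimum
   degree of G' forces almost all degrees of f(S) on V(G') to be large, and it
   is enough to prove a stability version of the Andrasfai-Erdos-Sos theorem for
   dense graphs with few K_r.  There, a random sample of bounded size is K_r-free
   with large minimum degree, so it is (r-1)-colourable, uniquely so, and its
   colouring extends to nearly all of the graph.

   Containers: write F(S, C; y) for the independence polynomial of the sets U in C
   such that S + U is independent.  If ln F(S, C; x) is much smaller than
   x |C|, then some vertex v of C has F(S + v, C - v; y) noticeably smaller than
   F(S, C; y) on average over y <= x.  Ask whether v belongs to the independent
   set: a positive answer lowers ln F, so there are few of them.  When the
   process stops, a random subset of C is independent with probability
   exp (- small x |C|), and Janson's inequality bounds the number of edges in C.

   When no two edges of H meet, p n^2 may stay bounded and the union bound fails;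
   then all degrees of G(n,p) are almost surely at most eta p n^2, and H embeds
   greedily. *)

Require Import Defs.
From HB Require Import structures.
From mathcomp Require Import all_boot all_order all_algebra.
From mathcomp Require Import all_classical all_reals all_analysis.
From mathcomp Require Import zify ring lra.
Import Order.TTheory GRing.Theory Num.Theory.
Import numFieldNormedType.Exports.
Import mathcomp.boot.fintype mathcomp.boot.finset.

Set Implicit Arguments.
Unset Strict Implicit.
Unset Printing Implicit Defensive.

(** * The Andrásfai-Erdős-Sós theorem *)

Definition clique (K : finType) (e : rel K) (Q : {set K}) : bool :=
  [forall a in Q, forall b in Q, (a != b) ==> e a b].

Section AndrasfaiErdosSos.
Variable K : finType.
Implicit Types (e : rel K) (Q : {set K}) (u v x y z : K).

Lemma cliqueP e Q :
  reflect {in Q &, forall a b, a != b -> e a b} (clique e Q).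
Proof.
apply: (iffP forall_inP) => [h a b aQ bQ ab | h a aQ].
  by have /forall_inP/(_ b bQ)/implyP/(_ ab) := h a aQ.
by apply/forall_inP => b bQ; apply/implyP => ab; exact: h.
Qed.

Lemma cliqueS e Q Q' : Q' \subset Q -> clique e Q -> clique e Q'.
Proof.
move=> /subsetP s /cliqueP h; apply/cliqueP => a b /s aQ /s bQ; exact: h.
Qed.

Lemma cliqueU1 e Q u : symmetric e -> {in Q, forall a, e u a} ->
  clique e Q -> clique e (u |: Q).
Proof.
move=> se uQ /cliqueP h; apply/cliqueP => a b /setU1P[->|aQ] /setU1P[->|bQ] ab.
- by rewrite eqxx in ab.
- exact: uQ.
- by rewrite se; exact: uQ.
- exact: h.
Qed.

Definition clique_free e r := [forall Q : {set K}, (#|Q| == r) ==> ~~ clique e Q].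

Lemma clique_freeP e r : clique_free e r ->
  forall Q, clique e Q -> (#|Q| < r)%N.
Proof.
move=> /forallP h Q cQ; rewrite ltnNge; apply/negP => rQ.
have [A sA cA] : exists2 A : {set K}, A \subset Q & #|A| = r.
  have : 0 < #|[set A : {set K} | (A \subset Q) && (#|A| == r)]|.
    by rewrite cards_draws bin_gt0.
  by case/card_gt0P => A; rewrite inE => /andP[? /eqP]; exists A.
by have /implyP/(_ (introT eqP cA)) := h A; rewrite (cliqueS sA cQ).
Qed.

Definition codeg e v := #|[set u | ~~ e v u]|.

(* Brandt's configurations: [Q1] and [Q2] are [s]-cliques completed to
   [s.+1]-cliques by [x] and by [y], resp. [x] and [z], and [k] is the size of
   their common core.  In a maximal [s.+2]-clique-free graph one exists as soon
   as non-adjacency is not transitive. *)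
Definition wheel e s k (c : K * K * K * {set K} * {set K}) : bool :=
  let: (x, y, z, Q1, Q2) := c in
  [&& e y z, #|Q1| == s, #|Q2| == s, clique e Q1, clique e Q2,
      [forall a in Q1, e x a && e y a], [forall a in Q2, e x a && e z a]
    & #|Q1 :&: Q2| == k].

Lemma card_disagree e u Q : #|[set a in Q | ~~ e u a]| = \sum_(a in Q) ~~ e u a.
Proof.
rewrite -sum1_card big_mkcond [RHS]big_mkcond; apply: eq_bigr => a _.
by rewrite inE; case: (a \in Q); case: (e u a).
Qed.

Lemma sum_codeg e Q : symmetric e ->
  \sum_u \sum_(a in Q) ~~ e u a = \sum_(a in Q) codeg e a.
Proof.
move=> se; rewrite exchange_big; apply: eq_bigr => a _.
by rewrite /codeg -sum1_card [RHS]big_mkcond; apply: eq_bigr => u _; rewrite inE se; case: (e a u).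
Qed.

(* If [k] is maximal and core vertices get weight 3, the others weight 1, every
   vertex misses weight at least 3: otherwise it could be moved into the core,
   or would complete a clique. *)
Lemma wheel_miss e r s k c u : symmetric e -> irreflexive e ->
  clique_free e r -> r = s.+2 -> wheel e s k c ->
  (forall k' c', wheel e s k' c' -> k' <= k) ->
  let: (x, y, z, Q1, Q2) := c in
  3 <= 3 * (\sum_(a in Q1 :&: Q2) ~~ e u a) + ~~ e u x + ~~ e u y + ~~ e u z
       + \sum_(a in Q1 :\: Q2) ~~ e u a + \sum_(a in Q2 :\: Q1) ~~ e u a.
Proof.
case: c => [[[[x y] z] Q1] Q2] se ie /clique_freeP cf rs.
move=> /and5P[eyz /eqP c1 /eqP c2 q1 /and4P[q2 /forall_inP h1 /forall_inP h2 /eqP ck]] mx.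
rewrite -!card_disagree.
set mC := #|_|; set mA := #|_|; set mB := #|_|.
have [mC0|] := posnP mC; last by lia.
have adjC a : a \in Q1 -> a \in Q2 -> e u a.
  move=> a1 a2; apply/negPn/negP => ne.
  by move/eqP: mC0; rewrite cards_eq0 => /eqP/setP/(_ a); rewrite !inE a1 a2 ne.
have big w Q : #|Q| = s -> clique e Q -> {in Q, forall a, e w a} -> e u w ->
   {in Q, forall a, e u a} -> False.
  move=> cQ qQ wQ uw uQ.
  have wnQ : w \notin Q by apply/negP => /wQ; rewrite ie.
  have unQ : u \notin w |: Q.
    rewrite !inE negb_or; apply/andP; split.
      by apply/eqP => E; rewrite E ie in uw.
    by apply/negP => /uQ; rewrite ie.
  have := cf (u |: (w |: Q)).
  rewrite !cardsU1 unQ wnQ cQ rs ltnn => H; suff: false by []; apply: H.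
  apply: cliqueU1 => //; last exact: cliqueU1.
  by move=> a /setU1P[->|/uQ].
have hA : mA = 0 -> {in Q1, forall a, e u a}.
  move=> /eqP; rewrite cards_eq0 => /eqP/setP A0 a a1.
  have [a2|a2] := boolP (a \in Q2); first exact: adjC.
  by have := A0 a; rewrite !inE a1 a2 /= => /negPn.
have hB : mB = 0 -> {in Q2, forall a, e u a}.
  move=> /eqP; rewrite cards_eq0 => /eqP/setP A0 a a2.
  have [a1|a1] := boolP (a \in Q1); first exact: adjC.
  by have := A0 a; rewrite !inE a1 a2 /= => /negPn.
have x1 : {in Q1, forall a, e x a} by move=> a /h1/andP[].
have y1 : {in Q1, forall a, e y a} by move=> a /h1/andP[].
have x2 : {in Q2, forall a, e x a} by move=> a /h2/andP[].
have z2 : {in Q2, forall a, e z a} by move=> a /h2/andP[].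
have A0x : mA = 0 -> ~~ e u x.
  by move=> /hA E; apply/negP => ux; exact: (big x Q1).
have A0y : mA = 0 -> ~~ e u y.
  by move=> /hA E; apply/negP => ux; exact: (big y Q1).
have B0x : mB = 0 -> ~~ e u x.
  by move=> /hB E; apply/negP => ux; exact: (big x Q2).
have B0z : mB = 0 -> ~~ e u z.
  by move=> /hB E; apply/negP => ux; exact: (big z Q2).
rewrite mC0 muln0 add0n.
case: (boolP (e u x)) A0x B0x => [ux|nux]; last first.
  move=> _ _; move: A0y B0z; case: (mA) => [|?]; case: (mB) => [|?] /= hy hz;
    rewrite ?(hy erefl) ?(hz erefl); lia.
move=> /= A0 B0.
have {A0} pA : 0 < mA by rewrite lt0n; apply/eqP => /A0.
have {B0} pB : 0 < mB by rewrite lt0n; apply/eqP => /B0.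
have [//|lt] := leqP 3 (_ + _).
have [uy uz A1 B1] : [/\ e u y, e u z, mA = 1 & mB = 1].
  by move: lt; case: (e u y); case: (e u z) => /=; split; lia.
have /cards1P[a Ea] : mA == 1 by rewrite A1.
have /cards1P[b Eb] : mB == 1 by rewrite B1.
have ua a' : a' \in Q1 -> a' != a -> e u a'.
  move=> a1 na; have [a2|a2] := boolP (a' \in Q2); first exact: adjC.
  by move/setP/(_ a'): Ea; rewrite !inE a1 a2 (negbTE na) /= => /negbFE.
have ub a' : a' \in Q2 -> a' != b -> e u a'.
  move=> a2 na; have [a1|a1] := boolP (a' \in Q1); first exact: adjC.
  by move/setP/(_ a'): Eb; rewrite !inE a1 a2 (negbTE na) /= => /negbFE.
have [aQ1 aQ2 nua] : [/\ a \in Q1, a \notin Q2 & ~~ e u a].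
  by move/setP/(_ a): Ea; rewrite !inE eqxx => /andP[/andP[-> ->] ->].
have [bQ2 bQ1 nub] : [/\ b \in Q2, b \notin Q1 & ~~ e u b].
  by move/setP/(_ b): Eb; rewrite !inE eqxx => /andP[/andP[-> ->] ->].
have u1 : u \notin Q1 :\ a.
  by rewrite !inE; apply/negP => /andP[na uQ]; have := ua u uQ na; rewrite ie.
have u2 : u \notin Q2 :\ b.
  by rewrite !inE; apply/negP => /andP[na uQ]; have := ub u uQ na; rewrite ie.
pose Q1' := u |: (Q1 :\ a); pose Q2' := u |: (Q2 :\ b).
have W : wheel e s #|Q1' :&: Q2'| (x, y, z, Q1', Q2').
  apply/and5P; split=> //; first by rewrite cardsU1 u1 -c1 (cardsD1 a Q1) aQ1.
    by rewrite cardsU1 u2 -c2 (cardsD1 b Q2) bQ2.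
    apply: cliqueU1 => //; last exact: cliqueS (subsetDl _ _) q1.
    by move=> a' /setD1P[? ?]; exact: ua.
  apply/and4P; split=> //.
  - apply: cliqueU1 => //; last exact: cliqueS (subsetDl _ _) q2.
    by move=> a' /setD1P[? ?]; exact: ub.
  - apply/forall_inP => a' /setU1P[->|/setD1P[_ /h1//]].
    by rewrite se ux se uy.
  - apply/forall_inP => a' /setU1P[->|/setD1P[_ /h2//]].
    by rewrite se ux se uz.
have := mx _ _ W; rewrite -ck => le.
suff : #|u |: (Q1 :&: Q2)| <= #|Q1' :&: Q2'|.
  rewrite cardsU1; suff -> : u \notin Q1 :&: Q2.
    by move=> gt; have := leq_trans gt le; rewrite ltnn.
  apply/negP => /setIP[uQ1 uQ2].
  by have := adjC _ uQ1 uQ2; rewrite ie.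
apply/subset_leq_card/subsetP => v /setU1P[->|/setIP[v1 v2]].
  by rewrite !inE !eqxx.
rewrite !inE v1 v2 !andbT; apply/andP; split; apply/orP; right; apply/eqP => E.
  by rewrite -E v2 in aQ2.
by rewrite -E v1 in bQ1.
Qed.

Lemma no_wheel e r s k c : symmetric e -> irreflexive e -> clique_free e r ->
  r = s.+2 -> (forall v, (3 * r - 4) * codeg e v < 3 * #|K|) -> ~~ wheel e s k c.
Proof.
move=> se ie cf rs cod; apply/negP => W0.
have [k0 [c0 W mx]] : exists k0, exists2 c0, wheel e s k0 c0 &
    forall k' c', wheel e s k' c' -> k' <= k0.
  pose P j := [exists c, wheel e s j c].
  have ex : exists j, P j by exists k; apply/existsP; exists c.
  have ub j : P j -> j <= #|K|.
    move=> /existsP[[[[[x y] z] Q1] Q2]] /and5P[_ _ _ _ /and4P[_ _ _ /eqP <-]].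
    exact: max_card.
  case: (ex_maxnP ex ub) => j /existsP[cj Wj] mx; exists j, cj => // k' c' W'.
  by apply: mx; apply/existsP; exists c'.
have miss u := wheel_miss u se ie cf rs W mx.
case: c0 W miss => [[[[x y] z] Q1] Q2] W miss.
move/and5P: (W) => [eyz /eqP c1 /eqP c2 q1 /and4P[q2 /forall_inP h1 /forall_inP h2 /eqP ck]].
have ks : k0 < s.
  rewrite ltnNge; apply/negP => sk.
  have E : Q1 = Q2.
    apply/eqP; rewrite eqEcard c1 c2 leqnn andbT.
    have /eqP <- : Q1 :&: Q2 == Q1 by rewrite eqEcard subsetIl ck c1.
    exact: subsetIr.
  subst Q2.
  have zQ : z \notin Q1 by apply/negP => /h2; rewrite ie andbF.
  have yQ : y \notin z |: Q1.
    rewrite !inE negb_or; apply/andP; split; first by apply/eqP => E; rewrite E ie in eyz.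
    by apply/negP => /h1; rewrite ie andbF.
  have := clique_freeP cf (Q := y |: (z |: Q1)).
  rewrite !cardsU1 zQ yQ c1 rs ltnn => H; suff: false by []; apply: H.
  apply: cliqueU1 => //.
    by move=> a /setU1P[->//|/h1/andP[]].
  by apply: cliqueU1 => // a /h2/andP[].
have cA : #|Q1 :\: Q2| + k0 = s by rewrite -ck -c1 -(cardsID Q2 Q1) addnC.
have cB : #|Q2 :\: Q1| + k0 = s by rewrite -ck -c2 -(cardsID Q1 Q2) addnC setIC.
have sum1 w : \sum_u ~~ e u w = codeg e w.
  by have := sum_codeg [set w] se; rewrite big_set1 => <-; apply: eq_bigr => u _; rewrite big_set1.
have tot : 3 * #|K| <= 3 * (\sum_(a in Q1 :&: Q2) codeg e a) + codeg e x + codeg e y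
    + codeg e z + \sum_(a in Q1 :\: Q2) codeg e a + \sum_(a in Q2 :\: Q1) codeg e a.
  rewrite -!sum_codeg // -!sum1 big_distrr /= -!big_split /= mulnC -sum_nat_const.
  exact: leq_sum.
have bd Q : (3 * r - 4) * (\sum_(a in Q) codeg e a) <= #|Q| * (3 * #|K|).
  rewrite big_distrr /= -sum_nat_const; apply: leq_sum => a _; exact: ltnW.
have := bd (Q1 :&: Q2); have := bd (Q1 :\: Q2); have := bd (Q2 :\: Q1).
have := cod x; have := cod y; have := cod z.
move: tot; rewrite ck.
set SC := \sum_(a in Q1 :&: Q2) _; set SA := \sum_(a in Q1 :\: Q2) _.
set SB := \sum_(a in Q2 :\: Q1) _.
move: cA cB; set nA := #|Q1 :\: Q2|; set nB := #|Q2 :\: Q1|.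
set R := 3 * r - 4; set N := 3 * #|K| => cA cB tot lz ly lx lB lA lC.
have RE : R = 3 * s + 2 by rewrite /R rs; lia.
have : R * N <= R * (3 * SC + codeg e x + codeg e y + codeg e z + SA + SB).
  by rewrite leq_mul2l tot orbT.
have : (3 * k0 + 3 + nA + nB) * N <= R * N.
  by rewrite leq_mul2r; apply/orP; right; lia.
nia.
Qed.

Lemma maximal_clique_free e r : 1 < r -> symmetric e -> irreflexive e -> clique_free e r ->
  exists e' : rel K, [/\ symmetric e', irreflexive e', clique_free e' r, subrel e e' &
   forall x y, x != y -> ~~ e' x y ->
     exists Q, [/\ #|Q|.+2 = r, clique e' Q, {in Q, forall a, e' x a} & {in Q, forall a, e' y a}]].
Proof.
move=> r1 se ie cf.
pose re (E : {set K * K}) : rel K := fun x y => (x, y) \in E.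
pose P (E : {set K * K}) := [&& [forall x, forall y, re E x y == re E y x],
   [forall x, ~~ re E x x] & clique_free (re E) r].
pose E0 := [set p : K * K | e p.1 p.2].
have re0 : re E0 =2 e by move=> x y; rewrite /re inE.
have clE e1 e2 Q : e1 =2 e2 -> clique e1 Q = clique e2 Q.
  by move=> ee; apply: eq_forallb => a; congr (_ ==> _); apply: eq_forallb => b; rewrite ee.
have P0 : P E0.
  apply/and3P; split.
  - by apply/forallP => x; apply/forallP => y; rewrite !re0 se.
  - by apply/forallP => x; rewrite re0 ie.
  - by apply/forallP => Q; rewrite (clE _ _ _ re0); exact: (forallP cf).
have [E /maxsetP[/and3P[/forallP sE /forallP iE cE] mx] sub] := maxset_exists P0.
have seE : symmetric (re E) by move=> x y; have /forallP/(_ y)/eqP := sE x.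
have ieE : irreflexive (re E) by move=> x; apply/negbTE.
exists (re E); split=> //.
  by move=> x y exy; apply: (subsetP sub); rewrite inE.
move=> x y xy nxy.
pose E' := (x, y) |: ((y, x) |: E).
have reE' a b : re E' a b = [|| (a == x) && (b == y), (a == y) && (b == x) | re E a b].
  by rewrite /re !inE !xpair_eqE.
have nP : ~~ P E'.
  apply/negP => PE'; have EE : E' = E.
    by apply: mx => //; apply/subsetP => p pE; rewrite !inE pE !orbT.
  by move: nxy; rewrite /re -EE !inE eqxx.
have : ~~ clique_free (re E') r.
  apply: contra nP => cf'; apply/and3P; split=> //.
    apply/forallP => a; apply/forallP => b; rewrite !reE' seE.
    by rewrite orbA [X in X || _]orbC orbA -orbA (andbC (a == y)) (andbC (a == x)) orbA.
  apply/forallP => a; rewrite reE' (negbTE (iE a)) orbF negb_or.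
  by apply/andP; split; apply/negP => /andP[/eqP -> /eqP E1]; rewrite E1 eqxx in xy.
rewrite negb_forall => /existsP[Q]; rewrite negb_imply negbK => /andP[/eqP cQ qQ].
have sub2 a b : re E' a b -> a != x -> re E a b \/ (a = y /\ b = x).
  rewrite reE' => /or3P[/andP[->]|/andP[/eqP -> /eqP ->]|->] //; last by left.
  by right.
have nonE Q' : Q' \subset Q -> ~~ ((x \in Q') && (y \in Q')) -> clique (re E) Q'.
  move=> sQ nb; apply/cliqueP => a b aQ bQ ab.
  have := cliqueP _ _ qQ a b (subsetP sQ _ aQ) (subsetP sQ _ bQ) ab.
  rewrite reE' => /or3P[/andP[/eqP ax /eqP bY]|/andP[/eqP ax /eqP bY]|//].
    by rewrite -ax -bY aQ bQ in nb.
  by rewrite -ax -bY aQ bQ in nb.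
have [xQ yQ] : x \in Q /\ y \in Q.
  case: (boolP ((x \in Q) && (y \in Q))) => [/andP[]//|nb].
  by have := clique_freeP cE (nonE Q (subxx _) nb); rewrite cQ ltnn.
exists (Q :\ x :\ y); split.
- have yQ' : y \in Q :\ x by rewrite !inE eq_sym xy.
  by rewrite -cQ (cardsD1 x Q) xQ (cardsD1 y (Q :\ x)) yQ'.
- apply: nonE; last by rewrite !inE eqxx /= ?andbF.
  by apply: subset_trans (subsetDl _ _) (subsetDl _ _).
- move=> a; rewrite !inE => /and3P[ay ax aQ].
  have := nonE (Q :\ y) (subsetDl _ _); rewrite !inE eqxx andbF => /(_ isT)/cliqueP h.
  by apply: h; rewrite ?inE ?ax ?ay ?aQ ?xQ ?xy // eq_sym.
- move=> a; rewrite !inE => /and3P[ay ax aQ].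
  have := nonE (Q :\ x) (subsetDl _ _); rewrite !inE eqxx => /(_ isT)/cliqueP h.
  by apply: h; rewrite ?inE ?ax ?ay ?aQ ?yQ ?andbT // eq_sym.
Qed.

Definition proper e k (c : K -> nat) :=
  (forall v, c v < k) /\ (forall v w, e v w -> c v <> c w).

Theorem andrasfai_erdos_sos e r : 1 < r -> symmetric e -> irreflexive e ->
  clique_free e r -> (forall v, (3 * r - 4) * codeg e v < 3 * #|K|) ->
  exists c, proper e r.-1 c.
Proof.
move=> r1 se0 ie0 cf0 cod0.
have [e' [se ie cf sub mx]] := maximal_clique_free r1 se0 ie0 cf0.
have cod v : (3 * r - 4) * codeg e' v < 3 * #|K|.
  apply: leq_ltn_trans (cod0 v); rewrite leq_mul2l; apply/orP; right.
  by apply/subset_leq_card/subsetP => u; rewrite !inE; apply: contra => /sub.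
have rs : r = (r - 2).+2 by lia.
have tr x y z : ~~ e' x y -> ~~ e' x z -> ~~ e' y z.
  move=> nxy nxz; apply/negP => eyz.
  have xy : x != y by apply/eqP => E; rewrite E eyz in nxz.
  have xz : x != z by apply/eqP => E; rewrite E se eyz in nxy.
  have [Q1 [c1 q1 x1 y1]] := mx _ _ xy nxy.
  have [Q2 [c2 q2 x2 z2]] := mx _ _ xz nxz.
  have /negP := no_wheel #|Q1 :&: Q2| (x, y, z, Q1, Q2) se ie cf rs cod; apply.
  have C1 : #|Q1| == r - 2 by rewrite -c1 subn2.
  have C2 : #|Q2| == r - 2 by rewrite -c2 subn2.
  apply/and5P; split=> //; apply/and4P; split=> //; apply/forall_inP => a aQ.
    by rewrite x1 // y1.
  by rewrite x2 // z2.
have [Q /maxsetP[qQ mxQ] _] : {Q | maxset (clique e') Q & set0 \subset Q}.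
  by apply: maxset_exists; apply/cliqueP => a b; rewrite inE.
have pk v : exists q, (q \in Q) && ~~ e' v q.
  have [vQ|vQ] := boolP (v \in Q); first by exists v; rewrite vQ ie.
  apply/existsP; apply: contraR vQ => /existsPn h.
  have <- : v |: Q = Q; last exact: setU11.
  apply: mxQ; last exact: subsetUr.
  apply: cliqueU1 => // a aQ; apply/negPn/negP => na.
  by have := h a; rewrite aQ na.
exists (fun v => index (xchoose (pk v)) (enum Q)); split=> [v|v w /sub evw].
  apply: (@leq_trans #|Q|); last by rewrite -ltnS prednK ?(ltnW r1) //; exact: clique_freeP cf _ qQ.
  by have /= /andP[vQ _] := xchooseP (pk v); rewrite cardE index_mem mem_enum.
have /= /andP[vQ nv] := xchooseP (pk v); have /= /andP[wQ nw] := xchooseP (pk w).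
move=> E; have {}E : xchoose (pk v) = xchoose (pk w).
  by rewrite -(nth_index v (s := enum Q) (x := xchoose (pk v))) ?mem_enum // E nth_index ?mem_enum.
rewrite {}E se in nv; rewrite se in nw.
by have := tr _ _ _ nv nw; rewrite evw.
Qed.

End AndrasfaiErdosSos.

Section UniqueColouring.
Variables (I : finType) (e : rel I) (r a : nat).
Hypotheses (r1 : 1 < r) (cod : forall v, codeg e v <= a) (ha : (3 * r - 4) * a < 3 * #|I|).

Lemma class_le c i : proper e r.-1 c -> #|[set v | c v == i]| <= a.
Proof.
move=> [_ pc]; have [->|[v]] := set_0Vmem [set v | c v == i]; first by rewrite cards0.
rewrite inE => /eqP cv; apply: leq_trans (cod v); apply/subset_leq_card/subsetP => u.
by rewrite !inE => /eqP cu; apply/negP => /pc; rewrite cu cv.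
Qed.

Lemma class_ge c i : proper e r.-1 c -> i < r.-1 ->
  #|I| <= #|[set v | c v == i]| + (r - 2) * a.
Proof.
move=> pc ir.
have -> : #|I| = \sum_(j < r.-1) #|[set v | c v == j]|.
  rewrite -sum1_card (partition_big (fun v => Ordinal (pc.1 v)) predT) //=.
  apply: eq_bigr => j _; rewrite -sum1_card; apply: eq_bigl => v.
  by rewrite inE -val_eqE.
rewrite (bigD1 (Ordinal ir)) //= leq_add2l.
have -> : (r - 2) * a = \sum_(j < r.-1 | j != Ordinal ir) a.
  rewrite sum_nat_const cardC1 card_ord; congr (_ * _); lia.
by apply: leq_sum => j _; exact: class_le.
Qed.

Lemma unique_colouring f g v w :
  proper e r.-1 f -> proper e r.-1 g -> f v = f w -> g v = g w.
Proof.
move=> pf pg fvw; apply/eqP; apply: contraT => gvw.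
pose F := [set u | f u == f v]; pose G x := [set u | g u == g x].
have UB x : f x = f v -> #|F :|: G x| <= a.
  move=> fx; apply: leq_trans (cod x); apply/subset_leq_card/subsetP => u.
  rewrite !inE => /orP[] /eqP E; apply/negP.
    by move=> /pf.2; rewrite E fx.
  by move=> /pg.2; rewrite E.
have := UB v erefl; have := UB w (esym fvw).
have E x : #|F :|: G x| = #|F :\: G x| + #|G x|.
  by rewrite -(cardsID (G x) (F :|: G x)) setIUl setIid setDUl setDv setU0 addnC (setUidPr (subsetIr _ _)).
rewrite !E.
have : #|F| <= #|F :\: G v| + #|F :\: G w|.
  apply: leq_trans (leq_card_setU _ _); apply/subset_leq_card/subsetP => u uF.
  rewrite !inE in uF *; rewrite uF !andbT -negb_and.
  by apply: contra gvw => /andP[/eqP -> /eqP ->].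
have := class_ge pf (pf.1 v); have := class_ge pg (pg.1 v).
have := class_ge pg (pg.1 w); rewrite -/F -/(G v) -/(G w).
move: ha; set nF := #|F|; set N := #|I| => h1 h2 h3 h4 h5 h6 h7.
have h8 : (3 * r - 4) * a = 3 * ((r - 2) * a) + 2 * a by nia.
lia.
Qed.

End UniqueColouring.

Section ExtendColouring.
Variables (I K : finType) (i : I -> K) (e : rel K) (r a : nat).
Variables (f : I -> nat) (g : K -> nat).
Hypotheses (r1 : 1 < r) (se : symmetric e).
Hypotheses (pf : proper (relpre i e) r.-1 f) (pg : proper e r.-1 g).
Hypothesis cod : forall k, #|[set j | ~~ e k (i j)]| <= a.
Hypothesis ha : (3 * r - 4) * a < 3 * #|I|.

Definition misses (k : K) (c : nat) : bool := [forall j, (f j == c) ==> ~~ e k (i j)].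

Let pgi : proper (relpre i e) r.-1 (g \o i).
Proof. by split=> [v|v w ev]; [exact: pg.1 | exact: pg.2]. Qed.

Let cod' v : codeg (relpre i e) v <= a. Proof. exact: cod. Qed.

Lemma twin k : exists j, g (i j) = g k /\ misses k (f j).
Proof.
have := class_ge r1 cod' ha pgi (pg.1 k).
set G := [set _ | _] => GE.
have [G0|[j]] := set_0Vmem G; first by move: GE ha; rewrite G0 cards0; nia.
rewrite inE /= => /eqP gj; exists j; split=> //.
apply/forallP => j'; apply/implyP => /eqP fj.
have /= E := unique_colouring r1 cod' ha pf pgi fj.
by apply/negP => /pg.2; rewrite E gj.
Qed.

Lemma misses_ex k : exists2 c, c < r.-1 & misses k c.
Proof. by have [j [_ m]] := twin k; exists (f j) => //; exact: pf.1. Qed.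

Lemma misses_inj k c j : c < r.-1 -> misses k c -> misses k (f j) -> f j = c.
Proof.
move=> cr /forallP m1 /forallP m2; apply/eqP; apply: contraT => ne.
have : #|[set v | f v == c] :|: [set v | f v == f j]| <= a.
  apply: leq_trans (cod k); apply/subset_leq_card/subsetP => u.
  rewrite !inE => /orP[] E; first exact: (implyP (m1 u)).
  exact: (implyP (m2 u)).
rewrite cardsU; set X := #|_ :&: _|.
have -> : X = 0.
  apply/eqP; rewrite cards_eq0 -subset0; apply/subsetP => u; rewrite !inE.
  by move=> /andP[/eqP E1 /eqP E2]; rewrite -E2 E1 eqxx in ne.
have := class_ge r1 cod' ha pf cr; have := class_ge r1 cod' ha pf (pf.1 j).
move: ha; have h8 : (3 * r - 4) * a = 3 * ((r - 2) * a) + 2 * a by nia.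
lia.
Qed.

Lemma misses_same k l c : c < r.-1 -> misses k c -> misses l c -> ~~ e k l.
Proof.
move=> cr mk ml; apply/negP => /pg.2; apply.
have [j [gj mj]] := twin k; have [j' [gj' mj']] := twin l.
rewrite -gj -gj'; apply: (unique_colouring r1 cod' ha pf pgi).
by rewrite (misses_inj cr mk mj) (misses_inj cr ml mj').
Qed.

End ExtendColouring.

(** * Stability of dense graphs with few cliques *)

Section Marginals.
Variable X : finType.

Lemma card_extensions (A B : finType) (g : A -> B) (y : {ffun A -> X}) : injective g ->
  #|[set x : {ffun B -> X} | [ffun a => x (g a)] == y]| = (#|X| ^ (#|B| - #|A|))%N.
Proof.
move=> ig.
pose F b : {pred X} := if [pick a | g a == b] is Some a then pred1 (y a) else predT.
have Fg a : F (g a) = pred1 (y a).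
  rewrite /F; case: pickP => [a' /eqP/ig -> //|/(_ a)]; by rewrite eqxx.
have -> : [set x : {ffun B -> X} | [ffun a => x (g a)] == y] = [set x in family F].
  apply/setP => x; rewrite !inE; apply/eqP/familyP => [E b|h].
    rewrite /F; case: pickP => [a /eqP <-|//].
    by rewrite -E ffunE inE.
  apply/ffunP => a; rewrite ffunE; apply/eqP.
  by have := h (g a); rewrite Fg.
rewrite cardsE card_family foldrE big_image /=.
rewrite (eq_bigr (fun b => if b \notin codom g then #|X| else 1%N)); last first.
  move=> b _; rewrite /F; case: pickP => [a /eqP <-|h].
    by rewrite codom_f /= card1.
  have -> : b \notin codom g by apply/codomP => -[a E]; have := h a; rewrite E eqxx.
  by apply: eq_card.
rewrite -big_mkcond prod_nat_const; congr (_ ^ _)%N.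
by rewrite -(card_codom ig) -(cardC (mem (codom g))) addKn; apply: eq_card => b.
Qed.

Lemma card_marginal (A B : finType) (g : A -> B) (P : pred {ffun A -> X}) : injective g ->
  #|[set x : {ffun B -> X} | P [ffun a => x (g a)]]| =
  (#|X| ^ (#|B| - #|A|) * #|[set y | P y]|)%N.
Proof.
move=> ig; rewrite -sum1_card.
rewrite (partition_big (fun x : {ffun B -> X} => [ffun a => x (g a)]) P) => [|x]; last by rewrite inE.
rewrite mulnC -sum_nat_const big_set /=; apply: eq_bigr => y Py.
rewrite -(card_extensions y ig) sum1dep_card; apply: eq_card => x.
by rewrite !inE; case: eqP => [->|]; rewrite ?andbF // Py.
Qed.

End Marginals.

Lemma expR_le_quad (R : realType) (t : R) :
  (0 <= t <= 1 / 2 -> expR t <= 1 + t + 2 * t ^+ 2)%R.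
Proof.
move=> /andP[t0 t1].
have h : (1 - t <= expR (- t))%R by have := expR_ge1Dx (- t)%R; lra.
have e0 := expR_gt0 t.
have : ((1 - t) * expR t <= 1)%R.
  by apply: (le_trans (ler_wpM2r (ltW e0) h)); rewrite -expRD addNr expR0.
move=> h2; have t2 : (0 < 1 - t)%R by lra.
rewrite -(ler_pM2l t2); apply: (le_trans h2); nra.
Qed.

(* A tuple [x] stands for a sample of [m] vertices of [X] followed by two more,
   at the indices [None] and [Some None]. *)
Section Sampling.
Variables (X : finType) (D : rel X) (r m a : nat).
Hypotheses (r1 : 1 < r) (sD : symmetric D) (iD : irreflexive D).
Hypothesis ha : (3 * r - 4) * (a + 2) < 3 * m.

Definition sample_bad (x : {ffun option (option 'I_m) -> X}) : bool :=
  ~~ clique_free (relpre x D) r ||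
  [exists k, a < #|[set j : 'I_m | ~~ D (x k) (x (Some (Some j)))]|].

Definition sample_ext (y : {ffun 'I_m -> X}) (v w : X) : {ffun option (option 'I_m) -> X} :=
  [ffun k => if k is Some k' then (if k' is Some j then y j else w) else v].

Lemma good_colouring x : ~~ sample_bad x -> exists g, proper (relpre x D) r.-1 g.
Proof.
rewrite negb_or negbK => /andP[cf /existsPn cod].
apply: andrasfai_erdos_sos => //; [by move=> i j /= | by move=> i /= |].
move=> k; have := cod k; rewrite -leqNgt => le.
have : codeg (relpre x D) k <= a + 2.
  apply: leq_trans (leq_add le (leqnn 2)).
  pose h (j : 'I_m) : option (option 'I_m) := Some (Some j).
  have ih : injective h by move=> i j [].
  apply: (@leq_trans #|(h @: [set j : 'I_m | ~~ D (x k) (x (Some (Some j)))]) :|: [set None; Some None]|).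
    rewrite /codeg; apply/subset_leq_card/fintype.subsetP => -[[j|]|] /=; rewrite !inE ?orbT // => nD.
    by apply/orP; left; apply/imsetP; exists j; rewrite // inE.
  apply: leq_trans (leq_card_setU _ _) _.
  by rewrite card_imset // cards2.
rewrite !card_option card_ord; move: (codeg _ _) => c hc.
apply: leq_ltn_trans (leq_mul (leqnn _) hc) _; lia.
Qed.

(* Fix a colouring of the sample.  As good samples are uniquely colourable, a
   vertex misses exactly one colour class, and that is its colour in every
   extension; so an edge inside a class of [c] has a bad extension. *)
Lemma sample_colouring (y : {ffun 'I_m -> X}) : exists c : X -> nat,
  (forall v, c v < r.-1) /\
  (forall v w, D v w -> c v = c w -> sample_bad (sample_ext y v w)).
Proof.
have r0 : 0 < r.-1 by lia.
have [/existsP[v0 /existsP[w0 /good_colouring[g0 pg0]]]|none] :=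
  boolP [exists v, exists w, ~~ sample_bad (sample_ext y v w)]; last first.
  exists (fun=> 0); split=> // v w _ _; apply: contraNT none => nb.
  by apply/existsP; exists v; apply/existsP; exists w.
pose f (j : 'I_m) := g0 (Some (Some j)).
have pf : proper (relpre y D) r.-1 f.
  split=> [v|v w /= vw]; first exact: pg0.1.
  by apply: pg0.2; rewrite /= !ffunE.
pose ms v (i : 'I_r.-1) := [forall j, (f j == i) ==> ~~ D v (y j)].
exists (fun v => if [pick i | ms v i] is Some i then i : nat else 0).
split=> [v|v w vw]; first by case: pickP.
move=> E; apply: contraT => nb; have [g pg] := good_colouring nb.
set x := sample_ext y v w in nb pg.
pose h (j : 'I_m) : option (option 'I_m) := Some (Some j).
have sx : symmetric (relpre x D) by move=> i j /=.
have pf' : proper (relpre h (relpre x D)) r.-1 f.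
  by split=> [j|i j /=]; [exact: pf.1 | rewrite !ffunE => /pf.2].
have cod k : #|[set j | ~~ relpre x D k (h j)]| <= a.
  by move: nb; rewrite negb_or => /andP[_ /existsPn/(_ k)]; rewrite -leqNgt.
have ha' : (3 * r - 4) * a < 3 * #|'I_m| by rewrite card_ord; apply: leq_ltn_trans ha; rewrite leq_mul2l leq_addr orbT.
have mE k (i : nat) : misses h (relpre x D) f k i = [forall j, (f j == i) ==> ~~ D (x k) (y j)].
  by apply: eq_forallb => j; rewrite /= !ffunE.
have pk k u : x k = u -> exists2 i : 'I_r.-1, [pick i | ms u i] = Some i & misses h (relpre x D) f k i.
  move=> xk; have [c cr mc] := misses_ex r1 pf' pg cod ha' k.
  case: pickP => [i mi|/(_ (Ordinal cr))]; last by rewrite /ms -xk -mE mc.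
  by exists i => //; rewrite mE xk.
have [i Ei mi] := pk None v (ffunE _ _); have [j Ej mj] := pk (Some None) w (ffunE _ _).
rewrite Ei Ej in E; rewrite -E in mj.
have := misses_same r1 pf' pg cod ha' (ltn_ord i) mi mj.
by rewrite /= !ffunE vw.
Qed.

Lemma sample_average : exists2 c : X -> nat, (forall v, c v < r.-1) &
  #|[set p : X * X | D p.1 p.2 && (c p.1 == c p.2)]| * #|X| ^ m <= #|[set x | sample_bad x]|.
Proof.
pose B (y : {ffun 'I_m -> X}) := \sum_(p : X * X) sample_bad (sample_ext y p.1 p.2).
have [n0|n0] := posnP #|X|.
  exists (fun=> 0); first by lia.
  suff -> : #|[set p : X * X | D p.1 p.2 && true]| = 0 by [].
  apply/eqP; rewrite cards_eq0; apply/eqP/setP => -[u v].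
  by have := fintype0 (T := X) u.
have /card_gt0P[u0 _] : 0 < #|X| by [].
have [y hy] : exists y, B y * #|X| ^ m <= \sum_y B y.
  have [y _ hy] := arg_minnP (P := predT) B (isT : predT [ffun _ : 'I_m => u0]).
  exists y; rewrite -{1}(card_ord m) -card_ffun mulnC -sum_nat_const.
  by apply: leq_sum => z _; exact: hy.
have [c [cr hc]] := sample_colouring y.
exists c => //; apply: leq_trans (leq_trans _ hy) _.
  rewrite leq_mul2r; apply/orP; right.
  rewrite /B -sum1_card big_mkcond; apply: leq_sum => -[v w] _ /=.
  by rewrite inE /=; case: ifP => // /andP[vw /eqP/(hc _ _ vw) ->].
rewrite pair_big /= -sum1_card [X in _ <= X]big_mkcond /=.
pose q (z : {ffun 'I_m -> X} * (X * X)) := sample_ext z.1 z.2.1 z.2.2.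
have iq : injective q.
  move=> [y1 [v1 w1]] [y2 [v2 w2]] /ffunP E.
  have := E None; have := E (Some None); rewrite !ffunE /= => -> ->.
  by congr (_, _); apply/ffunP => j; have := E (Some (Some j)); rewrite !ffunE.
rewrite (eq_bigr (fun z => sample_bad (q z) : nat)) //.
rewrite -(big_imset (h := q) (A := predT) (fun x => sample_bad x : nat)) /=; last by move=> ? ? _ _ /iq.
rewrite [X in X <= _]big_mkcond; apply: leq_sum => x _; rewrite inE.
by case: ifP => //; case: sample_bad.
Qed.

End Sampling.

Local Open Scope ring_scope.

Definition clique_tuple (X : finType) (D : rel X) (r : nat) (y : {ffun 'I_r -> X}) : bool :=
  [forall i, forall j, (i != j) ==> D (y i) (y j)].

Lemma expR_le_inv_sqr (R : realType) (y : R) : 0 < y -> expR (- y) <= 4 / y ^+ 2.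
Proof.
move=> y0; have h : y / 2 <= expR (y / 2).
  by have := expR_ge1Dx (y / 2); lra.
have e : expR y = expR (y / 2) ^+ 2 by rewrite expr2 -expRD; congr expR; lra.
have h2 : y ^+ 2 / 4 <= expR y by rewrite e; nra.
have y2 : 0 < y ^+ 2 by rewrite exprn_gt0.
rewrite expRN -[leRHS]invrK lef_pV2 ?posrE ?expR_gt0 ?invr_gt0 ?divr_gt0 //.
by rewrite invf_div.
Qed.

Section SamplingProbability.
Variables (R : realType) (X : finType) (D : rel X) (r m a : nat).

Lemma card_clique_samples :
  (#|[set x : {ffun option (option 'I_m) -> X} | ~~ clique_free (relpre x D) r]| <=
   2 ^ m.+2 * (#|X| ^ (m.+2 - r) * #|[set y : {ffun 'I_r -> X} | clique_tuple D y]|))%N.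
Proof.
pose K := option (option 'I_m).
have cK : #|{: K}| = m.+2 by rewrite !card_option card_ord.
pose S (Q : {set K}) := [set x : {ffun K -> X} | (#|Q| == r) && clique (relpre x D) Q].
apply: (@leq_trans (\sum_(Q : {set K}) #|S Q|)).
  apply: leq_trans (_ : (#|\bigcup_(Q : {set K}) S Q| <= _)%N).
    apply/subset_leq_card/fintype.subsetP => x; rewrite inE negb_forall => /existsP[Q].
    rewrite negb_imply negbK => /andP[cQ qQ]; apply/bigcupP; exists Q => //.
    by rewrite inE cQ.
  apply: (big_ind2 (fun (A : {set {ffun K -> X}}) n => (#|A| <= n)%N)) => //.
    by rewrite cards0.
  by move=> A1 n1 A2 n2 h1 h2; apply: leq_trans (leq_card_setU _ _) (leq_add h1 h2).
have -> : (2 ^ m.+2)%N = #|{set K}|.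
  by rewrite -cK -cardsT -card_powerset powersetT cardsT.
rewrite -sum_nat_const; apply: leq_sum => Q _.
have [cQ|nQ] := eqVneq #|Q| r; last first.
  by rewrite (_ : S Q = finset.set0) ?cards0 //; apply/setP => x; rewrite !inE (negbTE nQ).
pose g (i : 'I_r) : K := enum_val (cast_ord (esym cQ) i).
have ig : injective g by move=> i j /enum_val_inj/cast_ord_inj.
have := card_marginal (@clique_tuple X D r) ig; rewrite cK card_ord => <-.
apply/subset_leq_card/fintype.subsetP => x; rewrite !inE => /andP[_ /cliqueP q].
apply/forallP => i; apply/forallP => j; apply/implyP => ij; rewrite !ffunE.
by apply: q; rewrite ?enum_valP //; apply: contra ij => /eqP/ig ->.
Qed.

Lemma card_hit (K : finType) (L : {set X}) :
  (#|[set x : {ffun K -> X} | [exists k, x k \in L]]| <= #|K| * (#|X| ^ (#|K| - 1) * #|L|))%N.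
Proof.
apply: (@leq_trans (\sum_(k : K) #|[set x : {ffun K -> X} | x k \in L]|)).
  apply: leq_trans (_ : (#|\bigcup_(k : K) [set x : {ffun K -> X} | x k \in L]| <= _)%N).
    apply/subset_leq_card/fintype.subsetP => x; rewrite inE => /existsP[k xk].
    by apply/bigcupP; exists k; rewrite ?inE.
  apply: (big_ind2 (fun (A : {set {ffun K -> X}}) n => (#|A| <= n)%N)) => //.
    by rewrite cards0.
  by move=> A1 n1 A2 n2 h1 h2; apply: leq_trans (leq_card_setU _ _) (leq_add h1 h2).
rewrite -sum_nat_const; apply: leq_sum => k _.
have ik : injective (fun _ : 'I_1 => k) by move=> i j _; rewrite !ord1.
have := card_marginal (fun y : {ffun 'I_1 -> X} => y ord0 \in L) ik.
rewrite card_ord => h; apply: (@leq_trans (#|X| ^ (#|K| - 1) * #|[set y : {ffun 'I_1 -> X} | y ord0 \in L]|)).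
  by rewrite -h; apply/eq_leq/eq_card => x; rewrite !inE ffunE.
rewrite leq_mul2l; apply/orP; right.
pose p (y : {ffun 'I_1 -> X}) := y ord0.
have ip : injective p by move=> y z E; apply/ffunP => i; rewrite ord1.
rewrite -(card_imset _ ip); apply/subset_leq_card/fintype.subsetP => u /imsetP[y].
by rewrite inE => yL ->.
Qed.

Lemma chernoff_samples (alpha t : R) (k : option (option 'I_m)) (L : {set X}) :
  0 <= t <= 1 / 2 -> 0 <= alpha ->
  (forall v, v \notin L -> (codeg D v)%:R <= alpha * #|X|%:R) ->
  (#|[set x : {ffun option (option 'I_m) -> X} | (x k \notin L) &&
     (a < #|[set j : 'I_m | ~~ D (x k) (x (Some (Some j)))]|)%N]|)%:R
  <= #|X|%:R ^+ m.+2 * expR (m.+1%:R * ((t + 2 * t ^+ 2) * alpha) - t * a%:R).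
Proof.
move=> t01 a0 hL; set S := [set x | _].
pose h (j : 'I_m) : option (option 'I_m) := Some (Some j).
pose N (v : X) (b : option (option 'I_m)) (u : X) : R :=
  if b == k then (u == v)%:R else
  if b is Some (Some _) then expR (t * (~~ D v u)%:R) else 1.
have N0 v b u : 0 <= N v b u.
  by rewrite /N; case: ifP => // _; case: b => [[b|]|] //; exact: expR_ge0.
have pt x : x \in S -> expR (t * a%:R) <= \sum_(v in ~: L) \prod_b N v b (x b).
  rewrite inE => /andP[xk lt].
  rewrite (bigD1 (x k)) ?inE //=; apply: ler_wpDr.
    by apply: sumr_ge0 => v _; apply: prodr_ge0.
  have -> : \prod_b N (x k) b (x b) =
     \prod_(b | b != k) (if b is Some (Some _) then expR (t * (~~ D (x k) (x b))%:R) else 1).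
    rewrite (bigD1 k) //= {1}/N !eqxx mul1r; apply: eq_bigr => b bk.
    by rewrite /N (negbTE bk).
  have -> : \prod_(b | b != k) (if b is Some (Some _) then expR (t * (~~ D (x k) (x b))%:R) else 1) =
     \prod_(b | b != k) expR (t * (if b is Some (Some _) then (~~ D (x k) (x b))%:R else 0)).
    by apply: eq_bigr => -[[b|]|] _ //; rewrite mulr0 expR0.
  rewrite -expR_sum ler_expR -mulr_sumr; apply: ler_wpM2l; first by case/andP: t01.
  pose A := [set j : 'I_m | ~~ D (x k) (x (Some (Some j)))].
  have : (a <= #|(h @: A) :\ k|)%N.
    have ih : injective h by move=> i j [].
    have : (a < #|h @: A|)%N by rewrite card_imset.
    rewrite (cardsD1 k); case: (k \in _) => //; by rewrite ?add0n ?add1n // => /ltnW.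
  rewrite -(ler_nat R) => /le_trans; apply.
  rewrite -sum1_card natr_sum big_mkcond [leRHS]big_mkcond /=.
  apply: ler_sum => b _; rewrite !inE.
  case: (b != k) => //=; case: ifP => [/imsetP[j]|_].
    by rewrite inE => nD ->; rewrite nD.
  by case: b => [[b|]|].
have : #|S|%:R * expR (t * a%:R) <= \sum_(x : {ffun option (option 'I_m) -> X}) \sum_(v in ~: L) \prod_b N v b (x b).
  rewrite -sum1_card natr_sum mulr_suml [leLHS]big_mkcond /=; apply: ler_sum => x _.
  case: ifP => [/pt|_]; first by rewrite mul1r.
  by apply: sumr_ge0 => v _; apply: prodr_ge0.
rewrite exchange_big /=.
set E := expR ((t + 2 * t ^+ 2) * alpha).
have bd v : v \in ~: L ->
   \sum_(x : {ffun option (option 'I_m) -> X}) \prod_b N v b (x b) <= (#|X|%:R * E) ^+ m.+1.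
  rewrite inE => vL; rewrite -bigA_distr_bigA (bigD1 k) //=.
  have -> : \sum_u N v k u = 1.
    rewrite (bigD1 v) //= {1}/N !eqxx big1 ?addr0 // => u uv.
    by rewrite /N eqxx (negbTE uv).
  rewrite mul1r.
  have -> : (#|X|%:R * E) ^+ m.+1 = \prod_(b : option (option 'I_m) | b != k) (#|X|%:R * E).
    by rewrite prodr_const cardC1 !card_option card_ord.
  have E1 : 1 <= E.
    rewrite -expR0 ler_expR; apply: mulr_ge0 => //.
    by case/andP: t01 => t0 _; rewrite addr_ge0 // mulr_ge0 // sqr_ge0.
  apply: ler_prod => b bk; apply/andP; split; first exact: sumr_ge0.
  have : \sum_u N v b u <= #|X|%:R + (t + 2 * t ^+ 2) * (codeg D v)%:R.
    have -> : #|X|%:R + (t + 2 * t ^+ 2) * (codeg D v)%:R =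
       \sum_(u : X) (1 + (t + 2 * t ^+ 2) * (~~ D v u)%:R).
      rewrite big_split /= sumr_const -mulr_sumr; congr (_ + _ * _).
      rewrite /codeg -sum1_card natr_sum [LHS]big_mkcond; apply: eq_bigr => u _.
      by rewrite inE; case: (D v u).
    apply: ler_sum => u _; rewrite /N (negbTE bk).
    have q0 : 0 <= (t + 2 * t ^+ 2) * (~~ D v u)%:R.
      by apply: mulr_ge0 => //; case/andP: t01 => t0 _; rewrite addr_ge0 // mulr_ge0 // sqr_ge0.
    case: b bk => [[b|]|] bk; rewrite ?lerDl //.
    case: (D v u) q0 => /=; rewrite ?mulr0 ?expR0 ?addr0 // mulr1 => _.
    by rewrite mulr1 addrA; apply: expR_le_quad.
  move/le_trans; apply; apply: (@le_trans _ _ (#|X|%:R * (1 + (t + 2 * t ^+ 2) * alpha))).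
    rewrite mulrDr mulr1 lerD2l [leRHS]mulrCA; apply: ler_wpM2l.
      by case/andP: t01 => t0 _; rewrite addr_ge0 // mulr_ge0 // sqr_ge0.
    by rewrite mulrC; apply: hL.
  by apply: ler_wpM2l => //; rewrite /E; exact: expR_ge1Dx.
move=> h1; have {h1} h2 : #|S|%:R * expR (t * a%:R) <= #|X|%:R * (#|X|%:R * E) ^+ m.+1.
  apply: (le_trans h1); apply: (le_trans (ler_sum _ bd)).
  rewrite sumr_const -[leLHS]mulr_natl; apply: ler_wpM2r; first by rewrite exprn_ge0 // mulr_ge0 // expR_ge0.
  by rewrite ler_nat max_card.
rewrite expRD expRN mulrA ler_pdivlMr ?expR_gt0 //; apply: (le_trans h2).
by rewrite exprMn (exprS _ m.+1) -mulrA !ler_wpM2l ?exprn_ge0 // /E -expRM_natl.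
Qed.

End SamplingProbability.

Lemma le_of_eq (R : numDomainType) (x y : R) : x = y -> x <= y.
Proof. by move->. Qed.

Section DenseStability.
Variables (R : realType) (r : nat).
Hypothesis r1 : (1 < r)%N.

Let a0 : R := 3 / (3 * r%:R - 4).

Lemma ratio_gt0 : 0 < 3 * r%:R - 4 :> R.
Proof.
have : (2 : R) <= r%:R by rewrite ler_nat.
lra.
Qed.

Lemma dense_stability_params (g zeta : R) : 0 < g -> g <= 1 -> g <= a0 -> 0 < zeta ->
  exists m a : nat, [/\ (r <= m)%N, ((3 * r - 4) * (a + 2) < 3 * m)%N &
    m.+2%:R * expR (m.+1%:R * ((g / 24 + 2 * (g / 24) ^+ 2) * (a0 - g / 2)) - g / 24 * a%:R) <= zeta / 3].
Proof.
move=> g0 g1 ga z0; have d0 := ratio_gt0.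
have r2 : (2 : R) <= r%:R by rewrite ler_nat.
have a0le : a0 <= 3 / 2 by rewrite /a0 ler_pdivrMr //; lra.
have a00 : 0 < a0 by rewrite divr_gt0.
set t := g / 24; set al := a0 - g / 2.
have t0 : 0 < t by rewrite /t; lra.
have t1 : t <= 1 / 24 by rewrite /t; lra.
pose kap : R := 3 * t ^+ 2.
have k0 : 0 < kap by apply: mulr_gt0; [lra | exact: exprn_gt0].
pose e1 : R := expR 1.
have e10 : 0 < e1 by exact: expR_gt0.
pose B : R := 36 * e1 / (kap ^+ 2 * zeta).
have k20 : 0 < kap ^+ 2 by exact: exprn_gt0.
have B0 : 0 < B by apply: divr_gt0; apply: mulr_gt0 => //; lra.
pose m := ((Num.truncn B).+1 + (Num.truncn (12 / g)).+1 + 3 * r)%N.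
have mB : B < m%:R.
  apply: (@lt_le_trans _ _ (Num.truncn B).+1%:R); first exact: truncnS_gt.
  by rewrite ler_nat /m -addnA leq_addr.
have mg : 12 / g < m%:R.
  apply: (@lt_le_trans _ _ (Num.truncn (12 / g)).+1%:R); first exact: truncnS_gt.
  by rewrite ler_nat /m addnAC leq_addl.
have m0 : 0 < m%:R :> R by apply: lt_trans mB.
pose z : R := (a0 - g / 4) * m%:R.
have z0' : 0 <= z by apply: mulr_ge0; lra.
pose a := (Num.truncn z).+1.
have za : z <= a%:R by exact/ltW/truncnS_gt.
have az : a%:R <= z + 1 by rewrite /a -natr1 lerD2r truncn_le.
have rm : (r <= m)%N by apply: leq_trans (leq_addl _ _); rewrite leq_pmull.
have m1 : (0 < m)%N by rewrite (leq_trans _ rm) // ltnW.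
have r4 : (4 <= 3 * r)%N by apply: (@leq_trans (3 * 2)); rewrite // leq_mul2l.
exists m, a; split=> //.
  rewrite -(ltr_nat R) !natrM natrB // natrM natrD.
  rewrite mulrC; have -> : (3 * m%:R = (a0 * m%:R) * (3 * r%:R - 4) :> R).
    by rewrite /a0; field; lra.
  rewrite ltr_pM2r //.
  have : 12 < m%:R * g by rewrite -ltr_pdivrMr.
  rewrite /z in az; lra.
have le1 : m.+1%:R * ((t + 2 * t ^+ 2) * al) - t * a%:R <= 1 - m%:R * kap.
  have al1 : al <= 3 / 2 by rewrite /al; lra.
  have al0 : 0 <= al by rewrite /al; lra.
  have h1 : t * z <= t * a%:R by rewrite ler_pM2l.
  have tt : 0 <= t ^+ 2 by exact: sqr_ge0.
  have t2 : t ^+ 2 <= t by rewrite expr2 ler_piMr ?ltW //; lra.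
  have h2 : (t + 2 * t ^+ 2) * al <= 3 * t * (3 / 2) by apply: ler_pM => //; lra.
  have h3 : t ^+ 2 * al <= t ^+ 2 * (3 / 2) by exact: ler_wpM2l.
  have h4 : m%:R * (t ^+ 2 * al) <= m%:R * (t ^+ 2 * (3 / 2)) by apply: ler_wpM2l => //; exact: ltW.
  have h5 : g = 24 * t by rewrite /t; lra.
  rewrite -natr1 /kap; rewrite /z h5 in h1; rewrite /al h5 in h2 h3 h4 *; lra.
have -> : zeta / 3 = 3 * m%:R * (zeta / (9 * m%:R)) by field; lra.
have m2 : m.+2%:R <= 3 * m%:R :> R.
  rewrite -addn2 natrD; have : (1 : R) <= m%:R by rewrite ler1n.
  lra.
apply: ler_pM => //; rewrite ?expR_ge0 //.
apply: (@le_trans _ _ (e1 * expR (- (m%:R * kap)))).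
  by rewrite -expRD ler_expR.
apply: (@le_trans _ _ (e1 * (4 / (m%:R * kap) ^+ 2))).
  by rewrite ler_pM2l // expR_le_inv_sqr // mulr_gt0.
have : 36 * e1 <= m%:R * (kap ^+ 2 * zeta).
  by rewrite -ler_pdivrMr ?mulr_gt0 ?exprn_gt0 //; exact: ltW.
move=> hh.
rewrite ler_pdivlMr ?mulr_gt0 //.
have -> : e1 * (4 / (m%:R * kap) ^+ 2) * (9 * m%:R) = 36 * e1 / (m%:R * kap ^+ 2).
  by field; rewrite !gt_eqF.
rewrite ler_pdivrMr; last by rewrite mulr_gt0.
by apply: (le_trans hh); apply: le_of_eq; ring.
Qed.

Theorem dense_stability (gamma zeta : R) : 0 < gamma -> 0 < zeta ->
  exists eps eta : R, [/\ 0 < eps, 0 < eta & forall (X : finType) (D : rel X),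
    symmetric D -> irreflexive D ->
    (forall A : {set X}, (\sum_(v in A) codeg D v)%:R <=
        (a0 - gamma) * #|X|%:R * #|A|%:R + eta * #|X|%:R ^+ 2) ->
    #|[set y : {ffun 'I_r -> X} | clique_tuple D y]|%:R <= eps * #|X|%:R ^+ r ->
    exists2 c : X -> nat, (forall v, c v < r.-1)%N &
      #|[set p : X * X | D p.1 p.2 && (c p.1 == c p.2)]|%:R <= zeta * #|X|%:R ^+ 2].
Proof.
move=> gam0 z0; have d0 := ratio_gt0.
have a00 : 0 < a0 by rewrite divr_gt0.
pose g := Num.min gamma (Num.min 1 a0).
have g0 : 0 < g by rewrite !lt_min gam0 a00 ltr01.
have [gg g1 ga] : [/\ g <= gamma, g <= 1 & g <= a0].
  by rewrite !ge_min !lexx !orbT.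
have [m [a [rm ha hexp]]] := dense_stability_params g0 g1 ga z0.
set E := expR _ in hexp.
have [M ME] : exists M, M = m.+2 by exists m.+2.
rewrite -ME in hexp.
have M0 : (0 < M)%N by rewrite ME.
have MR : 0 < M%:R :> R by rewrite ltr0n.
exists (zeta / (3 * 2 ^+ M)), (g * zeta / (6 * M%:R)); split.
- by rewrite divr_gt0 // mulr_gt0 // exprn_gt0.
- by rewrite divr_gt0 // mulr_gt0.
move=> X D sD iD hA hK; set n : R := #|X|%:R in hA hK *.
have [X0|X0] := posnP #|X|.
  exists (fun=> 0%N); first by move=> v; have := fintype0 (T := X) v.
  rewrite (_ : #|_| = 0)%N ?mulr_ge0 ?sqr_ge0 //; first exact: ltW.
  apply/eqP; rewrite cards_eq0; apply/eqP/setP => -[u v].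
  by have := fintype0 (T := X) u.
have n0 : 0 < n by rewrite ltr0n.
pose L := [set v | (a0 - g / 2) * n < (codeg D v)%:R].
have cL : #|L|%:R <= 2 * (zeta / (6 * M%:R)) * n.
  have h1 : (a0 - g / 2) * n * #|L|%:R <= (\sum_(v in L) codeg D v)%:R.
    rewrite natr_sum mulr_natr -sumr_const; apply: ler_sum => v.
    by rewrite inE => /ltW.
  have h2 : (a0 - gamma) * n * #|L|%:R <= (a0 - g) * n * #|L|%:R.
    by apply: ler_wpM2r => //; apply: ler_wpM2r; [exact: ltW | lra].
  have h3 : g / 2 * n * #|L|%:R <= g * (zeta / (6 * M%:R)) * n ^+ 2.
    have := hA L; rewrite mulrA; lra.
  have gn : 0 < g / 2 * n by rewrite mulr_gt0 // divr_gt0.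
  rewrite -(ler_pM2l gn); apply: (le_trans h3); apply: le_of_eq; rewrite expr2; field.
  by rewrite gt_eqF.
have [c cr hc] := sample_average r1 sD iD ha.
exists c => //.
rewrite -(ler_pM2r (exprn_gt0 m n0)).
move: hc; rewrite -(ler_nat R) natrM natrX => /le_trans; apply.
rewrite -mulrA -exprD add2n -ME.
pose S1 := [set x : {ffun option (option 'I_m) -> X} | ~~ clique_free (relpre x D) r].
pose S2 := [set x : {ffun option (option 'I_m) -> X} | [exists k, x k \in L]].
pose S3 k := [set x : {ffun option (option 'I_m) -> X} | (x k \notin L) &&
     (a < #|[set j : 'I_m | ~~ D (x k) (x (Some (Some j)))]|)%N].
have cM : #|{: option (option 'I_m)}| = M by rewrite !card_option card_ord ME.
have sub : (#|[set x : {ffun option (option 'I_m) -> X} | sample_bad D r a x]| <= #|S1| + (#|S2| + \sum_k #|S3 k|))%N.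
  apply: (@leq_trans #|S1 :|: (S2 :|: \bigcup_k S3 k)|).
    apply/subset_leq_card/fintype.subsetP => x; rewrite !inE => /orP[->//|/existsP[k hk]].
    apply/orP; right; case: (boolP (x k \in L)) => xL.
      by apply/orP; left; apply/existsP; exists k.
    by apply/orP; right; apply/bigcupP; exists k => //; rewrite inE xL.
  apply: leq_trans (leq_card_setU _ _) _; rewrite leq_add2l.
  apply: leq_trans (leq_card_setU _ _) _; rewrite leq_add2l.
  apply: (big_ind2 (fun (A : {set {ffun _ -> X}}) n => (#|A| <= n)%N)) => //.
    by rewrite cards0.
  by move=> A1 n1 A2 n2 h1 h2; apply: leq_trans (leq_card_setU _ _) (leq_add h1 h2).
move: sub; rewrite -(ler_nat R) !natrD natr_sum => /le_trans; apply.
have -> : zeta * n ^+ M = zeta / 3 * n ^+ M + (zeta / 3 * n ^+ M + zeta / 3 * n ^+ M) by field.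
apply: lerD; [|apply: lerD].
- have := card_clique_samples D r m; rewrite -ME -(ler_nat R) !natrM => /le_trans; apply.
  rewrite !natrX -/n.
  apply: (@le_trans _ _ (2 ^+ M * (n ^+ (M - r) * (zeta / (3 * 2 ^+ M) * n ^+ r)))).
    apply: ler_wpM2l; first exact: exprn_ge0.
    by apply: ler_wpM2l => //; exact/exprn_ge0/ltW.
  have EM : n ^+ M = n ^+ (M - r) * n ^+ r.
    by rewrite -exprD subnK // ME (leq_trans rm) // -addn2 leq_addr.
  have : (2 : R) ^+ M != 0 by rewrite expf_neq0.
  rewrite EM; move: (2 ^+ M) (n ^+ (M - r)) (n ^+ r) => P u w P0.
  by apply: le_of_eq; field.
- have := card_hit (option (option 'I_m)) L; rewrite cM -(ler_nat R) !natrM => /le_trans; apply.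
  have -> : (M - 1 = m.+1)%N by rewrite ME subn1.
  rewrite natrX -/n.
  apply: (@le_trans _ _ (M%:R * (n ^+ m.+1 * (2 * (zeta / (6 * M%:R)) * n)))).
    apply: ler_wpM2l => //.
    by apply: ler_wpM2l => //; exact/exprn_ge0/ltW.
  have -> : n ^+ M = n * n ^+ m.+1 by rewrite ME exprS.
  move: (n ^+ m.+1) (M%:R : R) MR => u w w0; apply: le_of_eq; field.
  by rewrite gt_eqF.
- apply: (@le_trans _ _ (\sum_(k : option (option 'I_m)) n ^+ M * E)).
    apply: ler_sum => k _; rewrite ME; apply: chernoff_samples; try lra.
    by move=> v; rewrite inE -leNgt.
  rewrite sumr_const cM -[leLHS]mulr_natl mulrCA [leRHS]mulrC.
  by apply: ler_wpM2l => //; exact/exprn_ge0/ltW.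
Qed.

End DenseStability.

(** * Supersaturation *)

Section BlowUp.
Variables (R : realType) (T : finType).

Definition fcons (X : Type) (r : nat) (v : X) (y : {ffun 'I_r -> X}) : {ffun 'I_r.+1 -> X} :=
  [ffun i => oapp y v (unlift ord0 i)].

Lemma fcons_lift (X : Type) r (v : X) (y : {ffun 'I_r -> X}) i : fcons v y (lift ord0 i) = y i.
Proof. by rewrite ffunE liftK. Qed.

Lemma fcons0 (X : Type) r (v : X) (y : {ffun 'I_r -> X}) : fcons v y ord0 = v.
Proof. by rewrite ffunE unlift_none. Qed.

Lemma sum_fcons (X : finType) r (F : {ffun 'I_r.+1 -> X} -> R) :
  \sum_x F x = \sum_v \sum_y F (fcons v y).
Proof.
rewrite pair_big /= (reindex (fun p : X * {ffun 'I_r -> X} => fcons p.1 p.2)) //=.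
exists (fun x => (x ord0, [ffun i => x (lift ord0 i)])).
  move=> [v y] _ /=; rewrite fcons0; congr (_, _).
  by apply/ffunP => i; rewrite ffunE fcons_lift.
move=> x _; apply/ffunP => i /=; have [j ->|->] := unliftP ord0 i.
  by rewrite fcons_lift ffunE.
by rewrite fcons0.
Qed.

Lemma many_above (A : finType) (F : A -> R) (N e : R) : 0 <= N -> 0 <= e ->
  (forall a, 0 <= F a <= N) -> e * (#|A|%:R * N) <= \sum_a F a ->
  e / 2 * #|A|%:R * N <= N * #|[set a | e / 2 * N <= F a]|%:R.
Proof.
move=> N0 e0 FN h; set S := [set a | _].
have : \sum_a F a <= \sum_a (e / 2 * N + (a \in S)%:R * N).
  apply: ler_sum => a _; case/andP: (FN a) => F0 F1.
  rewrite inE; case: (leP (e / 2 * N) (F a)) => hh /=.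
    by rewrite mul1r; apply: ler_wpDl => //; rewrite mulr_ge0 // divr_ge0.
  by rewrite mul0r addr0 ltW.
rewrite big_split /= sumr_const -mulr_suml.
have -> : \sum_(a : A) (a \in S)%:R = #|S|%:R :> R.
  by rewrite -sum1_card natr_sum [RHS]big_mkcond; apply: eq_bigr => a _; case: (a \in S).
rewrite -[_ *+ _]mulr_natl.
lra.
Qed.

Definition blow (V : finType) r (Phi : pred {ffun 'I_r -> V}) (Y : {ffun 'I_r -> {ffun T -> V}}) : bool :=
  [forall s : {ffun 'I_r -> T}, Phi [ffun i => Y i (s i)]].

Lemma blow_fcons (V : finType) r (Phi : pred {ffun 'I_r.+1 -> V}) (Y0 : {ffun T -> V}) Y :
  blow (fun a => [forall t, Phi (fcons (Y0 t) a)]) Y -> blow Phi (fcons Y0 Y).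
Proof.
move=> /forallP h; apply/forallP => s.
have /forallP/(_ (s ord0)) := h [ffun i => s (lift ord0 i)].
congr (Phi _); apply/ffunP => i; rewrite [RHS]ffunE.
have [j ->|->] := unliftP ord0 i; first by rewrite !fcons_lift !ffunE.
by rewrite !fcons0.
Qed.

Lemma sum_bool_card (A : finType) (P : pred A) : \sum_a (P a)%:R = #|[set a | P a]|%:R :> R.
Proof.
rewrite -sum1_card natr_sum [RHS]big_mkcond; apply: eq_bigr => a _.
by rewrite inE; case: (P a).
Qed.

Lemma many_blow r (e : R) : 0 < e -> exists2 k : R, 0 < k &
  forall (V : finType) (Phi : pred {ffun 'I_r -> V}), (0 < #|V|)%N ->
    e * #|V|%:R ^+ r <= \sum_x (Phi x)%:R ->
    k * (#|V|%:R ^+ #|T|) ^+ r <= \sum_Y (blow Phi Y)%:R.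
Proof.
elim: r e => [|r IH] e e0.
  have u (X : Type) (x y : {ffun 'I_0 -> X}) : x = y by apply/ffunP => -[].
  exists e => // V Phi V0; rewrite !expr0 !mulr1 !sum_bool_card => h.
  have /card_gt0P[x xP] : (0 < #|[set x | Phi x]|)%N by rewrite -(ltr_nat R); apply: lt_le_trans h.
  have /card_gt0P[v _] := V0.
  apply: (le_trans h); rewrite ler_nat (@leq_trans 1) //.
    by rewrite -(cards1 x); apply/subset_leq_card/subsetP => y _; rewrite (u _ y x) set11.
  apply/card_gt0P; exists [ffun=> [ffun=> v]]; rewrite inE; apply/forallP => s.
  by rewrite (u _ (finfun _) x); rewrite inE in xP.
pose t := #|T|; pose e1 := (e / 2) ^+ t.+1.
have e2 : 0 < e / 2 by rewrite divr_gt0.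
have e10 : 0 < e1 by rewrite exprn_gt0.
have [k k0 hk] := IH (e1 / 2) (divr_gt0 e10 (ltr0n _ 2)).
exists (e1 / 2 * k) => [|V Phi V0 h]; first by rewrite mulr_gt0 // divr_gt0.
set n : R := #|V|%:R in h *; have n0 : 0 < n by rewrite ltr0n.
pose A := {ffun 'I_r -> V}.
have cA : #|{: A}|%:R = n ^+ r by rewrite card_ffun card_ord natrX.
have cW : #|{: {ffun T -> V}}|%:R = n ^+ t by rewrite card_ffun natrX.
pose d (a : A) : R := \sum_v (Phi (fcons v a))%:R.
have d01 a : 0 <= d a <= n.
  rewrite sumr_ge0 //= /d /n -sum1_card natr_sum; apply: ler_sum => v _.
  by case: (Phi _).
have hd : e * (#|{: A}|%:R * n) <= \sum_a d a.
  rewrite cA -exprSr; apply: (le_trans h); rewrite sum_fcons exchange_big /=; exact: lexx.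
have h1 := many_above (ltW n0) (ltW e0) d01 hd.
set S := [set a | _] in h1.
have hS : e / 2 * n ^+ r <= #|S|%:R by rewrite -(ler_pM2r n0) -cA [leRHS]mulrC.
pose PhiY (Y : {ffun T -> V}) : pred A := fun a => [forall u, Phi (fcons (Y u) a)].
pose D (Y : {ffun T -> V}) : R := \sum_a (PhiY Y a)%:R.
have D01 Y : 0 <= D Y <= n ^+ r.
  rewrite sumr_ge0 //= -cA -sum1_card natr_sum; apply: ler_sum => a _.
  by case: (PhiY Y a).
have hD : e1 * (#|{: {ffun T -> V}}|%:R * n ^+ r) <= \sum_Y D Y.
  rewrite exchange_big /= cW.
  have E a : \sum_Y (PhiY Y a)%:R = d a ^+ t.
    rewrite sum_bool_card /d sum_bool_card -natrX; congr (_%:R).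
    rewrite /t -card_ffun_on; apply: eq_card => Y.
    rewrite inE; apply/forallP/ffun_onP => hh u; first by rewrite inE.
    by have := hh u; rewrite inE.
  rewrite (eq_bigr _ (fun a _ => E a)).
  apply: (@le_trans _ _ (\sum_(a in S) (e / 2 * n) ^+ t)).
    rewrite sumr_const -[leRHS]mulr_natl /e1 exprS [X in _ <= _ * X]exprMn.
    have -> : e / 2 * (e / 2) ^+ t * (n ^+ t * n ^+ r) =
       e / 2 * n ^+ r * ((e / 2) ^+ t * n ^+ t) by ring.
    by apply: ler_wpM2r => //; rewrite mulr_ge0 // exprn_ge0 // ltW.
  rewrite big_mkcond /=; apply: ler_sum => a _; case: ifP => [|_].
    rewrite inE => aS; apply: lerXn2r => //; rewrite nnegrE.
      by rewrite mulr_ge0 // ltW.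
    by case/andP: (d01 a).
  by rewrite exprn_ge0 //; case/andP: (d01 a).
have nr0 : 0 < n ^+ r by rewrite exprn_gt0.
have h2 := many_above (ltW nr0) (ltW e10) D01 hD.
set S2 := [set Y | _] in h2.
have hS2 : e1 / 2 * n ^+ t <= #|S2|%:R by rewrite -(ler_pM2r nr0) -cW [leRHS]mulrC.
have hb : \sum_(Y0 in S2) k * (n ^+ t) ^+ r <= \sum_Y (blow Phi Y)%:R.
  rewrite sum_fcons big_mkcond /=; apply: ler_sum => Y0 _; case: ifP => [|_]; last exact: sumr_ge0.
  rewrite inE => /hk - /(_ V0) /le_trans; apply.
  apply: ler_sum => Y _; rewrite ler_nat.
  by case: (boolP (blow (PhiY Y0) Y)) => // /blow_fcons ->.
apply: le_trans hb; rewrite sumr_const -[leRHS]mulr_natl exprS.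
have -> : e1 / 2 * k * (n ^+ t * (n ^+ t) ^+ r) = e1 / 2 * n ^+ t * (k * (n ^+ t) ^+ r) by ring.
by apply: ler_wpM2r => //; rewrite mulr_ge0 ?exprn_ge0 // ltW.
Qed.

Theorem many_homs (r : nat) (e : R) : (0 < #|T|)%N -> 0 < e -> exists2 k : R, 0 < k &
  forall (V : finType) (D : rel V) (f : T -> 'I_r), (0 < #|V|)%N ->
    e * #|V|%:R ^+ r <= #|[set y : {ffun 'I_r -> V} | clique_tuple D y]|%:R ->
    k * #|V|%:R ^+ #|T| <=
      #|[set phi : {ffun T -> V} | [forall x, forall y, (f x != f y) ==> D (phi x) (phi y)]]|%:R.
Proof.
move=> T0 e0; have [k k0 hk] := many_blow r e0; exists k => // V D f V0.
rewrite -sum_bool_card => /(hk _ _ V0) {hk}.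
pose P (phi : {ffun T -> V}) := [forall x, forall y, (f x != f y) ==> D (phi x) (phi y)].
pose g (x : T) : 'I_r * T := (f x, x).
have ig : injective g by move=> x y [].
have := card_marginal P ig; rewrite card_prod card_ord => hm.
have /card_gt0P[x0 _] := T0.
rewrite sum_bool_card => hb.
have r0 : (0 < r)%N by case: (f x0) => i; apply: leq_ltn_trans.
have le1 : (#|[set Y : {ffun 'I_r -> {ffun T -> V}} | blow (@clique_tuple V D r) Y]| <=
   #|[set Z : {ffun 'I_r * T -> V} | P [ffun a => Z (g a)]]|)%N.
  pose c (Y : {ffun 'I_r -> {ffun T -> V}}) : {ffun 'I_r * T -> V} := [ffun p => Y p.1 p.2].
  have ic : injective c.
    move=> Y1 Y2 /ffunP E; apply/ffunP => i; apply/ffunP => t.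
    by have := E (i, t); rewrite !ffunE.
  rewrite -(card_imset _ ic); apply/subset_leq_card/subsetP => Z /imsetP[Y].
  rewrite inE => /forallP hY ->; rewrite inE; apply/forallP => x; apply/forallP => y.
  apply/implyP => fxy; rewrite !ffunE /=.
  have /forallP/(_ (f x))/forallP/(_ (f y))/implyP/(_ fxy) := hY [ffun i => if i == f x then x else y].
  by rewrite !ffunE eqxx eq_sym (negbTE fxy).
move: le1; rewrite hm -(ler_nat R) natrM natrX => /(le_trans hb).
have n0 : 0 < #|V|%:R :> R by rewrite ltr0n.
rewrite -exprM -[(#|T| * r)%N](subnK (_ : #|T| <= _)%N); last by rewrite leq_pmulr.
rewrite exprD mulrCA mulnC ler_pM2l //.
by rewrite exprn_gt0.
Qed.

End BlowUp.

(** * Random subsets and Janson's inequality *)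

Section RandomSubset.
Variables (R : realType) (V : finType).
Implicit Types (s : seq V) (f g : {set V} -> R) (E U W : {set V}).

(* Expectation of [f U] when [U] contains each element of the duplicate-free
   list [s] independently with probability [p]. *)
Fixpoint ex (p : R) s f : R :=
  if s is a :: s' then (1 - p) * ex p s' f + p * ex p s' (fun U => f (a |: U))
  else f set0.

Lemma ex_ext p s f g : (forall U, {subset U <= s} -> f U = g U) -> ex p s f = ex p s g.
Proof.
elim: s f g => [|a s IH] f g fg /=.
  by apply: fg => u; rewrite inE.
congr (_ * _ + _ * _); apply: IH => U Us; apply: fg.
  by move=> u /Us us; rewrite inE us orbT.
by move=> u /setU1P[->|/Us us]; rewrite inE ?eqxx ?us ?orbT.
Qed.

Lemma ex_le p s f g : 0 <= p <= 1 ->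
  (forall U, {subset U <= s} -> f U <= g U) -> ex p s f <= ex p s g.
Proof.
move=> /andP[p0 p1]; elim: s f g => [|a s IH] f g fg /=.
  by apply: fg => u; rewrite inE.
apply: lerD; apply: ler_wpM2l; rewrite ?subr_ge0 //; apply: IH => U Us; apply: fg.
  by move=> u /Us us; rewrite inE us orbT.
by move=> u /setU1P[->|/Us us]; rewrite inE ?eqxx ?us ?orbT.
Qed.

Lemma exD p s f g : ex p s (fun U => f U + g U) = ex p s f + ex p s g.
Proof. by elim: s f g => [|a s IH] f g //=; rewrite !IH; ring. Qed.

Lemma exZ p s c f : ex p s (fun U => c * f U) = c * ex p s f.
Proof. by elim: s f => [|a s IH] f //=; rewrite !IH; ring. Qed.

Lemma ex_cst p s c : ex p s (fun=> c) = c.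
Proof. by elim: s => [|a s IH] //=; rewrite !IH; ring. Qed.

Lemma ex_sum p s (J : Type) (l : seq J) (P : pred J) (F : J -> {set V} -> R) :
  ex p s (fun U => \sum_(j <- l | P j) F j U) = \sum_(j <- l | P j) ex p s (F j).
Proof.
elim: l => [|j l IH].
  by rewrite big_nil -[RHS](ex_cst p s); apply: ex_ext => U _; rewrite big_nil.
rewrite big_cons -IH; case: ifP => Pj.
  by rewrite -exD; apply: ex_ext => U _; rewrite big_cons Pj.
by apply: ex_ext => U _; rewrite big_cons Pj.
Qed.

Definition decreasing f := forall U W, U \subset W -> f W <= f U.

Lemma harris p s f g : 0 <= p <= 1 -> decreasing f -> decreasing g ->
  ex p s f * ex p s g <= ex p s (fun U => f U * g U).
Proof.
move=> p01; elim: s f g => [|a s IH] f g df dg //=.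
have df' : decreasing (fun U => f (a |: U)) by move=> U W UW; apply: df; exact: setUS.
have dg' : decreasing (fun U => g (a |: U)) by move=> U W UW; apply: dg; exact: setUS.
have h0 := IH f g df dg; have h1 := IH _ _ df' dg'.
have lf : ex p s (fun U => f (a |: U)) <= ex p s f.
  by apply: ex_le => // U _; apply: df; exact: subsetUr.
have lg : ex p s (fun U => g (a |: U)) <= ex p s g.
  by apply: ex_le => // U _; apply: dg; exact: subsetUr.
case/andP: p01 => p0 p1; have q0 : 0 <= 1 - p by rewrite subr_ge0.
apply: le_trans (lerD (ler_wpM2l q0 h0) (ler_wpM2l p0 h1)).
move: lf lg; move: (ex p s f) (ex p s g) (ex p s (fun U => f (a |: U))) (ex p s (fun U => g (a |: U))) => F0 G0 F1 G1 lf lg.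
rewrite -subr_ge0.
have -> : (1 - p) * (F0 * G0) + p * (F1 * G1) -
   ((1 - p) * F0 + p * F1) * ((1 - p) * G0 + p * G1) = p * (1 - p) * ((F0 - F1) * (G0 - G1)) by ring.
by rewrite !mulr_ge0 // subr_ge0.
Qed.

Lemma ex_given p s E g : uniq s -> {subset E <= s} ->
  ex p s (fun U => (E \subset U)%:R * g U) = p ^+ #|E| * ex p s (fun U => g (E :|: U)).
Proof.
elim: s E g => [|a s IH] E g /=.
  move=> _ Es; have -> : E = set0.
    by apply/setP => u; rewrite !inE; apply/negbTE/negP => /Es.
  by rewrite sub0set cards0 expr0 set0U.
move=> /andP[nas us] Es; have [aE|naE] := boolP (a \in E).
  have E's : {subset E :\ a <= s}.
    by move=> u /setD1P[ua /Es]; rewrite inE (negbTE ua).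
  rewrite (@ex_ext _ _ _ (fun=> 0)) => [|U Us]; last first.
    case: (boolP (E \subset U)) => [/subsetP/(_ a aE)/Us|_]; last by rewrite mul0r.
    by rewrite (negbTE nas).
  rewrite ex_cst mulr0 add0r.
  rewrite (@ex_ext _ _ _ (fun U => (E :\ a \subset U)%:R * g (a |: U))) => [|U Us]; last first.
    by rewrite subDset.
  rewrite (IH _ (fun U => g (a |: U))) //.
  have e1 : ex p s (fun U => g (a |: (E :\ a :|: U))) = ex p s (fun U => g (E :|: U)).
    by apply: ex_ext => U _; rewrite setUA setD1K.
  have e2 : ex p s (fun U => g (E :|: (a |: U))) = ex p s (fun U => g (E :|: U)).
    apply: ex_ext => U _; rewrite setUA [E :|: _]setUC.
    by rewrite (_ : [set a] :|: E = E) //; apply/setUidPr; rewrite sub1set.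
  by rewrite e1 e2 (cardsD1 a E) aE exprS; ring.
have E's : {subset E <= s}.
  move=> u uE; have := Es u uE; rewrite inE => /orP[/eqP ua|//].
  by rewrite -ua uE in naE.
rewrite IH // (@ex_ext _ _ (fun U => (E \subset a |: U)%:R * g (a |: U)) (fun U => (E \subset U)%:R * g (a |: U))) => [|U Us]; last first.
  suff -> : (E \subset a |: U) = (E \subset U) by [].
  apply/subsetP/subsetP => h u uE; last by rewrite !inE h // orbT.
  by have /setU1P[ua|//] := h u uE; rewrite -ua uE in naE.
rewrite (IH _ (fun U => g (a |: U))) //.
have -> : ex p s (fun U => g (a |: (E :|: U))) = ex p s (fun U => g (E :|: (a |: U))).
  by apply: ex_ext => U _; rewrite setUCA.
by ring.
Qed.

Lemma ex_subset p s E : uniq s -> {subset E <= s} ->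
  ex p s (fun U => (E \subset U)%:R) = p ^+ #|E|.
Proof.
move=> us Es; have := ex_given p (fun=> 1) us Es; rewrite ex_cst mulr1 => <-.
by apply: ex_ext => U _; rewrite mulr1.
Qed.

Lemma ex_pow p s W (l : R) : uniq s ->
  ex p s (fun U => l ^+ #|U :&: W|) = (1 + (l - 1) * p) ^+ count (mem W) s.
Proof.
elim: s => [|a s IH] /=; first by rewrite set0I cards0.
move=> /andP[nas us]; rewrite IH //.
rewrite (@ex_ext _ _ (fun U => l ^+ #|(a |: U) :&: W|)
   (fun U => l ^+ (a \in W) * l ^+ #|U :&: W|)) => [|U Us]; last first.
  rewrite -exprD setIUl; congr (_ ^+ _).
  have [aW|naW] := boolP (a \in W).
    rewrite (setIidPl _) ?sub1set // cardsU1 (_ : a \notin U :&: W) //.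
    by apply: contra nas => /setIP[/Us].
  by rewrite (_ : [set a] :&: W = set0) ?set0U //; apply/setP => u; rewrite !inE; case: eqP => // ->; rewrite (negbTE naW).
rewrite exZ IH //; case: (a \in W) => /=; rewrite ?add0n ?add1n ?expr1 ?expr0 ?exprS; ring.
Qed.

Lemma sum_subsetU1 (a : V) (A : {set V}) (G : {set V} -> R) : a \notin A ->
  \sum_(U : {set V} | U \subset a |: A) G U =
  \sum_(U : {set V} | U \subset A) G U + \sum_(U : {set V} | U \subset A) G (a |: U).
Proof.
move=> aA; rewrite (bigID (fun U : {set V} => a \notin U)) /=; congr (_ + _).
  apply: eq_bigl => U; apply/andP/idP => [[sU aU]|sU].
    apply/subsetP => u uU; have /setU1P[ua|//] := subsetP sU u uU.
    by rewrite -ua uU in aU.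
  split; first by apply: subset_trans sU _; exact: subsetUr.
  by apply: contra aA => /(subsetP sU).
rewrite [LHS](reindex_onto (fun U => a |: U) (fun U => U :\ a)) /=; last first.
  by move=> U /andP[_]; rewrite negbK => aU; rewrite setD1K.
apply: eq_bigl => U; rewrite negbK setU11 andbT.
apply/andP/idP => [[sU /eqP E]|sU].
  have aU : a \notin U by rewrite -E !inE eqxx.
  apply/subsetP => u uU; have : u \in a |: A by apply: (subsetP sU); rewrite inE uU orbT.
  by move=> /setU1P[ua|//]; rewrite -ua uU in aU.
split; first exact: setUS.
by rewrite setU1K //; apply: contra aA => /(subsetP sU).
Qed.

Lemma ex_sumE p s f : uniq s ->
  ex p s f = \sum_(U : {set V} | U \subset [set x in s]) p ^+ #|U| * (1 - p) ^+ (size s - #|U|) * f U.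
Proof.
elim: s f => [|a s IH] f /=.
  move=> _; rewrite (big_pred1 set0) ?cards0 ?expr0 ?mul1r // => U.
  rewrite /= -subset0; apply: eq_subset_r => u; by rewrite !inE.
move=> /andP[nas us].
have -> : [set x in a :: s] = a |: [set x in s] by apply/setP => u; rewrite !inE.
rewrite sum_subsetU1 ?inE // !IH // !mulr_sumr.
have cU U : U \subset [set x in s] -> (#|U| <= size s)%N.
  by move/subset_leq_card/leq_trans; apply; rewrite cardsE; exact: card_size.
congr (_ + _); apply: eq_bigr => U sU.
  by rewrite subSn ?cU // exprS; ring.
have aU : a \notin U by apply: contra nas => /(subsetP sU); rewrite inE.
by rewrite cardsU1 aU add1n subSS exprS; ring.
Qed.

End RandomSubset.

Section Janson.
Variables (R : realType) (V J : finType) (p : R) (s : seq V) (E : J -> {set V}).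
Hypotheses (p01 : 0 <= p <= 1) (us : uniq s).

Definition avoids (l : seq J) (U : {set V}) : bool := all (fun j => ~~ (E j \subset U)) l.

Let hit j k := p ^+ #|E j :|: E k|.

Fixpoint overlaps (l : seq J) : R :=
  if l is k :: l' then overlaps l' + \sum_(j <- l' | E j :&: E k != set0) hit j k else 0.

(* Given that [E k] is contained in [U], the conditions on the sets disjoint from
   [E k] are unaffected, and Harris' inequality decouples the others. *)
Lemma ex_avoids_step k l : {subset E k <= s} -> {in l, forall j, {subset E j <= s}} ->
  ex p s (fun U => (avoids (k :: l) U)%:R) <=
  ex p s (fun U => (avoids l U)%:R) *
    (1 - p ^+ #|E k| + \sum_(j <- l | E j :&: E k != set0) hit j k).
Proof.
move=> Eks Els; case/andP: (p01) => p0 p1.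
set P := ex p s (fun U => (avoids l U)%:R).
pose d1 (U : {set V}) : bool := all (fun j => (E j :&: E k == set0) ==> ~~ (E j \subset U)) l.
pose d0 (U : {set V}) : bool := all (fun j => (E j :&: E k != set0) ==> ~~ (E j \subset E k :|: U)) l.
have av U : avoids l (E k :|: U) = d1 U && d0 U.
  rewrite -all_predI; apply: eq_in_all => j jl /=.
  have [e0|//] := eqVneq (E j :&: E k) set0; rewrite andbT; congr (~~ _).
  by rewrite -subDset (setDidPl _) // -setI_eq0 e0.
have dd (b : pred {set V}) : (forall U W : {set V}, U \subset W -> b W -> b U) ->
    decreasing (fun U => (b U)%:R : R).
  by move=> h U W UW; rewrite ler_nat; case: (b W) (h U W UW) => // ->.
have dd1 : decreasing (fun U => (d1 U)%:R : R).
  apply: dd => U W UW; apply: sub_all => j /implyP h; apply/implyP => /h.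
  by apply: contra => /subset_trans; apply.
have dd0 : decreasing (fun U => (d0 U)%:R : R).
  apply: dd => U W UW; apply: sub_all => j /implyP h; apply/implyP => /h.
  by apply: contra => /subset_trans; apply; exact: setUS.
have P0 : 0 <= P by rewrite -(ex_cst p s 0); apply: ex_le.
have e1 : P <= ex p s (fun U => (d1 U)%:R).
  apply: ex_le => // U _; rewrite ler_nat; case: (boolP (avoids l U)) => // h.
  by rewrite (_ : d1 U) //; apply: sub_all h => j h; apply/implyP.
have e00 : 0 <= ex p s (fun U => (d0 U)%:R) by rewrite -(ex_cst p s 0); apply: ex_le.
have e0 : 1 - \sum_(j <- l | E j :&: E k != set0) p ^+ #|E j :\: E k| <= ex p s (fun U => (d0 U)%:R).
  have -> : \sum_(j <- l | E j :&: E k != set0) p ^+ #|E j :\: E k| =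
     ex p s (fun U => \sum_(j <- l | E j :&: E k != set0) (E j :\: E k \subset U)%:R).
    rewrite ex_sum big_seq_cond [RHS]big_seq_cond; apply: eq_bigr => j /andP[jl _].
    by rewrite ex_subset // => u /setDP[uE _]; exact: Els uE.
  rewrite -{1}(ex_cst p s 1) -mulN1r -exZ -exD; apply: ex_le => // U _.
  case: (boolP (d0 U)) => h0 /=.
    by rewrite mulN1r gerDl oppr_le0; apply: sumr_ge0.
  move: h0; rewrite -has_predC => /hasP[j jl /=]; rewrite negb_imply negbK => /andP[jk jU].
  rewrite mulN1r subr_le0 (big_rem j) //= jk subDset jU.
  by rewrite lerDl; apply: sumr_ge0.
have -> : ex p s (fun U => (avoids (k :: l) U)%:R) = P - p ^+ #|E k| * ex p s (fun U => (avoids l (E k :|: U))%:R).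
  rewrite -(ex_given _ (fun U => (avoids l U)%:R) us Eks) -mulN1r -exZ -exD; apply: ex_ext => U _ /=.
  by case: (E k \subset U); case: (avoids l U) => /=; ring.
have h : P * (1 - \sum_(j <- l | E j :&: E k != set0) p ^+ #|E j :\: E k|) <=
         ex p s (fun U => (avoids l (E k :|: U))%:R).
  apply: (@le_trans _ _ (ex p s (fun U => (d1 U)%:R) * ex p s (fun U => (d0 U)%:R))).
    by apply: (le_trans (ler_wpM2l P0 e0)); apply: ler_wpM2r.
  apply: (le_trans (harris _ p01 dd1 dd0)); apply: ex_le => // U _.
  by rewrite av -natrM mulnb.
have -> : \sum_(j <- l | E j :&: E k != set0) hit j k =
   p ^+ #|E k| * \sum_(j <- l | E j :&: E k != set0) p ^+ #|E j :\: E k|.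
  rewrite mulr_sumr; apply: eq_bigr => j _; rewrite /hit -exprD; congr (_ ^+ _).
  by rewrite setUC -{1}(cardsID (E k)) setUK setDUl setDv set0U.
have := ler_wpM2l (exprn_ge0 #|E k| p0) h.
by move: (p ^+ _) (\sum_(j <- _ | _) _) (ex _ _ _) => u v w; lra.
Qed.

Lemma ex_avoids_le l : {in l, forall j, {subset E j <= s}} ->
  ex p s (fun U => (avoids l U)%:R) <= expR (- \sum_(j <- l) p ^+ #|E j| + overlaps l).
Proof.
elim: l => [|k l IH] Es.
  by rewrite ex_cst big_nil oppr0 addr0 expR0.
have Es' : {in l, forall j, {subset E j <= s}} by move=> j jl; apply: Es; rewrite inE jl orbT.
have h := ex_avoids_step (Es k (mem_head _ _)) Es'.
apply: (le_trans h).
have {}IH := IH Es'.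
rewrite big_cons /=.
have P0 : 0 <= ex p s (fun U => (avoids l U)%:R) by rewrite -(ex_cst p s 0); apply: ex_le.
have e := expR_ge1Dx (- p ^+ #|E k| + \sum_(j <- l | E j :&: E k != set0) hit j k).
rewrite addrA in e.
apply: (le_trans (ler_wpM2l P0 e)).
rewrite [X in _ <= X](_ : _ = expR (- \sum_(j <- l) p ^+ #|E j| + overlaps l) *
   expR (- p ^+ #|E k| + \sum_(j <- l | E j :&: E k != set0) hit j k)).
  by apply: ler_wpM2r => //; exact: expR_ge0.
by rewrite -!expRD; congr expR; ring.
Qed.

Lemma overlaps_le l : uniq l ->
  overlaps l <= \sum_(k <- l) \sum_(j <- l | (j != k) && (E j :&: E k != set0)) hit j k.
Proof.
have h0 j k : 0 <= hit j k by apply: exprn_ge0; case/andP: p01.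
elim: l => [|k l IH] /=; first by rewrite big_nil.
move=> /andP[kl ul]; rewrite big_cons addrC; apply: lerD.
  rewrite big_cons eqxx /= le_eqVlt; apply/orP; left; apply/eqP.
  rewrite big_seq_cond [RHS]big_seq_cond; apply: eq_bigl => j.
  by case: (boolP (j \in l)) => // jl /=; case: (eqVneq j k) => // E'; rewrite -E' jl in kl.
apply: (le_trans (IH ul)); apply: ler_sum => j _.
by rewrite big_cons; case: ifP => // _; rewrite lerDr.
Qed.

(* Boppana and Spencer's argument applied to a [t]-random subfamily. *)
Lemma janson_sparsified (Q : {set J}) (t : R) : 0 <= t <= 1 ->
  {in Q, forall j, {subset E j <= s}} ->
  0 < ex p s (fun U => (avoids (enum Q) U)%:R) ->
  t * \sum_(j in Q) p ^+ #|E j| -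
  t ^+ 2 * \sum_(k in Q) \sum_(j in Q | (j != k) && (E j :&: E k != set0)) hit j k
  <= - ln (ex p s (fun U => (avoids (enum Q) U)%:R)).
Proof.
move=> t01 Qs P0; set P := ex _ _ _ in P0 *.
have uQ : uniq (enum Q) by exact: enum_uniq.
have sQ (j : J) : j \in Q -> {subset [set j] <= enum Q}.
  by move=> jQ i /set1P ->; rewrite mem_enum.
have -> : t * \sum_(j in Q) p ^+ #|E j| =
    ex t (enum Q) (fun L => \sum_(j in Q) p ^+ #|E j| * ([set j] \subset L)%:R).
  rewrite ex_sum mulr_sumr; apply: eq_bigr => j jQ.
  by rewrite exZ ex_subset ?cards1 ?expr1 1?mulrC //; exact: sQ.
have -> : t ^+ 2 * \sum_(k in Q) \sum_(j in Q | (j != k) && (E j :&: E k != set0)) hit j k =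
   ex t (enum Q) (fun L => \sum_(k in Q) \sum_(j in Q | (j != k) && (E j :&: E k != set0))
      hit j k * ([set j; k] \subset L)%:R).
  rewrite ex_sum mulr_sumr; apply: eq_bigr => k kQ.
  rewrite ex_sum mulr_sumr; apply: eq_bigr => j /andP[jQ /andP[jk _]].
  rewrite exZ ex_subset ?cards2 ?jk 1?mulrC // => i /set2P[] ->; by rewrite mem_enum.
rewrite -mulN1r -exZ -exD -[leRHS](ex_cst t (enum Q)); apply: ex_le => // L Ls.
have LQ : L \subset Q by apply/subsetP => j /Ls; rewrite mem_enum.
rewrite mulN1r -lnV ?posrE // -ler_expR lnK ?posrE ?invr_gt0 //.
rewrite -[X in expR X]opprK expRN lef_pV2 ?posrE ?expR_gt0 //.
apply: (@le_trans _ _ (ex p s (fun U => (avoids (enum L) U)%:R))).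
  apply: ex_le => // U _; rewrite ler_nat; case: (boolP (avoids _ _)) => // /allP h.
  rewrite (_ : avoids (enum L) U) //; apply/allP => j; rewrite mem_enum => jL.
  by apply: h; rewrite mem_enum; exact: (subsetP LQ).
apply: le_trans (ex_avoids_le _) _.
  by move=> j; rewrite mem_enum => jL; apply: Qs; exact: (subsetP LQ).
rewrite ler_expR opprB addrC; apply: lerD.
  apply: (le_trans (overlaps_le (enum_uniq _))); rewrite big_enum /=.
  rewrite big_mkcond [leRHS]big_mkcond /=; apply: ler_sum => k _.
  case: ifP => kL; last first.
    by case: ifP => // _; apply: sumr_ge0 => j _; rewrite mulr_ge0 // exprn_ge0 //; case/andP: p01.
  rewrite (subsetP LQ) // big_enum_cond /=.
  rewrite big_mkcond [leRHS]big_mkcond /=; apply: ler_sum => j _.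
  have hh : 0 <= hit j k by rewrite exprn_ge0 //; case/andP: p01.
  case: ifP => [/andP[jL ->]|_]; last by case: ifP => // _; rewrite mulr_ge0.
  rewrite (subsetP LQ) //= (_ : [set j; k] \subset L) ?mulr1 //.
  by apply/subsetP => i /set2P[] ->.
rewrite lerN2 big_enum /= big_mkcond [leRHS]big_mkcond /=; apply: ler_sum => j _.
rewrite sub1set; case: ifP => [jQ|]; case: (boolP (j \in L)) => //=; rewrite ?mulr1 ?mulr0 //.
by move=> /(subsetP LQ) ->.
Qed.

Lemma janson (Q : {set J}) (D : R) :
  {in Q, forall j, {subset E j <= s}} ->
  0 < ex p s (fun U => (avoids (enum Q) U)%:R) ->
  \sum_(j in Q) p ^+ #|E j| <= D ->
  \sum_(k in Q) \sum_(j in Q | (j != k) && (E j :&: E k != set0)) hit j k <= D ->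
  (\sum_(j in Q) p ^+ #|E j|) ^+ 2 <= 4 * D * - ln (ex p s (fun U => (avoids (enum Q) U)%:R)).
Proof.
move=> Qs P0; set mu := \sum_(j in Q) p ^+ #|E j|.
set Dl := \sum_(k in Q) \sum_(j in Q | _) _ => m1 D1.
have mu0 : 0 <= mu by apply: sumr_ge0 => j _; rewrite exprn_ge0 //; case/andP: p01.
have [D0|D0] := leP D 0.
  have -> : mu = 0 by lra.
  have -> : D = 0 by lra.
  by rewrite expr0n mulr0 mul0r.
have t01 : 0 <= mu / (2 * D) <= 1.
  by apply/andP; split; [apply: divr_ge0 => //; lra | rewrite ler_pdivrMr; lra].
have := janson_sparsified t01 Qs P0; rewrite -/mu -/Dl.
set c := - ln _ => h.
have h2 : (mu / (2 * D)) ^+ 2 * Dl <= (mu / (2 * D)) ^+ 2 * D by apply: ler_wpM2l => //; exact: sqr_ge0.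
have h3 : mu ^+ 2 / (4 * D) <= c.
  have -> : mu ^+ 2 / (4 * D) = mu / (2 * D) * mu - (mu / (2 * D)) ^+ 2 * D by field; rewrite gt_eqF.
  lra.
by rewrite mulrC -ler_pdivrMr // mulr_gt0.
Qed.

End Janson.

(** * Hypergraph containers *)

Lemma ln_le_sub1 (R : realType) (y : R) : 0 < y -> ln y <= y - 1.
Proof.
move=> y0; have e : 1 + (y - 1) = y by ring.
have h : ln (1 + (y - 1)) <= y - 1 by apply: le_ln1Dx; lra.
by rewrite e in h.
Qed.

Lemma ln_1D_ge (R : realType) (u : R) : 0 <= u -> u - u ^+ 2 <= ln (1 + u).
Proof.
move=> u0; have u1 : 0 < 1 + u by lra.
have h : 1 - (1 + u)^-1 <= ln (1 + u).
  have i0 : 0 < (1 + u)^-1 by rewrite invr_gt0.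
  have := ln_le_sub1 i0; rewrite lnV ?posrE //; lra.
apply: le_trans h.
have -> : 1 - (1 + u)^-1 = u / (1 + u) by field; rewrite gt_eqF.
rewrite ler_pdivlMr //; have u2 : 0 <= u ^+ 3 by exact: exprn_ge0.
have -> : (u - u ^+ 2) * (1 + u) = u - u ^+ 3 by ring.
lra.
Qed.

Section Containers.
Variables (R : realType) (V : finType) (ind : pred {set V}).
Hypothesis indS : forall U W : {set V}, U \subset W -> ind W -> ind U.
Implicit Types (S C I U : {set V}) (v : V) (y : R).

Definition indpoly S C y : R := \sum_(U : {set V} | U \subset C) (ind (S :|: U))%:R * y ^+ #|U|.

Lemma indpoly_rec S C v y : v \in C ->
  indpoly S C y = indpoly S (C :\ v) y + y * indpoly (v |: S) (C :\ v) y.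
Proof.
move=> vC; rewrite /indpoly -{1}(setD1K vC) sum_subsetU1 ?inE ?eqxx //; congr (_ + _).
rewrite mulr_sumr; apply: eq_bigr => U sU.
have vU : v \notin U by apply/negP => /(subsetP sU); rewrite !inE eqxx.
by rewrite cardsU1 vU add1n exprS setUCA setUA; ring.
Qed.

Lemma indpoly_ge0 S C y : 0 <= y -> 0 <= indpoly S C y.
Proof. by move=> y0; apply: sumr_ge0 => U _; rewrite mulr_ge0 // exprn_ge0. Qed.

Lemma indpoly_ge1 S C y : 0 <= y -> ind S -> 1 <= indpoly S C y.
Proof.
move=> y0 iS; rewrite /indpoly (bigD1 set0) ?sub0set //= setU0 iS cards0 expr0 mul1r.
by rewrite lerDl; apply: sumr_ge0 => U _; rewrite mulr_ge0 // exprn_ge0.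
Qed.

Lemma indpoly_subD1 S C v y : 0 <= y -> v \in C -> indpoly S (C :\ v) y <= indpoly S C y.
Proof.
by move=> y0 vC; rewrite (indpoly_rec S y vC) lerDl mulr_ge0 // indpoly_ge0.
Qed.

Lemma indpolyS S S' C y : 0 <= y -> S \subset S' -> indpoly S' C y <= indpoly S C y.
Proof.
move=> y0 SS'; apply: ler_sum => U _; apply: ler_wpM2r; first exact: exprn_ge0.
by rewrite ler_nat; case: (boolP (ind (S' :|: U))) => // /(indS (setSU U SS')) ->.
Qed.

Lemma indpoly_link_le S C v y : 0 <= y -> v \in C ->
  indpoly (v |: S) (C :\ v) y <= indpoly S C y.
Proof.
move=> y0 vC; apply: le_trans (indpoly_subD1 S y0 vC).
by apply: indpolyS => //; exact: subsetUr.
Qed.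

Lemma indpolyE S C v y : v \in C -> indpoly (v |: S) (C :\ v) y =
  \sum_(U : {set V} | U \subset C) (v \in U)%:R * ((ind (S :|: U))%:R * y ^+ #|U|.-1).
Proof.
move=> vC; rewrite -{2}(setD1K vC) sum_subsetU1 ?inE ?eqxx //.
rewrite big1 ?add0r => [|U sU]; last first.
  suff /negbTE -> : v \notin U by rewrite mul0r.
  by apply/negP => /(subsetP sU); rewrite !inE eqxx.
apply: eq_bigr => U sU.
have vU : v \notin U by apply/negP => /(subsetP sU); rewrite !inE eqxx.
by rewrite setU11 mul1r cardsU1 vU add1n /= setUCA setUA.
Qed.

(* [indpoly] is convex in [y], and its derivative is the sum of the links. *)
Lemma indpoly_tangent S C y h : 0 <= y -> 0 <= h ->
  indpoly S C y + h * \sum_(v in C) indpoly (v |: S) (C :\ v) y <= indpoly S C (y + h).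
Proof.
move=> y0 h0.
have -> : \sum_(v in C) indpoly (v |: S) (C :\ v) y =
  \sum_(U : {set V} | U \subset C) #|U|%:R * ((ind (S :|: U))%:R * y ^+ #|U|.-1).
  rewrite (eq_bigr _ (fun v vC => indpolyE S y vC)) exchange_big /=.
  apply: eq_bigr => U sU; rewrite -mulr_suml; congr (_ * _).
  rewrite -sum1_card natr_sum big_mkcond [RHS]big_mkcond /=; apply: eq_bigr => v _.
  by case: (boolP (v \in U)) => [/(subsetP sU) ->|] //; case: ifP.
rewrite mulr_sumr -big_split /=; apply: ler_sum => U _.
rewrite (_ : _ + _ = (ind (S :|: U))%:R * (y ^+ #|U| + h * (#|U|%:R * y ^+ #|U|.-1))); last by ring.
apply: ler_wpM2l => //; elim: #|U| => [|k IH]; first by rewrite !expr0 mul0r mulr0 addr0.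
rewrite [leRHS]exprS; apply: (@le_trans _ _ ((y + h) * (y ^+ k + h * (k%:R * y ^+ k.-1)))); last first.
  by apply: ler_wpM2l => //; exact: addr_ge0.
rewrite -natr1 exprS /=.
have -> : (y + h) * (y ^+ k + h * (k%:R * y ^+ k.-1)) =
   y * y ^+ k + h * (k%:R * (y * y ^+ k.-1) + y ^+ k) + h ^+ 2 * (k%:R * y ^+ k.-1) by ring.
have e0 : 0 <= h ^+ 2 * (k%:R * y ^+ k.-1) by rewrite mulr_ge0 ?sqr_ge0 // mulr_ge0 // exprn_ge0.
have -> : k%:R * (y * y ^+ k.-1) = k%:R * y ^+ k :> R.
  by case: k {IH e0} => [|k]; rewrite ?mul0r // exprS.
rewrite mulrDl mul1r; lra.
Qed.

Variables (x delta : R) (N : nat).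
Hypotheses (x0 : 0 < x) (d0 : 0 < delta) (d1 : delta < 1) (N0 : (0 < N)%N).
Hypothesis hN : x * #|V|%:R <= delta * N%:R.

Let h : R := x / N%:R.
Let xj (j : nat) : R := h * j%:R.

Let h0 : 0 < h. Proof. by rewrite divr_gt0 // ltr0n. Qed.
Let xj0 j : 0 <= xj j. Proof. by rewrite mulr_ge0 // ltW. Qed.

(* Each selected vertex lowers the potential by [delta * N], which bounds the size
   of fingerprints; when no vertex is selectable, integrating the logarithmic
   derivative of [indpoly] over the grid [xj] shows that [indpoly] is nearly
   maximal on the container. *)
Definition potential S C : R := \sum_(j < N) ln (indpoly S C (xj j)).

Definition selectable S C v : bool := (v \in C) &&
  (delta * N%:R <= \sum_(j < N) (1 - indpoly (v |: S) (C :\ v) (xj j) / indpoly S C (xj j))).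

Lemma potential_ge0 S C : ind S -> 0 <= potential S C.
Proof. by move=> iS; apply: sumr_ge0 => j _; rewrite ln_ge0 // indpoly_ge1. Qed.

Lemma potential_drop S C v : v \in C -> ind S -> potential S (C :\ v) <= potential S C.
Proof.
move=> vC iS; apply: ler_sum => j _.
rewrite ler_ln ?posrE ?indpoly_subD1 //.
by apply: lt_le_trans (indpoly_ge1 _ (xj0 j) iS).
by apply: lt_le_trans (indpoly_ge1 _ (xj0 j) iS).
Qed.

Lemma potential_select S C v : selectable S C v -> ind (v |: S) ->
  potential (v |: S) (C :\ v) + delta * N%:R <= potential S C.
Proof.
move=> /andP[vC sel] iv; have iS : ind S by apply: indS iv; exact: subsetUr.
apply: (le_trans (lerD (lexx _) sel)); rewrite -big_split /=; apply: ler_sum => j _.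
have p : 0 < indpoly S C (xj j) by apply: lt_le_trans (indpoly_ge1 _ _ _).
have q : 0 < indpoly (v |: S) (C :\ v) (xj j) by apply: lt_le_trans (indpoly_ge1 _ _ _).
set a := indpoly S C _ in p *; set b := indpoly _ _ _ in q *.
have ba : 0 < b / a by rewrite divr_gt0.
have := ln_le_sub1 ba; rewrite lnM ?posrE ?invr_gt0 // lnV ?posrE //; lra.
Qed.

Lemma indpoly_large S C : ind S -> (forall v, ~~ selectable S C v) ->
  (1 - 2 * delta) * x * #|C|%:R <= ln (indpoly S C x).
Proof.
move=> iS ns.
have p j : 0 < indpoly S C (xj j) by apply: lt_le_trans (indpoly_ge1 _ _ _).
pose r v j := indpoly (v |: S) (C :\ v) (xj j) / indpoly S C (xj j).
pose T j := \sum_(v in C) r v j.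
have r0 v j : 0 <= r v j by rewrite divr_ge0 ?indpoly_ge0 // ltW.
have T0 j : 0 <= T j by apply: sumr_ge0.
have TV j : T j <= #|V|%:R.
  apply: (@le_trans _ _ (\sum_(v in C) 1)); last by rewrite sumr_const ler_nat max_card.
  by apply: ler_sum => v vC; rewrite ler_pdivrMr // mul1r indpoly_link_le.
have hV : h * #|V|%:R <= delta.
  by rewrite /h mulrAC ler_pdivrMr ?ltr0n.
have step j : ln (indpoly S C (xj j)) + (1 - delta) * h * T j <= ln (indpoly S C (xj j.+1)).
  have hT : h * T j <= delta by apply: le_trans hV; rewrite ler_pM2l.
  have hT0 : 0 <= h * T j by rewrite mulr_ge0 // ltW.
  have e1 : (1 - delta) * h * T j <= ln (1 + h * T j).
    apply: le_trans (ln_1D_ge hT0); rewrite expr2 -[X in _ <= X - _]mul1r -mulrBl -mulrA.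
    by apply: ler_wpM2r => //; lra.
  apply: (le_trans (lerD (lexx _) e1)).
  have u1 : 0 < 1 + h * T j by lra.
  rewrite -lnM ?posrE // ler_ln ?posrE ?mulr_gt0 //.
  have := indpoly_tangent S C (xj0 j) (ltW h0).
  have -> : xj j + h = xj j.+1 by rewrite /xj -natr1 mulrDr mulr1.
  apply: le_trans; rewrite mulrDr mulr1 lerD2l mulrCA; apply: ler_wpM2l; first exact: ltW.
  rewrite mulr_sumr; apply: ler_sum => v _; rewrite /r mulrC divfK //.
  by rewrite gt_eqF.
have tot : \sum_(j < N) (1 - delta) * h * T j <= ln (indpoly S C x).
  have tele k : \sum_(j < k) (1 - delta) * h * T j <= ln (indpoly S C (xj k)).
    elim: k => [|k IH]; first by rewrite big_ord0 ln_ge0 // indpoly_ge1.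
    by rewrite big_ord_recr /=; apply: le_trans (step k); rewrite lerD2r.
  have := tele N; rewrite /xj /h divfK //.
  by rewrite pnatr_eq0 -lt0n.
apply: le_trans tot; rewrite -mulr_sumr.
have : (1 - delta) * N%:R * #|C|%:R <= \sum_(j < N) T j.
  rewrite exchange_big /=.
  rewrite -[X in _ * X]mulr1 mulr_natl -sumr_const mulr_sumr; apply: ler_sum => v vC.
  have := ns v; rewrite /selectable vC /= -ltNge sumrB sumr_const card_ord -mulr_natl mulr1.
  by rewrite mulr1 ltrBlDr => /ltW H; rewrite mulrBl mul1r lerBlDl.
have k0 : 0 <= (1 - delta) * h.
  by apply: mulr_ge0; [rewrite subr_ge0 ltW | exact: ltW h0].
move=> /(ler_wpM2l k0); apply: le_trans.
have -> : (1 - delta) * h * ((1 - delta) * N%:R * #|C|%:R) = (1 - delta) ^+ 2 * x * #|C|%:R.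
  by rewrite /h; field; rewrite pnatr_eq0 -lt0n.
apply: ler_wpM2r => //; apply: ler_wpM2r; first exact: ltW.
have := sqr_ge0 delta; lra.
Qed.

(* [I] is only consulted through the vertices that end up selected, so the
   fingerprint alone reproduces the run; see the last clause of [container_runP]. *)
Fixpoint container_run (k : nat) I S C : {set V} * {set V} :=
  if k is k'.+1 then
    if [pick v | selectable S C v] is Some v then
      if v \in I then container_run k' I (v |: S) (C :\ v) else container_run k' I S (C :\ v)
    else (S, C)
  else (S, C).

Lemma container_runP (k : nat) I S C : (#|C| <= k)%N -> ind I -> S \subset I ->
  I \subset S :|: C -> [disjoint S & C] ->
  let: (S', C') := container_run k I S C in
  [/\ [/\ S' \subset I, I \subset S' :|: C', [disjoint S' & C'] & C' \subset C],
      S \subset S', #|S'|%:R * (delta * N%:R) + potential S' C' <= #|S|%:R * (delta * N%:R) + potential S C,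
      (forall v, ~~ selectable S' C' v) &
      forall J : {set V}, S' \subset J -> J \subset I -> container_run k J S C = (S', C')].
Proof.
elim: k S C => [|k IH] S C /=.
  rewrite leqn0 cards_eq0 => /eqP -> iI SI IS dj; split=> //.
  by move=> v; rewrite /selectable inE.
move=> cC iI SI IS dj; case: pickP => [v sel|ns]; last by split=> // v; rewrite ns.
have vC : v \in C by case/andP: sel.
have cC' : (#|C :\ v| <= k)%N by move: cC; rewrite (cardsD1 v C) vC.
have vS : v \notin S by apply/negP => vS; have := disjointFr dj vS; rewrite vC.
case: (boolP (v \in I)) => vI.
  have SI' : v |: S \subset I by rewrite subUset sub1set vI.
  have IS' : I \subset (v |: S) :|: (C :\ v).
    apply/subsetP => u uI; have := subsetP IS u uI; rewrite !inE.
    by case: (u == v).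
  have dj' : [disjoint v |: S & C :\ v].
    rewrite -setI_eq0; apply/eqP/setP => u; rewrite !inE.
    case: eqP => //= _; apply/negbTE/negP => /andP[uS uC].
    by have := disjointFr dj uS; rewrite uC.
  have := IH _ _ cC' iI SI' IS' dj'.
  case: container_run => S' C' [[a1 a2 a3 a4] a5 a6 a7 a8]; split=> //.
  - by split=> //; apply: subset_trans a4 _; exact: subsetDl.
  - by apply: subset_trans a5; exact: subsetUr.
  - apply: (le_trans a6); rewrite cardsU1 vS natrD mulrDl mul1r addrAC addrC lerD2l addrC.
    by apply: potential_select => //; apply: indS iI.
  - move=> J s1 s2; rewrite a8 // ifT //.
    by apply: (subsetP s1); apply: (subsetP a5); exact: setU11.
have IS' : I \subset S :|: (C :\ v).
  apply/subsetP => u uI; have := subsetP IS u uI; rewrite !inE => /orP[->//|->].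
  by rewrite andbT orbC (_ : u != v) //; apply: contraNneq vI => <-.
have dj' : [disjoint S & C :\ v].
  by apply: disjointWr dj; exact: subsetDl.
have := IH _ _ cC' iI SI IS' dj'.
case: container_run => S' C' [[a1 a2 a3 a4] a5 a6 a7 a8]; split=> //.
- by split=> //; apply: subset_trans a4 _; exact: subsetDl.
- apply: (le_trans a6); rewrite lerD2l; apply: potential_drop => //.
  by apply: indS iI.
- move=> J s1 s2; rewrite a8 // ifF //.
  by apply/negbTE; apply: contra vI => /(subsetP s2).
Qed.

End Containers.

Lemma indpoly_ex (R : realType) (V : finType) (ind : pred {set V}) (S C : {set V}) (y : R) :
  0 <= y -> indpoly ind S C y =
    (1 + y) ^+ #|C| * ex (y / (1 + y)) (enum C) (fun U => (ind (S :|: U))%:R).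
Proof.
move=> y0; have y1 : 1 + y != 0 by rewrite gt_eqF //; lra.
rewrite ex_sumE ?enum_uniq // mulr_sumr set_enum -cardE.
apply: eq_bigr => U sU; have cU := subset_leq_card sU.
have -> : 1 - y / (1 + y) = (1 + y)^-1 by field.
rewrite -{1}(subnKC cU) exprD expr_div_n exprVn.
have e1 : (1 + y) ^+ #|U| != 0 by rewrite expf_neq0.
have e2 : (1 + y) ^+ (#|C| - #|U|) != 0 by rewrite expf_neq0.
by field; rewrite e1 e2.
Qed.

Theorem hypergraph_containers (R : realType) (V J : finType) (Q : {set J}) (E : J -> {set V})
    (A : {set V}) (p delta D : R) :
  0 < p < 1 -> 0 < delta < 1 ->
  \sum_(j in Q) p ^+ #|E j| <= D ->
  \sum_(k in Q) \sum_(j in Q | (j != k) && (E j :&: E k != set0)) p ^+ #|E j :|: E k| <= D ->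
  exists f : {set V} -> {set V}, forall I : {set V},
    I \subset A -> (forall j, j \in Q -> ~~ (E j \subset I)) ->
    exists S : {set V},
      [/\ S \subset I, #|S|%:R * delta <= p / (1 - p) * #|A|%:R, [disjoint S & f S],
        f S \subset A & I \subset S :|: f S /\
        (\sum_(j in Q | E j \subset f S) p ^+ #|E j|) ^+ 2 <= 8 * D * delta * (p / (1 - p)) * #|A|%:R].
Proof.
move=> /andP[p0 p1] /andP[d0 d1] hD1 hD2.
pose x := p / (1 - p); have x0 : 0 < x by rewrite divr_gt0 // subr_gt0.
pose ind (U : {set V}) := [forall j in Q, ~~ (E j \subset U)].
have indS (U W : {set V}) : U \subset W -> ind W -> ind U.
  move=> UW /forall_inP h; apply/forall_inP => j jQ.
  by apply: contra (h j jQ) => /subset_trans; apply.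
pose B := x * #|V|%:R / delta.
pose N := (Num.truncn B).+1.
have hN : x * #|V|%:R <= delta * N%:R.
  by rewrite mulrC -ler_pdivrMl // mulrC; apply: ltW; rewrite [X in X < _]mulrC /N truncnS_gt.
have N0 : (0 < N)%N by [].
pose run I := container_run ind x delta N #|A| I set0 A.
exists (fun S => (run S).2) => I IA nI.
have iI : ind I by apply/forall_inP.
have dj0 : [disjoint (set0 : {set V}) & A] by rewrite -setI_eq0 set0I.
have := container_runP indS delta x0 N0 (leqnn #|A|) iI (sub0set I).
rewrite set0U => /(_ IA dj0); rewrite -/(run I).
case E1 : (run I) => [S C] [[SI IC dj CA] _ hpot ns rerun].
have RS : run S = (S, C) by apply: rerun.
exists S; rewrite RS; split=> //=; last split=> //.
  have i0 : ind set0 by apply: indS iI; exact: sub0set.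
  have iS : ind S by apply: indS iI.
  have pot : potential ind x N set0 A <= N%:R * (x * #|A|%:R).
    have -> : N%:R * (x * #|A|%:R) = \sum_(j < N) x * #|A|%:R.
      by rewrite sumr_const card_ord mulr_natl.
    apply: ler_sum => j _; set y := x / N%:R * j%:R.
    have y0 : 0 <= y by rewrite mulr_ge0 // divr_ge0 // ltW.
    have yx : y <= x.
      rewrite /y mulrAC ler_pdivrMr ?ltr0n // ler_pM2l // ler_nat; exact: ltnW.
    have gt0 : 0 < indpoly ind set0 A y by apply: lt_le_trans (indpoly_ge1 _ y0 i0).
    have le1 : indpoly ind set0 A y <= (1 + y) ^+ #|A|.
      rewrite indpoly_ex // ler_piMr ?exprn_ge0 ?addr_ge0 //.
      rewrite -[leRHS](ex_cst (y / (1 + y)) (enum A)); apply: ex_le => [|U _].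
        rewrite divr_ge0 ?addr_ge0 //= ler_pdivrMr ?mul1r; lra.
      by case: (ind _).
    apply: (@le_trans _ _ (ln ((1 + y) ^+ #|A|))).
      by rewrite ler_ln ?posrE ?exprn_gt0 //; lra.
    rewrite lnXn; last by lra.
    rewrite -[leLHS]mulr_natl mulrC; apply: ler_wpM2r => //; apply: le_trans yx.
    apply: le_ln1Dx; lra.
  have p0' := potential_ge0 x0 N0 C iS.
  rewrite cards0 mul0r add0r in hpot.
  have h : #|S|%:R * (delta * N%:R) <= N%:R * (x * #|A|%:R) by lra.
  have NR : 0 < N%:R :> R by rewrite ltr0n.
  by rewrite -(ler_pM2l NR); apply: le_trans h; rewrite mulrCA [N%:R * _]mulrC.
have i0 : ind set0 by apply: indS iI; exact: sub0set.
have iS : ind S by apply: indS iI.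
have big : (1 - 2 * delta) * x * #|C|%:R <= ln (indpoly ind set0 C x).
  apply: le_trans (indpoly_large indS x0 d1 N0 hN iS ns) _.
  have x0' := ltW x0.
  rewrite ler_ln ?posrE; first by apply: indpolyS => //; exact: sub0set.
    by apply: lt_le_trans (indpoly_ge1 _ x0' iS).
  by apply: lt_le_trans (indpoly_ge1 _ x0' i0).
pose Q' := [set j in Q | E j \subset C].
have xp : x / (1 + x) = p by rewrite /x; field; apply/andP; split; rewrite gt_eqF //; lra.
have p01 : 0 <= p <= 1 by rewrite !ltW.
have eP : ex p (enum C) (fun U => (avoids E (enum Q') U)%:R) = ex p (enum C) (fun U => (ind (set0 :|: U))%:R).
  apply: ex_ext => U UC; congr (nat_of_bool _)%:R; rewrite set0U.
  apply/allP/forall_inP => h j.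
    move=> jQ; case: (boolP (E j \subset U)) => // jU; rewrite -jU; apply: h.
    by rewrite mem_enum inE jQ; apply/subsetP => u /(subsetP jU)/UC; rewrite mem_enum.
  by rewrite mem_enum inE => /andP[jQ _]; exact: h.
have ipos : 0 < indpoly ind set0 C x by apply: lt_le_trans (indpoly_ge1 _ (ltW x0) i0).
have x1 : 0 < (1 + x) ^+ #|C| by rewrite exprn_gt0 //; lra.
have Ppos : 0 < ex p (enum C) (fun U => (avoids E (enum Q') U)%:R).
  by move: ipos; rewrite (indpoly_ex _ _ _ (ltW x0)) xp -eP pmulr_rgt0.
have Qs : {in Q', forall j, {subset E j <= enum C}}.
  by move=> j; rewrite inE => /andP[_ /subsetP h] u /h; rewrite mem_enum.
have pe k : 0 <= p ^+ k by rewrite exprn_ge0 // ltW.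
have sQ j : j \in Q' -> j \in Q by rewrite inE => /andP[].
have D1 : \sum_(j in Q') p ^+ #|E j| <= D.
  apply: le_trans hD1; rewrite big_mkcond [leRHS]big_mkcond /=; apply: ler_sum => j _.
  by case: (boolP (j \in Q')) => [/sQ ->|_] //; case: ifP.
have D2 : \sum_(k in Q') \sum_(j in Q' | (j != k) && (E j :&: E k != set0)) p ^+ #|E j :|: E k| <= D.
  apply: le_trans hD2; rewrite big_mkcond [leRHS]big_mkcond /=; apply: ler_sum => k _.
  case: (boolP (k \in Q')) => [/sQ ->|_]; last by case: ifP => // _; apply: sumr_ge0.
  rewrite big_mkcond [leRHS]big_mkcond /=; apply: ler_sum => j _.
  by case: (boolP (j \in Q')) => [/sQ ->|_] //=; case: ifP.
have := janson p01 (enum_uniq _) Qs Ppos D1 D2.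
have -> : \sum_(j in Q') p ^+ #|E j| = \sum_(j in Q | E j \subset C) p ^+ #|E j|.
  by apply: eq_bigl => j; rewrite inE.
move=> /le_trans; apply.
have D0 : 0 <= D by apply: le_trans hD1; apply: sumr_ge0.
have ll : - ln (ex p (enum C) (fun U => (avoids E (enum Q') U)%:R)) <= 2 * delta * x * #|A|%:R.
  have CA' : #|C|%:R <= #|A|%:R :> R by rewrite ler_nat subset_leq_card.
  apply: (@le_trans _ _ (2 * delta * x * #|C|%:R)); last first.
    by apply: ler_wpM2l => //; apply: mulr_ge0; [apply: mulr_ge0 => // |]; exact: ltW.
  move: big; rewrite (indpoly_ex _ _ _ (ltW x0)) xp -eP lnM ?posrE // lnXn; last by lra.
  have l1 : ln (1 + x) <= x by apply: le_ln1Dx; lra.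
  have l2 : ln (1 + x) *+ #|C| <= x * #|C|%:R by rewrite -[leLHS]mulr_natr ler_wpM2r.
  lra.
apply: (@le_trans _ _ (4 * D * (2 * delta * x * #|A|%:R))); first by apply: ler_wpM2l => //; lra.
by rewrite le_eqVlt; apply/orP; left; apply/eqP; rewrite /x; ring.
Qed.

(** * Containers for graphs without a copy of H *)

Section Copies.
Variables (R : realType) (T X : finType) (H : sgraph T).
Implicit Types (phi psi : {ffun T -> X}).

Lemma sgraph_edge (e : {set T}) : e \in edges H -> #|e| = 2%N /\ e \subset verts H.
Proof.
move=> eH; case: H eH => VE wf eH; have /forallP/(_ e)/implyP/(_ eH)/andP[/eqP] := wf.
by [].
Qed.

Definition embedding (phi : {ffun T -> X}) : bool :=
  [forall x in verts H, forall y in verts H, (phi x == phi y) ==> (x == y)].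

Definition copy (phi : {ffun T -> X}) : {set {set X}} :=
  [set phi @: (e : {set T}) | e in edges H].

Lemma embeddingP phi : reflect {in verts H &, injective phi} (embedding phi).
Proof.
apply: (iffP forall_inP) => [h x y xH yH E | h x xH].
  by have /forall_inP/(_ y yH)/implyP := h x xH; rewrite E eqxx => /(_ isT)/eqP.
by apply/forall_inP => y yH; apply/implyP => /eqP E; apply/eqP; exact: h.
Qed.

Lemma imset_edge_inj phi : embedding phi -> {in edges H &, injective (fun e : {set T} => phi @: e)}.
Proof.
move=> /embeddingP ie e1 e2 /sgraph_edge[_ s1] /sgraph_edge[_ s2] E.
have sub (a b : {set T}) : a \subset verts H -> b \subset verts H -> phi @: a = phi @: b -> a \subset b.
  move=> sa sb Eab; apply/subsetP => x xa.
  have : phi x \in phi @: b by rewrite -Eab imset_f.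
  by case/imsetP => y yb /ie -> //; [exact: (subsetP sa) | exact: (subsetP sb)].
apply/eqP; rewrite eqEsubset; apply/andP; split; exact: sub.
Qed.

Lemma card_copy phi : embedding phi -> #|copy phi| = #|edges H|.
Proof. by move=> ie; rewrite card_in_imset //; exact: imset_edge_inj. Qed.

Lemma card_constrained (W : {set T}) (B : {set X}) :
  #|[set psi : {ffun T -> X} | [forall x in W, psi x \in B]]| = (#|B| ^ #|W| * #|X| ^ (#|T| - #|W|))%N.
Proof.
pose F x : {pred X} := [pred u | (x \in W) ==> (u \in B)].
have -> : [set psi : {ffun T -> X} | [forall x in W, psi x \in B]] = [set psi in family F].
  by apply/setP => psi; rewrite in_set.
rewrite cardsE card_family foldrE big_image /=.
rewrite (bigID (fun x => x \in W)) /=; congr (_ * _)%N.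
  by rewrite -prod_nat_const; apply: eq_bigr => x xW; apply: eq_card => u; rewrite inE xW.
have -> : (#|T| - #|W|)%N = #|~: W| by rewrite -(cardsC W) addKn.
rewrite -prod_nat_const; apply: eq_big => [x|x /negbTE xW]; first by rewrite inE.
by apply: eq_card => u; rewrite inE xW.
Qed.

Variable q : R.
Hypotheses (q0 : 0 < q) (X0 : (0 < #|X|)%N).
Let n : R := #|X|%:R.
Let h := #|edges H|.
Hypothesis hq : forall J : {set {set T}}, J \subset edges H -> J != set0 ->
  n ^+ 2 * q <= n ^+ #|cover J| * q ^+ #|J|.

Definition overlap_bound : R :=
  2 ^+ h * #|T|%:R ^+ #|T| * n ^+ #|T| * n ^+ #|T| * q ^+ h * q ^+ h / (n ^+ 2 * q).

Let n0 : 0 < n. Proof. by rewrite ltr0n. Qed.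
Let nq0 : 0 < n ^+ 2 * q. Proof. by rewrite mulr_gt0 ?exprn_gt0. Qed.

Definition common (phi psi : {ffun T -> X}) : {set {set T}} :=
  [set e in edges H | psi @: (e : {set T}) \in copy phi].

Lemma card_overlap phi psi : embedding phi -> embedding psi ->
  (#|copy psi :|: copy phi| + #|common phi psi| = 2 * h)%N.
Proof.
move=> ip is_.
have <- : #|copy psi :&: copy phi| = #|common phi psi|.
  rewrite -(card_in_imset (f := fun e : {set T} => psi @: e)); last first.
    move=> e1 e2; rewrite !inE => /andP[e1H _] /andP[e2H _]; exact: imset_edge_inj.
  apply: eq_card => e; rewrite inE; apply/andP/imsetP.
    by move=> [/imsetP[e0 e0H ->] eP]; exists e0; rewrite // inE e0H.
  by move=> [e0]; rewrite inE => /andP[e0H eP] ->; rewrite eP; split=> //; apply/imsetP; exists e0.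
by rewrite cardsUI !card_copy // mul2n addnn.
Qed.

Lemma sum_copies_le : (0 < #|T|)%N -> edges H != set0 ->
  \sum_(phi in [set phi | embedding phi]) q ^+ #|copy phi| <= overlap_bound.
Proof.
move=> T0 eH; apply: (@le_trans _ _ (\sum_(phi : {ffun T -> X}) q ^+ h)).
  rewrite big_mkcond /=; apply: ler_sum => phi _; rewrite inE.
  by case: ifP => [/card_copy -> //|_]; rewrite exprn_ge0 // ltW.
rewrite sumr_const card_ffun -mulr_natl natrX -/n /overlap_bound ler_pdivlMr //.
have h1 := hq (subxx _) eH.
have h2 : n ^+ #|cover (edges H)| <= n ^+ #|T|.
  by apply: ler_weXn2l; rewrite ?max_card // ler1n.
have h3 : 1 <= 2 ^+ h * #|T|%:R ^+ #|T| :> R.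
  by rewrite mulr_ege1 // exprn_ege1 // ler1n.
have a0 : 0 <= n ^+ #|T| * q ^+ h by rewrite mulr_ge0 ?exprn_ge0 // ltW.
apply: (@le_trans _ _ (n ^+ #|T| * q ^+ h * (n ^+ #|T| * q ^+ h))).
  apply: ler_wpM2l => //; apply: (le_trans h1); apply: ler_wpM2r => //.
  by rewrite exprn_ge0 // ltW.
rewrite -[leLHS]mul1r; apply: (@le_trans _ _ (2 ^+ h * #|T|%:R ^+ #|T| * (n ^+ #|T| * q ^+ h * (n ^+ #|T| * q ^+ h)))).
  by apply: ler_wpM2r => //; exact: mulr_ge0.
by move: (2 ^+ h : R) (#|T|%:R ^+ #|T| : R) (n ^+ #|T|) (q ^+ h) => a b c d; apply: le_of_eq; ring.
Qed.

Lemma sum_overlaps_le : (0 < #|T|)%N ->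
  \sum_(phi in [set phi | embedding phi])
    \sum_(psi in [set psi | embedding psi] | (psi != phi) && (copy psi :&: copy phi != set0))
      q ^+ #|copy psi :|: copy phi| <= overlap_bound.
Proof.
move=> T0.
pose B : R := 2 ^+ h * (#|T|%:R ^+ #|T| * n ^+ #|T| * q ^+ h * q ^+ h / (n ^+ 2 * q)).
have B0 : 0 <= B.
  by rewrite mulr_ge0 ?exprn_ge0 // divr_ge0 ?(ltW nq0) // !mulr_ge0 ?exprn_ge0 // ltW.
have key phi : embedding phi ->
   \sum_(psi in [set psi | embedding psi] | (psi != phi) && (copy psi :&: copy phi != set0))
      q ^+ #|copy psi :|: copy phi| <= B; last first.
  apply: (@le_trans _ _ (\sum_(phi : {ffun T -> X}) B)).
    rewrite big_mkcond /=; apply: ler_sum => phi _; rewrite inE.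
    by case: ifP => [/key|].
  rewrite sumr_const card_ffun -mulr_natl natrX -/n /overlap_bound /B.
  by move: (2 ^+ h : R) (#|T|%:R ^+ #|T| : R) (n ^+ #|T|) (q ^+ h) => a b c d; apply: le_of_eq; field; rewrite !gt_eqF.
move=> ip.
apply: (@le_trans _ _ (\sum_(psi : {ffun T -> X}) \sum_(J in powerset (edges H) | J != set0)
    (embedding psi && (common phi psi == J))%:R * (q ^+ h * q ^+ h / q ^+ #|J|))).
  rewrite big_mkcond /=; apply: ler_sum => psi _.
  have J0 J : 0 <= (embedding psi && (common phi psi == J))%:R * (q ^+ h * q ^+ h / q ^+ #|J|).
    by rewrite mulr_ge0 // divr_ge0 ?mulr_ge0 ?exprn_ge0 // ltW.
  rewrite inE; case: ifP => [/and3P[is_ _ ne]|_]; last exact: sumr_ge0.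
  rewrite (bigD1 (common phi psi)) /=; last first.
    apply/andP; split; first by rewrite inE; apply/subsetP => e; rewrite inE => /andP[].
    move: ne; apply: contraNneq => E0; apply/eqP/setP => e; rewrite in_set0.
    apply/negbTE/negP => /setIP[/imsetP[e0 e0H ->] eP].
    have : e0 \in common phi psi by rewrite inE e0H.
    by rewrite E0 inE.
  apply: ler_wpDr; first exact: sumr_ge0.
  rewrite is_ eqxx mul1r ler_pdivlMr ?exprn_gt0 // -!exprD card_overlap //.
  by rewrite mul2n addnn.
rewrite exchange_big /=.
apply: (@le_trans _ _ (\sum_(J in powerset (edges H)) #|T|%:R ^+ #|T| * n ^+ #|T| * q ^+ h * q ^+ h / (n ^+ 2 * q))); last first.
  by rewrite sumr_const card_powerset -/h -[leLHS]mulr_natl natrX.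
rewrite big_mkcond [leRHS]big_mkcond /=; apply: ler_sum => J _.
rewrite inE; case: (boolP (J \subset edges H)) => //= JH.
case: ifP => J0; last first.
  by rewrite divr_ge0 ?(ltW nq0) // !mulr_ge0 ?exprn_ge0 // ltW.
rewrite -mulr_suml.
have cJ : (#|cover J| <= #|T|)%N by exact: max_card.
have : \sum_psi (embedding psi && (common phi psi == J))%:R <= #|T|%:R ^+ #|T| * n ^+ (#|T| - #|cover J|) :> R.
  apply: (@le_trans _ _ (#|[set psi : {ffun T -> X} | [forall x in cover J, psi x \in [set phi y | y : T]]]|%:R)).
    rewrite -sum1_card natr_sum [leRHS]big_mkcond /=; apply: ler_sum => psi _.
    rewrite inE; case: (boolP (embedding psi && _)) => /= [/andP[is_ /eqP cE]|_]; last by case: ifP.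
    rewrite ifT //; apply/forall_inP => x /bigcupP[e].
    rewrite -cE inE => /andP[eH /imsetP[e' e'H E]] xe.
    have : psi x \in phi @: e' by rewrite -E imset_f.
    by case/imsetP => y _ ->; apply: imset_f.
  rewrite card_constrained natrM !natrX; apply: ler_wpM2r; first by rewrite exprn_ge0.
  have c1 : #|[set phi y | y : T]|%:R <= #|T|%:R :> R by rewrite ler_nat; exact: leq_imset_card.
  apply: (@le_trans _ _ (#|T|%:R ^+ #|cover J|)); first by apply: lerXn2r; rewrite ?nnegrE.
  by apply: ler_weXn2l; rewrite // ler1n.
move=> hs; have qJ : 0 <= q ^+ h * q ^+ h / q ^+ #|J| by rewrite divr_ge0 ?mulr_ge0 ?exprn_ge0 // ltW.
apply: (le_trans (ler_wpM2r qJ hs)).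
have e1 : n ^+ #|T| = n ^+ (#|T| - #|cover J|) * n ^+ #|cover J| by rewrite -exprD subnK.
rewrite ler_pdivlMr // e1.
have a0 : 0 <= #|T|%:R ^+ #|T| * n ^+ (#|T| - #|cover J|) * (q ^+ h * q ^+ h / q ^+ #|J|).
  by rewrite mulr_ge0 // mulr_ge0 ?exprn_ge0 // ltW.
apply: (le_trans (ler_wpM2l a0 (hq JH J0))).
have qn0 : q ^+ #|J| != 0 by rewrite expf_neq0 // gt_eqF.
by move: (#|T|%:R ^+ #|T| : R) (n ^+ (#|T| - #|cover J|)) (n ^+ #|cover J|) (q ^+ h) (q ^+ #|J|) qn0 => a b c d e e0; apply: le_of_eq; field.
Qed.

Theorem graph_containers (delta : R) : (0 < #|T|)%N -> edges H != set0 -> q <= 1 / 2 -> 0 < delta < 1 ->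
  exists f : {set {set X}} -> {set {set X}}, forall I : {set {set X}},
    (forall e, e \in I -> #|e| = 2%N) -> (forall phi, embedding phi -> ~~ (copy phi \subset I)) ->
    exists S : {set {set X}},
      [/\ S \subset I, #|S|%:R * delta <= 2 * q * n ^+ 2, [disjoint S & f S],
        forall e, e \in f S -> #|e| = 2%N & I \subset S :|: f S /\
        #|[set phi | embedding phi && (copy phi \subset f S)]|%:R ^+ 2 <=
          16 * 2 ^+ h * #|T|%:R ^+ #|T| * delta * (n ^+ #|T|) ^+ 2].
Proof.
move=> T0 eH q2 d01.
have q01 : 0 < q < 1 by rewrite q0 /=; lra.
pose A := [set e : {set X} | #|e| == 2%N].
have cA : #|A|%:R <= n ^+ 2.
  rewrite /A card_draws.
  rewrite -natrX ler_nat bin2; apply: leq_trans (half_leq (leq_mul (leqnn _) (leq_pred _))) _.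
  by rewrite -mulnn -divn2 leq_div.
have [f hf] := hypergraph_containers A q01 d01 (sum_copies_le T0 eH) (sum_overlaps_le T0).
exists f => I I2 Ifree.
have IA : I \subset A by apply/subsetP => e /I2 c2; rewrite inE c2.
have fI phi : phi \in [set phi | embedding phi] -> ~~ (copy phi \subset I) by rewrite inE => /Ifree.
have [S [SI cS dj fA [IS hN]]] := hf I IA fI.
have x2 : q / (1 - q) <= 2 * q.
  rewrite ler_pdivrMr; last by lra.
  by rewrite -mulrA [X in _ <= _ * X]mulrC mulrA -[leLHS]mul1r ler_wpM2r; lra.
case/andP: (d01) => d0 d1.
have h1 : q / (1 - q) * #|A|%:R <= 2 * q * n ^+ 2.
  by apply: ler_pM => //; apply: divr_ge0; [exact: ltW | lra].
exists S; split=> //.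
- exact: le_trans cS h1.
- by move=> e /(subsetP fA); rewrite inE => /eqP.
split=> //; set N := #|_|.
have EN : \sum_(j in [set phi | embedding phi] | copy j \subset f S) q ^+ #|copy j| = N%:R * q ^+ h.
  rewrite /N -sum1_card natr_sum mulr_suml; apply: eq_big => phi; rewrite !inE //.
  by move=> /andP[/card_copy -> _]; rewrite mul1r.
rewrite EN in hN.
have qh0 : 0 < (q ^+ h) ^+ 2 by rewrite !exprn_gt0.
rewrite -(ler_pM2r qh0) -exprMn; apply: (le_trans hN).
have ob0 : 0 <= overlap_bound.
  by rewrite divr_ge0 ?(ltW nq0) // !mulr_ge0 ?exprn_ge0 // ltW.
rewrite -mulrA; apply: (@le_trans _ _ (8 * overlap_bound * delta * (2 * q * n ^+ 2))).
  apply: ler_wpM2l h1; apply: mulr_ge0; [exact: mulr_ge0 | exact: ltW].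
rewrite /overlap_bound.
have qn : q != 0 by rewrite gt_eqF.
have nn : n != 0 by rewrite gt_eqF.
move: (2 ^+ h : R) (#|T|%:R ^+ #|T| : R) (n ^+ #|T|) (q ^+ h) => a b c d.
by apply: le_of_eq; field; rewrite nn qn.
Qed.

End Copies.

Definition adj (X : finType) (C : {set {set X}}) : rel X := fun u v => [set u; v] \in C.

Lemma adj_sym (X : finType) (C : {set {set X}}) : symmetric (adj C).
Proof. by move=> u v; rewrite /adj setUC. Qed.

Lemma adj_irr (X : finType) (C : {set {set X}}) :
  (forall e, e \in C -> #|e| = 2%N) -> irreflexive (adj C).
Proof.
move=> C2 u; apply/negbTE/negP => /C2; by rewrite setUid cards1.
Qed.

Section FewCliques.
Variables (R : realType) (T : finType) (H : sgraph T) (r : nat) (f : T -> 'I_r).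
Hypothesis fH : forall x y, [set x; y] \in edges H -> f x != f y.

Lemma card_noninjective (X : finType) :
  (#|[set phi : {ffun T -> X} | ~~ embedding H phi]| <= #|T| ^ 2 * #|X| ^ (#|T| - 1))%N.
Proof.
pose S (p : T * T) := [set phi : {ffun T -> X} | (p.1 != p.2) && (phi p.1 == phi p.2)].
apply: (@leq_trans (\sum_(p : T * T) #|S p|)).
  apply: (@leq_trans #|\bigcup_(p : T * T) S p|).
    apply/subset_leq_card/subsetP => phi; rewrite inE negb_forall => /existsP[x].
    rewrite negb_imply negb_forall => /andP[xH /existsP[y]].
    rewrite !negb_imply => /andP[yH /andP[E xy]].
    by apply/bigcupP; exists (x, y) => //; rewrite inE xy.
  apply: (big_ind2 (fun (A : {set {ffun T -> X}}) n => (#|A| <= n)%N)) => //.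
    by rewrite cards0.
  by move=> A1 n1 A2 n2 h1 h2; apply: leq_trans (leq_card_setU _ _) (leq_add h1 h2).
have -> : (#|T| ^ 2 = #|{: T * T}|)%N by rewrite card_prod mulnn.
rewrite -sum_nat_const; apply: leq_sum => -[x y] _; rewrite /S /=.
have [->|xy] := eqVneq x y.
  by rewrite (_ : [set _ | _] = set0) ?cards0 //; apply/setP => phi; rewrite !inE.
pose g (b : bool) := if b then x else y.
have ig : injective g by move=> [] [] //= E; rewrite E eqxx in xy.
have := card_marginal (fun z : {ffun bool -> X} => z true == z false) ig.
rewrite card_bool => hm.
apply: (@leq_trans (#|X| ^ (#|T| - 2) * #|[set z : {ffun bool -> X} | z true == z false]|)).
  by rewrite -hm; apply/eq_leq/eq_card => phi; rewrite !inE !ffunE.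
have t2 : (2 <= #|T|)%N by rewrite -card_bool; exact: leq_card ig.
have -> : (#|T| - 1 = (#|T| - 2).+1)%N by rewrite -subSn.
rewrite expnSr leq_mul2l; apply/orP; right.
pose c (z : {ffun bool -> X}) := z true.
rewrite -(card_in_imset (f := c)); first exact: max_card.
move=> z1 z2; rewrite !inE => /eqP e1 /eqP e2 E.
by apply/ffunP => -[]; rewrite // -e1 -e2.
Qed.

Lemma few_cliques (eps : R) : (0 < #|T|)%N -> 0 < eps -> exists2 k : R, 0 < k &
  exists n0 : nat, forall (X : finType) (C : {set {set X}}), (n0 <= #|X|)%N ->
    #|[set phi : {ffun T -> X} | embedding H phi && (copy H phi \subset C)]|%:R <= k * #|X|%:R ^+ #|T| ->
    #|[set y : {ffun 'I_r -> X} | clique_tuple (adj C) y]|%:R <= eps * #|X|%:R ^+ r.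
Proof.
move=> T0 e0; have [k k0 hk] := many_homs r T0 e0.
exists (k / 4); first by rewrite divr_gt0.
pose B := #|T|%:R ^+ 2 / (k / 4).
exists (Num.truncn B).+1 => X C hX hN.
have X0 : (0 < #|X|)%N by apply: leq_trans hX.
set n : R := #|X|%:R in hN *; have n0 : 0 < n by rewrite ltr0n.
have Bn : B <= n by apply/ltW/(lt_le_trans (truncnS_gt _)); rewrite ler_nat.
rewrite leNgt; apply/negP => /ltW /(hk X (adj C) f X0); rewrite -/n.
set A := [set phi | _]; move=> hA.
have : (#|A| <= #|[set phi : {ffun T -> X} | embedding H phi && (copy H phi \subset C)]| +
    #|[set phi : {ffun T -> X} | ~~ embedding H phi]|)%N.
  apply: leq_trans (leq_card_setU _ _); apply/subset_leq_card/subsetP => phi.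
  rewrite !inE => /forallP hphi; case: (embedding H phi) => //=; rewrite orbF.
  apply/subsetP => e /imsetP[e0' e0H ->].
  have [/eqP/cards2P[x [y [xy E]]] _] := sgraph_edge e0H; subst e0'.
  have := hphi x => /forallP/(_ y)/implyP; rewrite imsetU1 imset_set1; apply.
  exact: fH.
rewrite -(ler_nat R) natrD => /(le_trans hA).
have := card_noninjective X; rewrite -(ler_nat R) natrM !natrX -/n => h1 h2.
have eT : n ^+ #|T| = n * n ^+ (#|T| - 1) by rewrite -exprS subn1 prednK.
have h3 : #|T|%:R ^+ 2 * n ^+ (#|T| - 1) <= k / 4 * n ^+ #|T|.
  rewrite eT mulrA; apply: ler_wpM2r; first exact/exprn_ge0/ltW.
  by rewrite mulrC -ler_pdivrMr // divr_gt0.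
have nT : 0 < k * n ^+ #|T| by rewrite mulr_gt0 // exprn_gt0.
move: hN h1 h2 h3 nT; move: (n ^+ #|T|) (#|T|%:R ^+ 2 * n ^+ _) => a b; lra.
Qed.

End FewCliques.

Section Deterministic.
Variable n : nat.
Local Notation V := 'I_n.
Implicit Types (A B W : {set V}) (E C G S : {set {set V}}).

Definition touching A B : {set {set V}} := [set e : {set V} | (e \subset B) && (e :&: A != set0)].

Lemma sum_incidence E A : (forall e, e \in E -> #|e| = 2%N) ->
  (\sum_(v in A) #|[set e in E | v \in e]| =
   #|[set e in E | e :&: A != set0]| + #|[set e in E | e \subset A]|)%N.
Proof.
move=> E2.
have h (P : pred {set V}) : #|[set e in E | P e]| = (\sum_(e in E) P e)%N.
  rewrite -sum1_card big_mkcond [RHS]big_mkcond; apply: eq_bigr => e _.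
  by rewrite inE; case: (e \in E); case: (P e).
rewrite !h -big_split /= (eq_bigr (fun v => \sum_(e in E) (v \in e))%N) => [|v _]; last exact: h.
rewrite exchange_big /=; apply: eq_bigr => e eE.
have -> : (\sum_(v in A) (v \in e) = #|e :&: A|)%N.
  rewrite -sum1_card big_mkcond [RHS]big_mkcond; apply: eq_bigr => v _.
  by rewrite inE andbC; case: (v \in A); case: (v \in e).
have e2 := E2 e eE; rewrite -cards_eq0.
have := subset_leq_card (subsetIl e A); rewrite e2.
have -> : (e \subset A) = (#|e :&: A| == 2%N).
  apply/idP/eqP => [/setIidPl -> //|E']; apply/setIidPl/eqP.
  by rewrite eqEcard subsetIl e2 E'.
by case: #|_| => [|[|[|]]].
Qed.

Lemma incidence_adj C W v : (forall e, e \in C -> #|e| = 2%N) ->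
  (#|[set e in [set e in C | e \subset W] | v \in e]| <= #|[set w in W | adj C v w]|)%N.
Proof.
move=> C2; apply: leq_trans (leq_imset_card (fun w => [set v; w]) _).
apply/subset_leq_card/subsetP => e; rewrite !inE -andbA => /and3P[eC eW ve].
have /eqP/cards2P[x [y [xy E]]] := C2 e eC; subst e.
have [xW yW] : x \in W /\ y \in W by split; apply: (subsetP eW); rewrite !inE eqxx ?orbT.
move: ve; rewrite !inE => /orP[/eqP E|/eqP E]; subst v; apply/imsetP.
  by exists y => //; rewrite inE yW.
by exists x; rewrite ?inE ?xW /adj setUC.
Qed.

Definition mono_pairs C W (c : V -> nat) : {set V * V} :=
  [set p | [&& p.1 \in W, p.2 \in W, adj C p.1 p.2 & c p.1 == c p.2]].

Lemma sum_mono C W (c : V -> nat) k : (forall e, e \in C -> #|e| = 2%N) ->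
  (\sum_(i < k) #|C :&: touching [set v in W | c v == i] [set v in W | c v == i]| <= #|mono_pairs C W c|)%N.
Proof.
move=> C2; pose P (i : nat) := [set p in mono_pairs C W c | c p.1 == i].
apply: (@leq_trans (\sum_(i < k) #|P i|)).
  apply: leq_sum => i _.
  apply: leq_trans (leq_imset_card (fun p : V * V => [set p.1; p.2]) _).
  apply/subset_leq_card/subsetP => e; rewrite !inE => /andP[eC /andP[sub _]].
  have /eqP/cards2P[x [y [xy E]]] := C2 e eC; subst e.
  have xW : x \in [set v in W | c v == i] by apply: (subsetP sub); rewrite !inE eqxx.
  have yW : y \in [set v in W | c v == i] by apply: (subsetP sub); rewrite !inE eqxx orbT.
  move: xW yW; rewrite !inE => /andP[xW cx] /andP[yW cy].
  apply/imsetP; exists (x, y) => //; rewrite !inE /= xW yW cx /adj eC /=.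
  by rewrite (eqP cx) eq_sym cy.
rewrite (eq_bigr (fun i : 'I_k => \sum_(p in mono_pairs C W c) (c p.1 == i))%N); last first.
  move=> i _; rewrite -sum1_card big_mkcond [RHS]big_mkcond; apply: eq_bigr => p _.
  by rewrite inE; case: (p \in _); case: (_ == _).
rewrite exchange_big /= -sum1_card; apply: leq_sum => p _.
have [ck|ck] := ltnP (c p.1) k.
  rewrite (bigD1 (Ordinal ck)) //= eqxx big1 ?addn0 // => i ne.
  by case: eqP => // E; case/eqP: ne; apply: val_inj.
by rewrite big1 // => i _; case: eqP => // E; move: (ltn_ord i); rewrite -E ltnNge ck.
Qed.

Lemma card_classes E S G C W (c : V -> nat) k : (forall v, c v < k)%N ->
  (forall e, e \in E -> #|e| = 2%N) -> (forall e, e \in E -> e \subset W) ->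
  E \subset G -> E \subset S :|: C ->
  (#|[set e in E | [exists i : 'I_k, e \subset [set v in W | c v == i]]]| <=
   #|S| + \sum_(i < k) #|G :&: (C :&: touching [set v in W | c v == i] [set v in W | c v == i])|)%N.
Proof.
move=> ck E2 EW EG ESC.
apply: (@leq_trans #|S :|: \bigcup_(i < k) (G :&: (C :&: touching [set v in W | c v == i] [set v in W | c v == i]))|).
  apply/subset_leq_card/subsetP => e; rewrite !inE => /andP[eE /existsP[i si]].
  have := subsetP ESC e eE; rewrite inE => /orP[->//|eC]; apply/orP; right.
  apply/bigcupP; exists i => //; rewrite !inE (subsetP EG) // eC si /=.
  by rewrite (setIidPl si) -cards_eq0 E2.
apply: leq_trans (leq_card_setU _ _) _; rewrite leq_add2l.
apply: (big_ind2 (fun (A : {set {set V}}) n => (#|A| <= n)%N)) => //.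
  by rewrite cards0.
by move=> A1 n1 A2 n2 h1 h2; apply: leq_trans (leq_card_setU _ _) (leq_add h1 h2).
Qed.

End Deterministic.

Section StabilityFromContainer.
Variables (R : realType) (n : nat) (C G S E : {set {set 'I_n}}) (W : {set 'I_n}).
Hypotheses (C2 : forall e, e \in C -> #|e| = 2%N) (E2 : forall e, e \in E -> #|e| = 2%N).
Hypotheses (EW : forall e, e \in E -> e \subset W) (EG : E \subset G) (ESC : E \subset S :|: C).
Variables (p eta : R).
Hypothesis p0 : 0 < p.
Hypothesis typ : forall A B : {set 'I_n}, #|G :&: (C :&: touching A B)|%:R <=
  p * #|C :&: touching A B|%:R + eta * p * n%:R ^+ 2.
Hypothesis cS : #|S|%:R <= eta * p * n%:R ^+ 2.

Lemma degree_sum_le (theta : R) (A : {set 'I_n}) : A \subset W ->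
  (forall v, v \in W -> theta * p * n%:R <= #|[set e in E | v \in e]|%:R) ->
  theta * n%:R * #|A|%:R <= 4 * eta * n%:R ^+ 2 + (\sum_(v in A) #|[set w in W | adj C v w]|)%:R.
Proof.
move=> AW hdeg; rewrite -(ler_pM2l p0).
set Deg := (\sum_(v in A) #|[set w in W | adj C v w]|)%N.
have h1 : theta * p * n%:R * #|A|%:R <= (\sum_(v in A) #|[set e in E | v \in e]|)%:R.
  rewrite natr_sum mulr_natr -sumr_const; apply: ler_sum => v vA.
  by apply: hdeg; exact: (subsetP AW).
have E1 : (#|[set e in E | e :&: A != set0]| <= #|S| + #|G :&: (C :&: touching A W)|)%N.
  apply: leq_trans (leq_card_setU _ _); apply/subset_leq_card/subsetP => e.
  rewrite !inE => /andP[eE eA]; have := subsetP ESC e eE; rewrite inE => /orP[->//|->].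
  by rewrite (subsetP EG) // EW // eA orbT.
have E3 : (#|[set e in E | e \subset A]| <= #|S| + #|G :&: (C :&: touching A A)|)%N.
  apply: leq_trans (leq_card_setU _ _); apply/subset_leq_card/subsetP => e.
  rewrite !inE => /andP[eE eA]; have := subsetP ESC e eE; rewrite inE => /orP[->//|->].
  by rewrite (subsetP EG) // eA (setIidPl eA) -cards_eq0 E2 // orbT.
have D1 : (#|C :&: touching A W| + #|C :&: touching A A| <= Deg)%N.
  pose CW := [set e in C | e \subset W].
  have CW2 e : e \in CW -> #|e| = 2%N by rewrite inE => /andP[/C2].
  apply: (@leq_trans (\sum_(v in A) #|[set e in CW | v \in e]|)).
    rewrite sum_incidence //; apply: leq_add; apply/subset_leq_card/subsetP => e; rewrite !inE.
      by move=> /and3P[-> -> ->].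
    by move=> /and3P[-> eA _]; rewrite eA (subset_trans eA).
  by apply: leq_sum => v _; exact: incidence_adj.
move: h1; rewrite sum_incidence // natrD.
have := typ A W; have := typ A A; move: E1 E3 D1; rewrite -!(ler_nat R) !natrD.
set x1 := #|[set e in E | _]|%:R; set x2 := #|[set e in E | _]|%:R.
set y1 := #|G :&: _|%:R; set y2 := #|G :&: _|%:R; set z1 := #|C :&: _|%:R; set z2 := #|C :&: _|%:R.
move=> h1 h2 h3 h4 h5 h6.
have h7 : p * (z1 + z2) <= p * Deg%:R by rewrite ler_pM2l.
clear h3; move: cS h1 h2 h4 h5 h6 h7; move: x1 x2 y1 y2 z1 z2 (Deg%:R : R) (#|S|%:R : R) (n%:R ^+ 2 : R).
by move: (n%:R : R) (#|A|%:R : R) => m1 a x1 x2 y1 y2 z1 z2 d s m; lra.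
Qed.

Lemma mono_edges_le k (c : 'I_n -> nat) : (forall v, c v < k)%N ->
  #|[set e in E | [exists i : 'I_k, e \subset [set v in W | c v == i]]]|%:R <=
  p * #|mono_pairs C W c|%:R + k.+1%:R * eta * p * n%:R ^+ 2.
Proof.
move=> ck; have := card_classes ck E2 EW EG ESC.
rewrite -(ler_nat R) natrD natr_sum => /le_trans; apply.
pose t i := touching [set v in W | c v == i] [set v in W | c v == i].
have h : \sum_(i < k) #|G :&: (C :&: t i)|%:R <= \sum_(i < k) (p * #|C :&: t i|%:R + eta * p * n%:R ^+ 2).
  by apply: ler_sum => i _; exact: typ.
have := sum_mono W c k C2; rewrite -(ler_nat R) natr_sum.
move: h; rewrite big_split /= -mulr_sumr sumr_const card_ord -[_ *+ k]mulr_natl -natr1.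
set x := \sum_(i < k) #|G :&: _|%:R; set y := \sum_(i < k) #|C :&: _|%:R => h1 h2.
have h3 : p * y <= p * #|mono_pairs C W c|%:R by rewrite ler_pM2l.
rewrite -/x; clear h2; move: cS h1 h3; move: x y (#|mono_pairs C W c|%:R : R) (#|S|%:R : R) (n%:R ^+ 2 : R) (k%:R : R).
by move=> x y z s m j; lra.
Qed.

End StabilityFromContainer.

Theorem stability_from_container (R : realType) (r : nat) (gamma : R) : (1 < r)%N ->
  0 < gamma <= 1 -> exists eps eta : R, [/\ 0 < eps, 0 < eta &
  forall (n : nat) (C G S E : {set {set 'I_n}}) (W : {set 'I_n}) (p : R),
  (0 < n)%N -> 0 < p ->
  (forall e, e \in C -> #|e| = 2%N) -> (forall e, e \in E -> #|e| = 2%N) ->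
  (forall e, e \in E -> e \subset W) -> E \subset G -> E \subset S :|: C ->
  (forall A B : {set 'I_n}, #|G :&: (C :&: touching A B)|%:R <=
     p * #|C :&: touching A B|%:R + eta * p * n%:R ^+ 2) ->
  #|S|%:R <= eta * p * n%:R ^+ 2 ->
  #|[set y : {ffun 'I_r -> 'I_n} | clique_tuple (adj C) y]|%:R <= eps * n%:R ^+ r ->
  (forall v, v \in W -> (1 - 3 / (3 * r%:R - 4) + gamma) * p * n%:R <= #|[set e in E | v \in e]|%:R) ->
  exists2 c : 'I_n -> nat, (forall v, c v < r.-1)%N &
    #|[set e in E | [exists i : 'I_r.-1, e \subset [set v in W | c v == i]]]|%:R <= gamma * p * n%:R ^+ 2].
Proof.
move=> r1 /andP[g0 g1]; have d0 := ratio_gt0 R r1.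
have z0 : 0 < gamma / 2 by rewrite divr_gt0.
have [eps0 [eta0 [e0 h0 dense]]] := dense_stability r1 g0 z0.
pose kap := gamma / 2.
pose b := kap ^+ 2 * eta0 / 4.
have b0 : 0 < b by rewrite /b divr_gt0 // mulr_gt0 // exprn_gt0.
pose b' := gamma / 2 / r%:R.
have r0 : 0 < r%:R :> R by rewrite ltr0n ltnW.
have b'0 : 0 < b' by rewrite /b' divr_gt0.
exists (eps0 * kap ^+ r), (Num.min b b'); split.
- by rewrite mulr_gt0 // exprn_gt0.
- by rewrite lt_min b0.
move=> n C G S E W p n0 p0 C2 E2 EW EG ESC typ cS hK hdeg.
set eta := Num.min b b' in typ cS.
have [eb eb'] : eta <= b /\ eta <= b' by rewrite /eta !ge_min !lexx orbT.
have nR : 0 < n%:R :> R by rewrite ltr0n.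
have m0 : 0 < n%:R ^+ 2 :> R by rewrite exprn_gt0.
suff [c ck hc] : exists2 c : 'I_n -> nat, (forall v, c v < r.-1)%N &
    #|mono_pairs C W c|%:R <= gamma / 2 * n%:R ^+ 2.
  exists c => //; apply: (le_trans (mono_edges_le C2 E2 EW EG ESC p0 typ cS ck)).
  rewrite prednK ?(ltnW r1) //.
  have h1 : p * #|mono_pairs C W c|%:R <= p * (gamma / 2 * n%:R ^+ 2) by rewrite ler_pM2l.
  have h2 : r%:R * eta <= gamma / 2.
    by rewrite mulrC -ler_pdivlMr.
  have pm : 0 < p * n%:R ^+ 2 by rewrite mulr_gt0.
  have h3 : r%:R * eta * (p * n%:R ^+ 2) <= gamma / 2 * (p * n%:R ^+ 2) by rewrite ler_pM2r.
  move: h1 h3; move: (#|mono_pairs C W c|%:R : R) (n%:R ^+ 2 : R) (r%:R : R) => x m j; lra.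
have cW0 : #|W|%:R <= n%:R :> R by rewrite ler_nat -[n in (_ <= n)%N]card_ord max_card.
have [small|large] := leP (#|W|%:R : R) (kap * n%:R).
  exists (fun=> 0%N); first by move=> v; case: (r) r1 => [|[|]].
  apply: (@le_trans _ _ (#|W|%:R ^+ 2)).
    rewrite -natrX ler_nat -mulnn -cardsX; apply/subset_leq_card/subsetP => -[u v].
    by rewrite !inE /= => /and4P[-> ->].
  have h1 : #|W|%:R * #|W|%:R <= (kap * n%:R) * (kap * n%:R) by apply: ler_pM.
  have h2 : kap * (kap * n%:R ^+ 2) <= 1 * (kap * n%:R ^+ 2).
    by apply: ler_wpM2r; [apply: mulr_ge0; exact: ltW | rewrite /kap; lra].
  by apply: (le_trans h1); move: h2; rewrite /kap !expr2; move: (n%:R : R) => m; lra.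
pose X : finType := {v : 'I_n | v \in W}.
pose D : rel X := relpre val (adj C).
have cX : #|X| = #|W| by rewrite card_sig.
have sD : symmetric D by move=> u v; exact: adj_sym.
have iD : irreflexive D by move=> u; exact: adj_irr.
have k0 : 0 < kap by [].
have X0 : 0 < #|X|%:R :> R by rewrite cX; apply: lt_trans large; rewrite mulr_gt0.
have codE (v : X) : (codeg D v + #|[set w in W | adj C (val v) w]| = #|X|)%N.
  have -> : #|[set w in W | adj C (val v) w]| = #|[set u | D v u]|.
    rewrite -(card_imset _ val_inj); apply: eq_card => w; rewrite inE; apply/andP/imsetP.
      by move=> [wW vw]; exists (exist _ w wW); rewrite ?inE.
    by move=> [u]; rewrite inE => vu ->; split=> //; exact: valP.
  rewrite addnC -(cardsC [set u | D v u]); congr (_ + _)%N.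
  by apply: eq_card => u; rewrite !inE.
have hi (A : {set X}) : (\sum_(v in A) codeg D v)%:R <=
    (3 / (3 * r%:R - 4) - gamma) * #|X|%:R * #|A|%:R + eta0 * #|X|%:R ^+ 2.
  set th := 1 - 3 / (3 * r%:R - 4) + gamma in hdeg.
  pose A' := [set val v | v in A].
  have A'W : A' \subset W by apply/subsetP => v /imsetP[u _ ->]; exact: valP.
  have cA : #|A'| = #|A| by rewrite card_imset //; exact: val_inj.
  have := degree_sum_le C2 E2 EW EG ESC p0 typ cS A'W hdeg; rewrite cA.
  have -> : (\sum_(v in A') #|[set w in W | adj C v w]| = \sum_(v in A) #|[set w in W | adj C (val v) w]|)%N.
    by rewrite big_imset //= => u v _ _; exact: val_inj.
  set Deg := (\sum_(v in A) _)%N.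
  have tot : (\sum_(v in A) codeg D v + Deg = #|X| * #|A|)%N.
    by rewrite -big_split /= (eq_bigr _ (fun v _ => codE v)) sum_nat_const mulnC.
  move/(congr1 (fun k => k%:R : R)): tot; rewrite natrD natrM.
  have -> : 3 / (3 * r%:R - 4) - gamma = 1 - th by rewrite /th; ring.
  have h1 : 4 * eta * n%:R ^+ 2 <= eta0 * #|X|%:R ^+ 2.
    apply: (@le_trans _ _ (eta0 * (kap * n%:R) ^+ 2)); last first.
      apply: ler_wpM2l; first exact: ltW.
      apply: lerXn2r; rewrite ?nnegrE //; first by rewrite mulr_ge0 // ltW.
      by rewrite cX ltW.
    have : 4 * eta * n%:R ^+ 2 <= 4 * b * n%:R ^+ 2 by rewrite ler_pM2r // ler_pM2l.
    by rewrite /b [(kap * n%:R) ^+ 2]exprMn; move: (n%:R ^+ 2 : R) (kap ^+ 2) => m kk; lra.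
  have a0 : 0 <= #|A|%:R :> R by [].
  have [t0|t0] := leP 0 th.
    have h2 : th * #|X|%:R * #|A|%:R <= th * n%:R * #|A|%:R.
      by apply: ler_wpM2r => //; apply: ler_wpM2l => //; rewrite cX.
    move: h1 h2; move: (#|X|%:R : R) (#|A|%:R : R) (Deg%:R : R) ((\sum_(v in A) codeg D v)%:R : R).
    by move: (n%:R : R) => m x a d s; lra.
  have h2 : 0 <= (- th) * #|X|%:R * #|A|%:R by rewrite !mulr_ge0 // oppr_ge0 ltW.
  have h3 : 0 <= eta0 * #|X|%:R ^+ 2 by rewrite mulr_ge0 ?exprn_ge0 // ltW.
  have h4 : 0 <= Deg%:R :> R by [].
  move: h2 h3 h4; move: (#|X|%:R : R) (#|A|%:R : R) (Deg%:R : R) ((\sum_(v in A) codeg D v)%:R : R).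
  by move=> x a d s; lra.
have hii : #|[set y : {ffun 'I_r -> X} | clique_tuple D y]|%:R <= eps0 * #|X|%:R ^+ r.
  pose q (y : {ffun 'I_r -> X}) : {ffun 'I_r -> 'I_n} := [ffun i => val (y i)].
  have iq : injective q.
    by move=> y z /ffunP E'; apply/ffunP => i; apply: val_inj; have := E' i; rewrite !ffunE.
  apply: (@le_trans _ _ (#|[set y : {ffun 'I_r -> 'I_n} | clique_tuple (adj C) y]|%:R)).
    rewrite ler_nat -(card_imset _ iq); apply/subset_leq_card/subsetP => z /imsetP[y].
    rewrite inE => /forallP hy ->; rewrite inE; apply/forallP => i; apply/forallP => j.
    by have /forallP/(_ j) := hy i; rewrite !ffunE.
  apply: (le_trans hK); rewrite -mulrA -exprMn ler_pM2l //.
  by apply: lerXn2r; rewrite ?nnegrE ?mulr_ge0 // ?ltW // cX.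
have [c' ck hc] := dense X D sD iD hi hii.
exists (fun v => if insub v is Some x then c' x else 0%N).
  by move=> v; case: insubP => // _; case: (r) r1 => [|[|]].
apply: (@le_trans _ _ (#|[set z : X * X | D z.1 z.2 && (c' z.1 == c' z.2)]|%:R)).
  rewrite ler_nat; apply: leq_trans (leq_imset_card (fun z : X * X => (val z.1, val z.2)) _).
  apply/subset_leq_card/subsetP => -[u v]; rewrite inE /= => /and4P[uW vW uv cc].
  apply/imsetP; exists (exist _ u uW, exist _ v vW) => //.
  by move: cc; rewrite !inE /D /= uv !insubT.
apply: (le_trans hc); apply: ler_wpM2l; first exact: ltW.
by apply: lerXn2r; rewrite ?nnegrE // cX.
Qed.

(** * The binomial random graph *)

Definition all_pairs (n : nat) : {set {set 'I_n}} := [set e : {set 'I_n} | #|e| == 2%N].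

Section GnpProbability.
Variables (R : realType) (n : nat) (p : R).
Hypothesis p01 : 0 <= p <= 1.

Lemma graph_of_edges_wf (U : {set {set 'I_n}}) :
  sgraph_wf ([set: 'I_n], U) = (U \subset all_pairs n).
Proof.
apply/forall_inP/subsetP => [h e /h/andP[c _]|h e /h]; first by rewrite inE.
by rewrite inE => ->; exact: subsetT.
Qed.

Lemma sum_spanning (F : {set {set 'I_n}} -> R) :
  \sum_(G : sgraph 'I_n | verts G == [set: 'I_n]) F (edges G) =
  \sum_(U : {set {set 'I_n}} | U \subset all_pairs n) F U.
Proof.
have wf0 : sgraph_wf ([set: 'I_n], set0 : {set {set 'I_n}}) by rewrite graph_of_edges_wf sub0set.
pose mk (U : {set {set 'I_n}}) : sgraph 'I_n := insubd (SGraph wf0) ([set: 'I_n], U).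
have mkE (U : {set {set 'I_n}}) : U \subset all_pairs n -> sgraph_val (mk U) = ([set: 'I_n], U).
  by move=> sU; rewrite /mk -[LHS]/(val _) insubdK // -topredE /= graph_of_edges_wf.
have wfE (G : sgraph 'I_n) : verts G == [set: 'I_n] ->
    edges G \subset all_pairs n /\ sgraph_val G = ([set: 'I_n], edges G).
  case: G => -[V0 E0] wf /= /eqP VT; rewrite /verts /= in VT.
  by rewrite /edges /=; subst V0; split=> //; rewrite -graph_of_edges_wf.
rewrite (reindex_onto mk (@edges _)) /=; last first.
  move=> G /wfE[sE vG]; apply: val_inj; rewrite -[LHS]/(sgraph_val _) mkE //.
apply: eq_big => [U|U /andP[/wfE[sE _] /eqP ->]] //.
apply/andP/idP => [[/wfE[sE _] /eqP eU]|sU]; first by rewrite -eU.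
by rewrite /verts /edges mkE //= !eqxx.
Qed.

Lemma sum_gnp (F : {set {set 'I_n}} -> R) :
  \sum_(G : sgraph 'I_n) gnp_weight p G * F (edges G) = ex p (enum (all_pairs n)) F.
Proof.
rewrite ex_sumE ?enum_uniq // set_enum -cardE card_draws card_ord -sum_spanning [RHS]big_mkcond.
by apply: eq_bigr => G _; rewrite /gnp_weight; case: ifP; rewrite // mul0r.
Qed.

Lemma gnp_weight_ge0 (G : sgraph 'I_n) : 0 <= gnp_weight p G.
Proof.
case/andP: p01 => p0 p1; rewrite /gnp_weight; case: ifP => // _.
by rewrite mulr_ge0 // exprn_ge0 // subr_ge0.
Qed.

Lemma gnp_total : \sum_(G : sgraph 'I_n) gnp_weight p G = 1.
Proof.
rewrite -(ex_cst p (enum (all_pairs n)) 1) -sum_gnp.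
by apply: eq_bigr => G _; rewrite mulr1.
Qed.

Lemma gnp_prob_le1 (A : classical_sets.set (sgraph 'I_n)) : gnp_prob p A <= 1.
Proof.
rewrite -gnp_total /gnp_prob big_mkcond; apply: ler_sum => G _.
by case: ifP => // _; exact: gnp_weight_ge0.
Qed.

Lemma gnp_prob_ge (A : classical_sets.set (sgraph 'I_n)) (F : {set {set 'I_n}} -> R) :
  (forall U, 0 <= F U) -> (forall G, ~ A G -> 1 <= F (edges G)) ->
  1 - ex p (enum (all_pairs n)) F <= gnp_prob p A.
Proof.
move=> F0 F1; rewrite lerBlDr -gnp_total -sum_gnp /gnp_prob [X in _ <= X + _]big_mkcond -big_split /=.
apply: ler_sum => G _; have w0 := gnp_weight_ge0 G.
have [AG|AG] := pselect (A G).
  by rewrite mem_set // lerDl mulr_ge0.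
by rewrite memNset // add0r -{1}[gnp_weight p G]mulr1 ler_wpM2l // F1.
Qed.

Lemma card_all_pairs_le : #|all_pairs n|%:R <= n%:R ^+ 2 :> R.
Proof.
rewrite /all_pairs card_draws card_ord -natrX ler_nat bin2.
apply: leq_trans (half_leq (leq_mul (leqnn _) (leq_pred _))) _.
by rewrite -mulnn -divn2 leq_div.
Qed.

Lemma sum_powers (A : {set {set 'I_n}}) (y : R) : 0 <= y ->
  \sum_(U : {set {set 'I_n}} | U \subset A) y ^+ #|U| = (1 + y) ^+ #|A|.
Proof.
move=> y0; have := indpoly_ex predT set0 A y0; rewrite ex_cst mulr1 => <-.
by apply: eq_bigr => U _; rewrite mul1r.
Qed.

End GnpProbability.

Section TypicalContainers.
Variables (R : realType) (n : nat) (p eta : R) (f : {set {set 'I_n}} -> {set {set 'I_n}}).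
Hypotheses (p0 : 0 < p) (p1 : p <= 1) (eta0 : 0 < eta) (eta1 : eta <= 1).
Hypothesis pn : 48 / eta ^+ 2 <= p * n%:R.

Let t : R := eta / 4.
Let L : R := 32 / eta ^+ 2.
Let beta : R := eta ^+ 4 / 4 ^+ 5.
Let m : R := p * n%:R ^+ 2.

Definition admissible (S : {set {set 'I_n}}) : bool :=
  [&& S \subset all_pairs n, [disjoint S & f S] & f S \subset all_pairs n].

Definition typical (U : {set {set 'I_n}}) : Prop :=
  forall S : {set {set 'I_n}}, admissible S -> S \subset U -> #|S|%:R <= beta * m ->
  forall A B : {set 'I_n}, #|U :&: (f S :&: touching A B)|%:R <=
     p * #|f S :&: touching A B|%:R + eta * p * n%:R ^+ 2.

(* Exponential moment bounding the indicator of the failure of [typical]. *)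
Definition atypicality (U : {set {set 'I_n}}) : R :=
  \sum_(S : {set {set 'I_n}} | admissible S) \sum_(AB : {set 'I_n} * {set 'I_n})
    expR (L * beta * m - t * (p * #|f S :&: touching AB.1 AB.2|%:R + eta * m)) * expR (- L) ^+ #|S| *
    ((S \subset U)%:R * expR t ^+ #|U :&: (f S :&: touching AB.1 AB.2)|).

Let m0 : 0 <= m. Proof. by rewrite mulr_ge0 ?exprn_ge0 // ltW. Qed.
Let e2 : 0 < eta ^+ 2. Proof. by rewrite exprn_gt0. Qed.
Let L0 : 0 < L. Proof. by rewrite divr_gt0. Qed.
Let t0 : 0 < t. Proof. by rewrite divr_gt0. Qed.

Lemma atypicality_ge0 U : 0 <= atypicality U.
Proof.
apply: sumr_ge0 => S _; apply: sumr_ge0 => AB _.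
by rewrite !mulr_ge0 ?exprn_ge0 // expR_ge0.
Qed.

Lemma atypicality_ge1 U : ~ typical U -> 1 <= atypicality U.
Proof.
move=> nt; apply: contrapT => /negP; rewrite -ltNge => lt1; apply: nt => S aS SU cS A B.
rewrite leNgt; apply/negP => big.
move: lt1; rewrite /atypicality (bigD1 S) //= (bigD1 (A, B)) //= SU mul1r.
set x := _ * _ * _; have x1 : 1 <= x.
  rewrite /x -!expRM_natl -!expRD -[leLHS]expR0 ler_expR.
  set w := p * _ + _ in big *.
  have h1 : 0 <= L * (beta * m - #|S|%:R) by apply: mulr_ge0; [exact: ltW | rewrite subr_ge0].
  have h2 : t * w <= t * #|U :&: (f S :&: touching A B)|%:R by rewrite ler_pM2l // ltW.
  move: h1 h2; rewrite /w /m.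
  move: (#|S|%:R : R) (#|U :&: (f S :&: touching A B)|%:R : R) (#|f S :&: touching A B|%:R : R) (n%:R ^+ 2 : R).
  by move: L t beta => l u b s x' y z; lra.
apply/negP; rewrite -leNgt; apply: (le_trans x1); rewrite -addrA lerDl addr_ge0 //.
  by apply: sumr_ge0 => AB _; rewrite !mulr_ge0 ?exprn_ge0 // expR_ge0.
apply: sumr_ge0 => S' _; apply: sumr_ge0 => AB _.
by rewrite !mulr_ge0 ?exprn_ge0 // expR_ge0.
Qed.

Lemma ex_atypicality : ex p (enum (all_pairs n)) atypicality <= expR (- n%:R).
Proof.
have p01 : 0 <= p <= 1 by rewrite ltW.
have us : uniq (enum (all_pairs n)) by exact: enum_uniq.
rewrite /atypicality ex_sum.
pose K : R := expR (L * beta * m - eta ^+ 2 / 8 * m).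
have bound S AB : admissible S ->
  ex p (enum (all_pairs n)) (fun U =>
     expR (L * beta * m - t * (p * #|f S :&: touching AB.1 AB.2|%:R + eta * m)) * expR (- L) ^+ #|S| *
    ((S \subset U)%:R * expR t ^+ #|U :&: (f S :&: touching AB.1 AB.2)|)) <= K * (expR (- L) * p) ^+ #|S|.
  move=> /and3P[Sp dj fp]; set W := f S :&: _.
  rewrite exZ ex_given //; last by move=> e /(subsetP Sp); rewrite mem_enum.
  rewrite (@ex_ext _ _ _ _ (fun U => expR t ^+ #|(S :|: U) :&: W|) (fun U => expR t ^+ #|U :&: W|)); last first.
    move=> U _; rewrite setIUl (_ : S :&: W = set0) ?set0U //.
    apply/setP => e; rewrite !inE; case: (boolP (e \in S)) => //= eS.
    by rewrite (disjointFr dj eS).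
  rewrite ex_pow //.
  have cW : (count (mem W) (enum (all_pairs n)) <= #|W|)%N.
    rewrite -size_filter cardE; apply: uniq_leq_size; first exact: filter_uniq.
    by move=> e; rewrite mem_filter mem_enum => /andP[].
  have Wn : #|W|%:R <= n%:R ^+ 2 :> R.
    apply: le_trans (card_all_pairs_le R n); rewrite ler_nat; apply/subset_leq_card.
    by apply: subset_trans fp; exact: subsetIl.
  have et : expR t - 1 <= t + 2 * t ^+ 2.
    have := expR_le_quad (t := t); rewrite (ltW t0) /=.
    have -> : t <= 1 / 2 by rewrite /t; move: eta1; lra.
    by move=> /(_ isT); lra.
  have et0 : 0 <= expR t - 1 by have := expR_ge1Dx t; move: t0; lra.
  have h1 : (1 + (expR t - 1) * p) ^+ count (mem W) (enum (all_pairs n)) <= expR ((t + 2 * t ^+ 2) * p * #|W|%:R).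
    have b1 : 1 <= 1 + (expR t - 1) * p by rewrite lerDl mulr_ge0 // ltW.
    apply: (le_trans (ler_weXn2l b1 cW)).
    rewrite [leRHS](_ : _ = expR ((t + 2 * t ^+ 2) * p) ^+ #|W|); last by rewrite -expRM_natl; congr expR; rewrite [RHS]mulrC.
    apply: lerXn2r; rewrite ?nnegrE ?expR_ge0 //; first by apply: le_trans b1.
    apply: le_trans (expR_ge1Dx _); rewrite lerD2l; apply: ler_wpM2r => //; exact: ltW.
  rewrite exprMn [X in X * _ <= _]mulrC mulrACA.
  rewrite [leRHS]mulrC; apply: ler_wpM2l; first by rewrite mulr_ge0 ?exprn_ge0 ?expR_ge0 // ltW.
  apply: (le_trans (ler_wpM2l (expR_ge0 _) h1)); rewrite -expRD /K ler_expR.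
  have h2 : t ^+ 2 * p * #|W|%:R <= t ^+ 2 * p * n%:R ^+ 2.
    by apply: ler_wpM2l => //; rewrite mulr_ge0 ?exprn_ge0 // ltW.
  rewrite -subr_ge0 (_ : _ - _ = 2 * (t ^+ 2 * p * n%:R ^+ 2 - t ^+ 2 * p * #|W|%:R)).
    by rewrite mulr_ge0 // subr_ge0.
  rewrite /m /t; by move: (#|W|%:R : R) (n%:R ^+ 2 : R) L beta => w nn l b; field.
apply: (@le_trans _ _ (\sum_(S : {set {set 'I_n}} | S \subset all_pairs n)
    \sum_(AB : {set 'I_n} * {set 'I_n}) K * (expR (- L) * p) ^+ #|S|)).
  rewrite big_mkcond [leRHS]big_mkcond /=; apply: ler_sum => S _.
  have y0 : 0 <= K * (expR (- L) * p) ^+ #|S|.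
    by rewrite mulr_ge0 ?expR_ge0 // exprn_ge0 // mulr_ge0 ?expR_ge0 // ltW.
  case: (boolP (admissible S)) => aS; last by case: ifP => // _; apply: sumr_ge0.
  case/and3P: (aS) => -> _ _; rewrite ex_sum; apply: ler_sum => AB _; exact: bound.
pose N2 := #|{: {set 'I_n} * {set 'I_n}}|.
have -> : \sum_(S : {set {set 'I_n}} | S \subset all_pairs n)
    \sum_(AB : {set 'I_n} * {set 'I_n}) K * (expR (- L) * p) ^+ #|S| =
    N2%:R * K * \sum_(S : {set {set 'I_n}} | S \subset all_pairs n) (expR (- L) * p) ^+ #|S|.
  rewrite mulr_sumr; apply: eq_bigr => S _.
  by rewrite sumr_const -[LHS]mulr_natl mulrA.
have Lp0 : 0 <= expR (- L) * p by rewrite mulr_ge0 ?expR_ge0 // ltW.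
rewrite sum_powers //.
have hN2 : N2%:R <= expR (2 * n%:R) :> R.
  have -> : N2 = (2 ^ n * 2 ^ n)%N.
    by rewrite /N2 card_prod -cardsT -powersetT card_powerset cardsT card_ord.
  rewrite natrM !natrX -exprMn [expR _](_ : _ = expR 2 ^+ n); last by rewrite -expRM_natl mulrC.
  apply: lerXn2r; rewrite ?nnegrE ?expR_ge0 //.
  have := expR_ge1Dx (1 : R) => h; have -> : (2 : R) = 1 + 1 by [].
  by rewrite expRD; apply: ler_pM.
have eL : expR (- L) <= eta ^+ 2 / 32.
  have -> : eta ^+ 2 / 32 = L^-1 by rewrite /L invf_div.
  rewrite expRN lef_pV2 ?posrE ?expR_gt0 //.
  by have := expR_ge1Dx L; lra.
have h3 : (1 + expR (- L) * p) ^+ #|all_pairs n| <= expR (eta ^+ 2 / 32 * m).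
  apply: (@le_trans _ _ (expR (expR (- L) * p) ^+ #|all_pairs n|)).
    by apply: lerXn2r; rewrite ?nnegrE ?expR_ge0 ?addr_ge0 ?expR_ge1Dx.
  rewrite -expRM_natl ler_expR mulrC /m [leRHS]mulrA; apply: ler_pM => //.
    by apply: ler_wpM2r => //; exact: ltW.
  exact: card_all_pairs_le.
have Kn : 0 <= N2%:R * K by rewrite mulr_ge0 // expR_ge0.
apply: (le_trans (ler_wpM2l Kn h3)); rewrite -[leLHS]mulrA /K -expRD.
apply: (@le_trans _ _ (expR (2 * n%:R) * expR (L * beta * m - eta ^+ 2 / 8 * m + eta ^+ 2 / 32 * m))).
  by apply: ler_wpM2r => //; exact: expR_ge0.
rewrite -expRD ler_expR.
have Lb : L * beta = eta ^+ 2 / 32.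
  by rewrite /L /beta; field; rewrite gt_eqF.
have h4 : 3 * n%:R <= eta ^+ 2 / 16 * m.
  have -> : eta ^+ 2 / 16 * m = (eta ^+ 2 / 16 * (p * n%:R)) * n%:R by rewrite /m; ring.
  apply: ler_wpM2r => //; rewrite mulrC -ler_pdivrMr ?divr_gt0 //.
  by rewrite (_ : 3 / (eta ^+ 2 / 16) = 48 / eta ^+ 2) //; field; rewrite gt_eqF.
rewrite Lb (_ : _ - _ + _ = - (eta ^+ 2 / 16 * m)); last by field.
rewrite lerBlDr -lerBlDl; apply: le_trans h4; apply: le_of_eq; ring.
Qed.

End TypicalContainers.

Section GraphFacts.
Variables (R : realType) (T : finType) (H : sgraph T).

Lemma cover_edges_sub (J : {set {set T}}) : J \subset edges H -> cover J \subset verts H.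
Proof.
by move=> JH; apply/bigcupsP => e eJ; have [_] := sgraph_edge (subsetP JH _ eJ).
Qed.

(* Isolated vertices of [H] are placed on unused vertices of [G]. *)
Lemma has_copy_extend (n : nat) (G : sgraph 'I_n) (phi : {ffun T -> 'I_n}) :
  {in cover (edges H) &, injective phi} ->
  (forall e, e \in edges H -> phi @: (e : {set T}) \in edges G) ->
  (#|verts H| <= #|verts G|)%N -> has_copy H G.
Proof.
move=> ip pe hv; pose N := cover (edges H).
have NH : N \subset verts H by exact: cover_edges_sub.
have pN : phi @: N \subset verts G.
  apply/subsetP => u /imsetP[x /bigcupP[e eH xe] ->].
  have [_ /subsetP] := sgraph_edge (pe e eH); apply; exact: imset_f.
pose A := verts H :\: N; pose B := verts G :\: (phi @: N).
have cAB : (#|A| <= #|B|)%N.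
  rewrite /A /B !cardsD (setIidPr NH) (setIidPr pN) card_in_imset //; exact: leq_sub2r.
pose g (x : T) : 'I_n := if x \in N then phi x else nth (phi x) (enum B) (index x (enum A)).
have gB x : x \in verts H -> x \notin N -> g x \in B.
  move=> xH xN; rewrite /g (negbTE xN) -mem_enum mem_nth // -cardE.
  apply: leq_trans cAB; rewrite cardE index_mem mem_enum !inE xN; exact: xH.
exists (fun x => g (val x)); split.
- move=> [x xH] [y yH] /= E; apply: val_inj => /=.
  have [xN|xN] := boolP (x \in N); have [yN|yN] := boolP (y \in N).
  + by move: E; rewrite /g xN yN; exact: ip.
  + have := gB y yH yN; rewrite -E /g xN inE => /andP[/negP[]].
    by apply: imset_f.
  + have := gB x xH xN; rewrite E /g yN inE => /andP[/negP[]].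
    by apply: imset_f.
  + have iA z : z \in verts H -> z \notin N -> (index z (enum A) < size (enum B))%N.
      move=> zH zN; rewrite -cardE; apply: leq_trans cAB.
      by rewrite cardE index_mem mem_enum !inE zN; exact: zH.
    move: E; rewrite /g (negbTE xN) (negbTE yN) (set_nth_default (phi y)) ?iA // => /eqP.
    rewrite nth_uniq ?enum_uniq ?iA // => /eqP Ei.
    have xA : x \in enum A by rewrite mem_enum !inE xN.
    have yA : y \in enum A by rewrite mem_enum !inE yN.
    by rewrite -(nth_index x xA) Ei nth_index.
- move=> [x xH] /=; have [xN|xN] := boolP (x \in N).
    by rewrite /g xN; apply: (subsetP pN); apply: imset_f.
  by have := gB x xH xN; rewrite inE => /andP[].
- move=> [x xH] [y yH] /= xy.
  have xN : x \in N by apply/bigcupP; exists [set x; y]; rewrite // !inE eqxx.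
  have yN : y \in N by apply/bigcupP; exists [set x; y]; rewrite // !inE eqxx orbT.
  by have := pe _ xy; rewrite imsetU1 imset_set1 /g xN yN.
Qed.

Lemma min_degree_le (n : nat) (G : sgraph 'I_n) v : v \in verts G -> (min_degree G <= degree G v)%N.
Proof.
move=> vG; rewrite /min_degree; move: (mem_index_enum v).
elim: (index_enum _) => // a s IH; rewrite inE big_cons => /orP[/eqP <-|/IH h].
  by rewrite vG geq_minl.
by case: ifP => // _; apply: leq_trans (geq_minr _ _) h.
Qed.

Definition is_K2 : bool := (#|verts H| == 2)%N && (#|edges H| == 1)%N.

Definition density_set : classical_sets.set R :=
  classical_sets.image [set H' : sgraph T | subgraph H' H /\ (3 <= #|verts H'|)%N]%classic
    (fun H' => (#|edges H'|%:R - 1) / (#|verts H'|%:R - 2)).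

Lemma m2E : ~~ is_K2 -> m2 R H = sup density_set.
Proof. by rewrite /m2 /is_K2 => /negbTE ->. Qed.

Lemma m2_ge (H' : sgraph T) : ~~ is_K2 -> subgraph H' H -> (3 <= #|verts H'|)%N ->
  (#|edges H'|%:R - 1) / (#|verts H'|%:R - 2) <= m2 R H.
Proof.
move=> nK sH v3; rewrite m2E //; apply: ub_le_sup; last by exists H'.
exists #|edges H|%:R => _ [H2 [[_ sE] v32] <-].
have v1 : 1 <= #|verts H2|%:R - 2 :> R.
  by rewrite lerBrDr -natr1 -?natrD (_ : 1 + 2 = 3%:R) ?ler_nat //; ring.
have e1 : #|edges H2|%:R <= #|edges H|%:R :> R by rewrite ler_nat subset_leq_card.
rewrite ler_pdivrMr; last by lra.
have : #|edges H|%:R * 1 <= #|edges H|%:R * (#|verts H2|%:R - 2) :> R by rewrite ler_wpM2l.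
lra.
Qed.

Lemma m2_le0 : ~~ is_K2 -> (#|edges H| <= 1)%N -> m2 R H <= 0.
Proof.
move=> nK e1; rewrite m2E //.
have ub : ubound density_set 0.
  move=> _ [H2 [[_ sE] v32] <-].
  have v1 : 1 <= #|verts H2|%:R - 2 :> R.
    by rewrite lerBrDr (_ : 1 + 2 = 3%:R) ?ler_nat //; ring.
  have e2 : #|edges H2|%:R <= 1 :> R.
    by rewrite -[1]/(1%:R) ler_nat (leq_trans (subset_leq_card sE)).
  rewrite ler_pdivrMr; last by lra.
  by rewrite mul0r subr_le0.
have [[x Sx]|ne] := pselect (exists x, density_set x); last first.
  rewrite (_ : density_set = classical_sets.set0) ?sup0 //.
  by apply/classical_sets.seteqP; split=> x // Sx; case: ne; exists x.
by apply: ge_sup => //; exists x.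
Qed.

Definition sub_of (J : {set {set T}}) (JH : J \subset edges H) : sgraph T.
Proof.
refine (@SGraph T (cover J, J) _).
apply/forall_inP => e eJ; have [-> _] := sgraph_edge (subsetP JH _ eJ).
by rewrite eqxx; exact: bigcup_sup.
Defined.

Lemma m2_ge_sub (J : {set {set T}}) : ~~ is_K2 -> J \subset edges H -> (3 <= #|cover J|)%N ->
  (#|J|%:R - 1) / (#|cover J|%:R - 2) <= m2 R H.
Proof.
move=> nK JH c3; apply: (m2_ge (H' := sub_of JH)) => //.
by split=> //; exact: cover_edges_sub.
Qed.

Lemma card_cover2 (e1 e2 : {set T}) : cover [set e1; e2] = e1 :|: e2.
Proof. by rewrite /cover bigcup_setU !big_set1. Qed.

Lemma edges_sub_cover (J : {set {set T}}) e : e \in J -> e \subset cover J.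
Proof. by move=> eJ; exact: bigcup_sup. Qed.

Lemma cover_ge3 (J : {set {set T}}) : J \subset edges H -> (2 <= #|J|)%N -> (3 <= #|cover J|)%N.
Proof.
move=> JH /card_gt1P[e1 [e2 [e1J e2J ne]]].
rewrite ltnNge; apply/negP => c2.
have full e : e \in J -> e = cover J.
  move=> eJ; have [ce _] := sgraph_edge (subsetP JH _ eJ).
  by apply/eqP; rewrite eqEcard edges_sub_cover // ce.
by rewrite (full e1) // (full e2) // eqxx in ne.
Qed.

Lemma not_K2 : (2 <= #|edges H|)%N -> ~~ is_K2.
Proof. by move=> e2; rewrite /is_K2 negb_and; apply/orP; right; case: #|_| e2 => [|[|]]. Qed.

Lemma m2_adjacent (e1 e2 : {set T}) : e1 \in edges H -> e2 \in edges H -> e1 != e2 ->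
  ~~ [disjoint e1 & e2] -> 1 <= m2 R H.
Proof.
move=> h1 h2 ne nd.
have JH : [set e1; e2] \subset edges H by apply/subsetP => e /set2P[] ->.
have cJ : #|[set e1; e2]| = 2%N by rewrite cards2 ne.
have nK : ~~ is_K2 by apply: not_K2; rewrite -cJ subset_leq_card.
have c3 : (3 <= #|cover [set e1; e2]|)%N by apply: cover_ge3; rewrite ?cJ.
have c3' : (#|cover [set e1; e2]| <= 3)%N.
  rewrite card_cover2 cardsU (sgraph_edge h1).1 (sgraph_edge h2).1.
  have : (0 < #|e1 :&: e2|)%N by rewrite card_gt0; move: nd; rewrite -setI_eq0.
  by case: #|_| => [|[|[|[|]]]].
have := m2_ge_sub nK JH c3; have -> : #|cover [set e1; e2]| = 3%N by apply/eqP; rewrite eqn_leq c3 c3'.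
by rewrite cJ (_ : (2%:R - 1) / (3%:R - 2) = 1 :> R) //; field.
Qed.

Lemma m2_matching : (1 <= #|edges H|)%N -> ((2 <= #|edges H|)%N \/ is_K2) -> 1 / 2 <= m2 R H.
Proof.
move=> e1 [h2|]; last by rewrite /is_K2 /m2 => ->.
have /card_gt1P[a [b [aH bH ne]]] := h2.
have JH : [set a; b] \subset edges H by apply/subsetP => e /set2P[] ->.
have cJ : #|[set a; b]| = 2%N by rewrite cards2 ne.
have nK := not_K2 h2.
have c3 : (3 <= #|cover [set a; b]|)%N by apply: cover_ge3; rewrite ?cJ.
have c4 : (#|cover [set a; b]| <= 4)%N.
  by rewrite card_cover2 (leq_trans (leq_card_setU _ _)) // (sgraph_edge aH).1 (sgraph_edge bH).1.
apply: le_trans (m2_ge_sub nK JH c3); rewrite cJ.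
have x3 : (3 : R) <= #|cover [set a; b]|%:R by rewrite ler_nat.
have x4 : #|cover [set a; b]|%:R <= 4 :> R by rewrite ler_nat.
rewrite ler_pdivlMr; last by lra.
by lra.
Qed.

Lemma powR_density (n : nat) (m : R) (J : {set {set T}}) : (0 < n)%N -> 1 <= m -> m = m2 R H ->
  (2 <= #|edges H|)%N -> J \subset edges H -> J != set0 ->
  n%:R ^+ 2 * n%:R `^ (- (1 / m)) <= n%:R ^+ #|cover J| * (n%:R `^ (- (1 / m))) ^+ #|J|.
Proof.
move=> n0 m1 mE e2 JH J0; set q := _ `^ _.
have nR : 1 <= n%:R :> R by rewrite ler1n.
have q0 : 0 < q by rewrite powR_gt0 // ltr0n.
have J1 : (0 < #|J|)%N by rewrite card_gt0.
have [J1'|J2] := leqP #|J| 1.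
  have /cards1P[e Je] : #|J| == 1%N by rewrite eqn_leq J1' J1.
  have eH : e \in edges H by apply: (subsetP JH); rewrite Je set11.
  by rewrite Je cards1 /cover big_set1 (sgraph_edge eH).1 expr1.
have c3 := cover_ge3 JH J2.
have h := m2_ge_sub (not_K2 e2) JH c3; rewrite -mE in h.
have c2 : (2 <= #|cover J|)%N by apply: ltnW.
rewrite -(subnKC c2) exprD -mulrA; apply: ler_wpM2l; first by rewrite exprn_ge0.
rewrite -(subnKC J1) exprD expr1 mulrCA -[leLHS]mulr1; apply: ler_wpM2l; first exact: ltW.
rewrite -powR_mulrn // -[q ^+ _](powR_mulrn _ (ltW q0)) /q -powRrM -powRD; last first.
  by apply/implyP => _; rewrite gt_eqF // ltr0n.
rewrite -[leLHS](powRr0 n%:R); apply: ler_powR => //.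
have j1 : (#|J| - 1)%:R = #|J|%:R - 1 :> R by rewrite natrB.
have v2 : (#|cover J| - 2)%:R = #|cover J|%:R - 2 :> R by rewrite natrB.
have m0 : 0 < m by lra.
have v0 : 0 < #|cover J|%:R - 2 :> R.
  by rewrite -v2 ltr0n subn_gt0.
rewrite j1 v2; move: h; rewrite ler_pdivrMr // => h.
rewrite mulNr subr_ge0 div1r mulrC ler_pdivrMr //.
by rewrite [leRHS]mulrC.
Qed.

End GraphFacts.

Definition near_partite (R : realType) (T : finType) (H : sgraph T) (gamma p : R) (n : nat)
    (G : sgraph 'I_n) : Prop :=
  forall G' : sgraph 'I_n, subgraph G' G -> graph_free H G' ->
    (1 - 3 / (3 * (chi H)%:R - 4) + gamma) * p * n%:R <= (min_degree G')%:R ->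
    exists F : {set {set 'I_n}},
      [/\ F \subset edges G', #|F|%:R <= gamma * p * n%:R ^+ 2 &
          partite (chi H - 1)%N (del_edges G' F)].

Definition likely (R : realType) (T : finType) (H : sgraph T) (gamma : R) : Prop :=
  exists C K : R, exists N0 : nat, 0 < C /\
    forall (n : nat) (p : R), (N0 <= n)%N -> 0 <= p <= 1 ->
      C * n%:R `^ (- (1 / m2 R H)) <= p ->
      1 - K / n.+1%:R <= gnp_prob p (fun G : sgraph 'I_n => near_partite H gamma p G).

Section Cases.
Variables (R : realType) (T : finType) (H : sgraph T).

Lemma likely_vacuous (gamma : R) : m2 R H <= 0 -> likely H gamma.
Proof.
move=> m0; exists 2, 0, 1%N; split=> // n p n1 /andP[_ p1] hp.
have : 1 <= n%:R `^ (- (1 / m2 R H)).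
  rewrite -[leLHS](powRr0 (n%:R : R)); apply: ler_powR; first by rewrite ler1n.
  by rewrite oppr_ge0 div1r invr_le0.
lra.
Qed.

Lemma chi_colouring : exists2 c : T -> nat, (forall v, v \in verts H -> (c v < chi H)%N) &
  forall x y, [set x; y] \in edges H -> c x <> c y.
Proof. by rewrite /chi; case: ex_minnP => k /asboolP[c c1 c2] _; exists c. Qed.

Lemma edge_ends (e : {set T}) : e \in edges H ->
  exists x y, [/\ x != y, e = [set x; y], x \in verts H & y \in verts H].
Proof.
move=> eH; have [/eqP/cards2P[x [y [xy E]]] /subsetP s] := sgraph_edge eH.
by exists x, y; split=> //; apply: s; rewrite E !inE eqxx ?orbT.
Qed.

Lemma chi_gt1 : edges H != set0 -> (1 < chi H)%N.
Proof.
case/set0Pn => e eH; have [x [y [xy E xH yH]]] := edge_ends eH.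
have [c c1 c2] := chi_colouring; have := c1 x xH; have := c1 y yH.
have : c x <> c y by apply: c2; rewrite -E.
by case: (chi H) => [|[|k]] //; case: (c x) => //; case: (c y).
Qed.

Lemma card_edges_verts (n : nat) (G : sgraph 'I_n) : (#|edges G| <= #|verts G| ^ 2)%N.
Proof.
rewrite -mulnn -cardsX; apply: leq_trans (leq_imset_card (fun q : 'I_n * 'I_n => [set q.1; q.2]) _).
apply/subset_leq_card/subsetP => e eG; have [/eqP/cards2P[x [y [xy E]]] /subsetP s] := sgraph_edge eG.
by apply/imsetP; exists (x, y) => //; rewrite inE /= !s // E !inE eqxx ?orbT.
Qed.

Lemma del_all_partite (n k : nat) (G : sgraph 'I_n) : (0 < k)%N -> partite k (del_edges G (edges G)).
Proof.
move=> k0; exists (fun=> 0%N) => // x y.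
by rewrite /edges /= setDv inE.
Qed.

Lemma matching_embedding (n : nat) (E : {set {set 'I_n}}) (D : R) :
  (forall e, e \in E -> #|e| = 2%N) -> {in edges H &, forall a b : {set T}, a != b -> [disjoint a & b]} ->
  (forall v, #|[set e in E | v \in e]|%:R <= D) -> 0 <= D -> #|T|%:R * D < #|E|%:R ->
  exists2 phi : {ffun T -> 'I_n}, {in cover (edges H) &, injective phi} &
    forall e, e \in edges H -> phi @: (e : {set T}) \in E.
Proof.
move=> E2 mH hD D0 big.
suff h k (M : {set {set T}}) : #|M| = k -> M \subset edges H ->
    exists2 phi : {ffun T -> 'I_n}, {in cover M &, injective phi} &
      forall e, e \in M -> phi @: (e : {set T}) \in E by exact: h erefl (subxx _).
elim: k M => [|k IH] M.
  move=> /eqP; rewrite cards_eq0 => /eqP -> _.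
  have /card_gt0P[e eE] : (0 < #|E|)%N.
    by rewrite -(ltr_nat R); apply: le_lt_trans big; rewrite mulr_ge0.
  have /card_gt0P[v _] : (0 < #|e|)%N by rewrite E2.
  by exists [ffun=> v] => [x y|e']; rewrite ?inE // /cover big_set0 inE.
move=> cM MH; have /card_gt0P[e0 e0M] : (0 < #|M|)%N by rewrite cM.
have [phi ip pe] : exists2 phi : {ffun T -> 'I_n}, {in cover (M :\ e0) &, injective phi} &
      forall e, e \in M :\ e0 -> phi @: (e : {set T}) \in E.
  apply: IH; last exact: subset_trans (subsetDl _ _) MH.
  by move: cM; rewrite (cardsD1 e0) e0M => -[].
pose Z := phi @: cover (M :\ e0).
have [e eE eZ] : exists2 e, e \in E & e :&: Z == set0.
  apply/exists_inP; apply: contraT => /exists_inPn none.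
  have : (#|E| <= \sum_(z in Z) #|[set e in E | z \in e]|)%N.
    apply: (@leq_trans #|\bigcup_(z in Z) [set e in E | z \in e]|).
      apply/subset_leq_card/subsetP => e eE; have := none e eE.
      case/set0Pn => z /setIP[ze zZ]; apply/bigcupP; exists z => //.
      by rewrite inE eE.
    apply: (big_ind2 (fun (A : {set {set 'I_n}}) n => (#|A| <= n)%N)) => //.
      by rewrite cards0.
    by move=> A1 n1 A2 n2 h1 h2; apply: leq_trans (leq_card_setU _ _) (leq_add h1 h2).
  rewrite -(ler_nat R) natr_sum => hE.
  have : #|E|%:R <= #|T|%:R * D.
    apply: (le_trans hE); apply: (@le_trans _ _ (\sum_(z in Z) D)); first exact: ler_sum.
    rewrite sumr_const -[leLHS]mulr_natl; apply: ler_wpM2r => //.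
    by rewrite ler_nat (leq_trans (leq_imset_card _ _)) // max_card.
  by rewrite leNgt big.
have /eqP/cards2P[a [b [ab Eab]]] := E2 e eE; subst e.
have [x [y [xy Exy xH yH]]] := edge_ends (subsetP MH _ e0M).
have out u : u \in e0 -> u \notin cover (M :\ e0).
  move=> ue; apply/negP => /bigcupP[e1 /setD1P[ne e1M] ue1].
  have := mH _ _ (subsetP MH _ e1M) (subsetP MH _ e0M) ne => dj.
  by have := disjointFr dj ue1; rewrite ue.
have xout : x \notin cover (M :\ e0) by apply: out; rewrite Exy !inE eqxx.
have yout : y \notin cover (M :\ e0) by apply: out; rewrite Exy !inE eqxx orbT.
have aZ : a \notin Z.
  by apply: contraTN eZ => aZ; apply/set0Pn; exists a; rewrite !inE eqxx.
have bZ : b \notin Z.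
  by apply: contraTN eZ => bZ; apply/set0Pn; exists b; rewrite !inE eqxx orbT.
pose psi : {ffun T -> 'I_n} := [ffun u => if u == x then a else if u == y then b else phi u].
have px : psi x = a by rewrite ffunE eqxx.
have py : psi y = b by rewrite ffunE eqxx eq_sym (negbTE xy).
have pin u : u \in cover (M :\ e0) -> psi u = phi u.
  move=> uc; rewrite ffunE; case: eqP => [E1|_]; first by rewrite -E1 uc in xout.
  by case: eqP => // E1; rewrite -E1 uc in yout.
have inZ u : u \in cover (M :\ e0) -> phi u \in Z by exact: imset_f.
have cov u : u \in cover M -> [\/ u = x, u = y | u \in cover (M :\ e0)].
  case/bigcupP => e1 e1M ue1; have [E1|ne] := eqVneq e1 e0.
    by move: ue1; rewrite E1 Exy => /set2P[] ->; [constructor 1 | constructor 2].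
  by constructor 3; apply/bigcupP; exists e1; rewrite // !inE ne.
exists psi.
  move=> u v /cov[->|->|uc] /cov[->|->|vc]; rewrite ?px ?py ?(pin u uc) ?(pin v vc) // => E1.
  - by rewrite E1 eqxx in ab.
  - by rewrite E1 inZ in aZ.
  - by rewrite E1 eqxx in ab.
  - by rewrite E1 inZ in bZ.
  - by rewrite -E1 inZ in aZ.
  - by rewrite -E1 inZ in bZ.
  - exact: ip.
move=> e1 e1M; have [->|ne] := eqVneq e1 e0.
  by rewrite Exy imsetU1 imset_set1 px py.
have e1' : e1 \in M :\ e0 by rewrite !inE ne.
rewrite (eq_in_imset (g := phi)); first exact: pe.
by move=> u ue; apply: pin; apply/bigcupP; exists e1.
Qed.

End Cases.

Section LikelyCases.
Variables (R : realType) (T : finType) (H : sgraph T) (gamma : R).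
Hypotheses (g0 : 0 < gamma) (g1 : gamma <= 1) (eH : edges H != set0).

Let T0 : (0 < #|T|)%N.
Proof.
case/set0Pn: eH => e /edge_ends[x _]; by apply/card_gt0P; exists x.
Qed.

Lemma chi_pred_gt0 : (0 < chi H - 1)%N.
Proof. by rewrite subn_gt0 chi_gt1. Qed.

Lemma delete_all (n : nat) (p : R) (G : sgraph 'I_n) : #|edges G|%:R <= gamma * p * n%:R ^+ 2 ->
  exists F : {set {set 'I_n}}, [/\ F \subset edges G, #|F|%:R <= gamma * p * n%:R ^+ 2 &
    partite (chi H - 1)%N (del_edges G F)].
Proof. by move=> h; exists (edges G); split=> //; exact: del_all_partite chi_pred_gt0. Qed.

Lemma small_graph (n : nat) (p : R) (G : sgraph 'I_n) :
  (#|T|%:R + 1) ^+ 2 / gamma <= p * n%:R ^+ 2 -> (#|verts G| < #|verts H|)%N ->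
  #|edges G|%:R <= gamma * p * n%:R ^+ 2.
Proof.
rewrite ler_pdivrMr // => hp hv; apply: (@le_trans _ _ ((#|T|%:R + 1) ^+ 2)).
  rewrite natr1 -natrX ler_nat; apply: leq_trans (card_edges_verts G) _.
  by rewrite leq_sqr; apply: ltnW; apply: leq_trans hv _; rewrite leqW // max_card.
by apply: (le_trans hp); apply: le_of_eq; ring.
Qed.

Lemma likely_matching : {in edges H &, forall a b : {set T}, a != b -> [disjoint a & b]} ->
  1 / 2 <= m2 R H -> likely H gamma.
Proof.
move=> mH m12; pose t : R := #|T|%:R.
have t0 : 0 <= t by [].
pose eta := gamma / (2 * (t + 1)).
have t1 : 0 < 2 * (t + 1) by rewrite mulr_gt0 // ltr_wpDl.
have eta0 : 0 < eta by rewrite divr_gt0.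
pose C := 2 / eta + (t + 1) ^+ 2 / gamma.
have C1 : 0 < 2 / eta by rewrite divr_gt0.
have C2 : 0 <= (t + 1) ^+ 2 / gamma by rewrite divr_ge0 ?exprn_ge0 ?addr_ge0 // ltW.
have C0 : 0 < C by rewrite /C ltr_wpDr.
exists C, (4 / eta ^+ 2), 1%N; split=> // n p n1 p01 hp.
case/andP: (p01) => p0 p1.
have nR : 1 <= n%:R :> R by rewrite ler1n.
have n0 : 0 < n%:R :> R by rewrite ltr0n.
set m := p * n%:R ^+ 2.
have nn0 : 0 < n%:R ^+ 2 :> R by rewrite exprn_gt0.
have m2p : 0 < m2 R H by apply: lt_le_trans m12.
have hm : C <= m.
  rewrite /m -ler_pdivrMr //; apply: le_trans hp; apply: ler_wpM2l; first exact: ltW.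
  rewrite -powR_mulrn // -powRN; apply: ler_powR => //.
  rewrite lerN2 ler_pdivrMr //; move: m12; rewrite ler_pdivrMr //; by rewrite mulrC.
have hm1 : 2 / eta <= m by apply: le_trans hm; rewrite lerDl.
have hm2 : (t + 1) ^+ 2 / gamma <= m by apply: le_trans hm; rewrite lerDr ltW.
have m0 : 0 < m by apply: lt_le_trans hm1.
set k := eta * m.
have k2 : 2 <= k by move: hm1; rewrite ler_pdivrMr // mulrC.
have k0 : 0 < k by apply: lt_le_trans k2.
pose I v : {set {set 'I_n}} := [set e in all_pairs n | v \in e].
pose F (U : {set {set 'I_n}}) : R := 2 / k ^+ 2 * \sum_v \sum_(e in I v) \sum_(e' in I v | e' != e)
   ([set e; e'] \subset U)%:R.
have kk : 0 < 2 / k ^+ 2 by rewrite divr_gt0 // exprn_gt0.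
have F0 U : 0 <= F U.
  apply: mulr_ge0; first exact: ltW.
  by apply: sumr_ge0 => v _; apply: sumr_ge0 => e _; apply: sumr_ge0.
have cI v : #|I v|%:R <= n%:R :> R.
  rewrite ler_nat; have := incidence_adj setT v (C := all_pairs n) _ => h.
  have {}h := h (fun e he => ltac:(by move: he; rewrite inE => /eqP)).
  apply: leq_trans (leq_trans h _); last by rewrite -[n in (_ <= n)%N]card_ord max_card.
  by apply/subset_leq_card/subsetP => e; rewrite !inE => /andP[-> ->]; rewrite subsetT.
have exF : ex p (enum (all_pairs n)) F <= 4 / eta ^+ 2 / n.+1%:R.
  rewrite exZ ex_sum.
  have b v : ex p (enum (all_pairs n)) (fun U => \sum_(e in I v) \sum_(e' in I v | e' != e)
      ([set e; e'] \subset U)%:R) <= p ^+ 2 * n%:R ^+ 2.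
    rewrite ex_sum; apply: (@le_trans _ _ (\sum_(e in I v) \sum_(e' in I v) p ^+ 2)).
      apply: ler_sum => e eI; rewrite ex_sum big_mkcondr /=; apply: ler_sum => e' eI'.
      case: ifP => [ne|_]; last exact: exprn_ge0.
      rewrite ex_subset ?enum_uniq ?cards2 1?eq_sym ?ne // => u /set2P[] ->; rewrite mem_enum.
        by move: eI; rewrite inE => /andP[].
      by move: eI'; rewrite inE => /andP[].
    rewrite !sumr_const -!mulrnA -[leLHS]mulr_natl natrM mulrC; apply: ler_wpM2l; first exact: exprn_ge0.
    by rewrite expr2; apply: ler_pM.
  apply: (@le_trans _ _ (2 / k ^+ 2 * \sum_(v : 'I_n) p ^+ 2 * n%:R ^+ 2)).
    by apply: ler_wpM2l; [exact: ltW | exact: ler_sum].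
  rewrite sumr_const card_ord -[X in _ * X <= _]mulr_natl.
  have -> : 2 / k ^+ 2 * (n%:R * (p ^+ 2 * n%:R ^+ 2)) = 2 / (eta ^+ 2 * n%:R).
    have pn : p != 0 by move: m0; rewrite /m; case: eqP => // ->; rewrite mul0r ltxx.
    by rewrite /k /m; field; rewrite pn !gt_eqF.
  rewrite ler_pdivrMr; last by rewrite mulr_gt0 ?exprn_gt0.
  have n1' : 0 < n.+1%:R :> R by rewrite ltr0n.
  have -> : 4 / eta ^+ 2 / n.+1%:R * (eta ^+ 2 * n%:R) = 4 * n%:R / n.+1%:R.
    by move: (n.+1%:R : R) n1' => j j0; field; rewrite !gt_eqF.
  by rewrite ler_pdivlMr // -[n.+1%:R]natr1; move: nR; move: (n%:R : R) => x; lra.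
apply: le_trans (gnp_prob_ge p01 F0 _); first by rewrite lerD2l lerN2.
move=> G notnear; have [/forallP hdeg|] := boolP [forall v, #|[set e in edges G | v \in e]|%:R <= k :> R].
  case: notnear => G' [_ sE] free _; apply: delete_all.
  have [hv|hv] := leqP #|verts H| #|verts G'|; last exact: small_graph.
  rewrite leNgt; apply/negP => big; apply: free.
  have E2 e : e \in edges G' -> #|e| = 2%N by case/sgraph_edge.
  have hd v : #|[set e in edges G' | v \in e]|%:R <= k.
    apply: le_trans (hdeg v); rewrite ler_nat; apply/subset_leq_card/subsetP => e.
    by rewrite !inE => /andP[/(subsetP sE) -> ->].
  have [|phi ip pe] := matching_embedding E2 mH hd (ltW k0).
    apply: (@le_lt_trans _ _ (gamma * m)); last by rewrite /m mulrA.
    have -> : #|T|%:R * k = (t / (2 * (t + 1))) * (gamma * m).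
      by rewrite -/t /k /eta; field; rewrite gt_eqF // ltr_wpDl.
    apply: ler_piMl; first by rewrite mulr_ge0 // ltW.
    by rewrite ler_pdivrMr // mul1r; lra.
  exact: has_copy_extend ip pe hv.
rewrite negb_forall => /existsP[v]; rewrite -ltNge => big.
set d : R := #|_|%:R in big.
have hd : d * (d - 1) <= \sum_(e in I v) \sum_(e' in I v | e' != e) ([set e; e'] \subset edges G)%:R.
  have sub e : e \in edges G -> v \in e -> e \in I v.
    by move=> eG ve; rewrite !inE ve andbT; have [->] := sgraph_edge eG.
  pose Ev := [set e in edges G | v \in e].
  apply: (@le_trans _ _ (\sum_(e in Ev) \sum_(e' in Ev | e' != e) 1)).
    apply: le_of_eq; rewrite (eq_bigr (fun=> d - 1)) => [|e eE].
      by rewrite sumr_const -[RHS]mulr_natl.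
    rewrite sumr_const; have := cardsD1 e Ev; rewrite eE /d -/Ev => ->.
    rewrite natrD addrAC subrr add0r; congr (_%:R); apply: eq_card => e'.
    by rewrite !inE andbC -topredE /= !inE.
  rewrite big_mkcond [leRHS]big_mkcond /=; apply: ler_sum => e _.
  case: (boolP (e \in Ev)) => [|_]; last by case: ifP => // _; apply: sumr_ge0.
  rewrite inE => /andP[eG ve]; rewrite sub //.
  rewrite big_mkcond [leRHS]big_mkcond /=; apply: ler_sum => e' _.
  case: (boolP (e' \in Ev)) => [|_] /=; last by case: ifP.
  rewrite inE => /andP[eG' ve']; rewrite sub //=; case: ifP => // _.
  rewrite (_ : [set e; e'] \subset edges G) //.
  by apply/subsetP => u /set2P[] ->.
rewrite /F (bigD1 v) //= -[leLHS](_ : 2 / k ^+ 2 * (k ^+ 2 / 2) = _); last first.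
  by field; rewrite gt_eqF.
apply: ler_wpM2l; first exact: ltW.
apply: ler_wpDr; first by apply: sumr_ge0 => u _; apply: sumr_ge0 => e _; apply: sumr_ge0.
apply: le_trans hd.
have d2 : k * k <= d * d by apply: ler_pM; rewrite ?ltW.
have d3 : 2 <= d by apply: le_trans k2 (ltW big).
have d4 : 2 * d <= d * d by apply: ler_wpM2r => //; lra.
by rewrite expr2; clear -d2 d4; move: (k * k) d2 => kk; lra.
Qed.

End LikelyCases.

Section LikelyAdjacent.
Variables (R : realType) (T : finType) (H : sgraph T) (gamma : R).
Hypotheses (g0 : 0 < gamma) (g1 : gamma <= 1).

Lemma proper_ordinal : (1 < chi H)%N ->
  exists f : T -> 'I_(chi H), forall x y, [set x; y] \in edges H -> f x != f y.
Proof.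
move=> r1; have [c c1 c2] := chi_colouring H.
have r0 : (0 < chi H)%N by apply: ltnW.
exists (fun x => insubd (Ordinal r0) (c x)) => x y xy.
have [_ /subsetP s] := sgraph_edge xy.
have xH : x \in verts H by apply: s; rewrite !inE eqxx.
have yH : y \in verts H by apply: s; rewrite !inE eqxx orbT.
have vE z : z \in verts H -> val (insubd (Ordinal r0) (c z)) = c z.
  by move=> zH; rewrite insubdK // -topredE /= c1.
by apply/eqP => /(congr1 val); rewrite !vE //; exact: c2.
Qed.

Lemma near_partite_of_colouring (n : nat) (p : R) (G : sgraph 'I_n) (c : 'I_n -> nat) :
  (forall v, c v < (chi H).-1)%N ->
  #|[set e in edges G | [exists i : 'I_(chi H).-1, e \subset [set v in verts G | c v == i]]]|%:R
    <= gamma * p * n%:R ^+ 2 ->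
  exists F : {set {set 'I_n}}, [/\ F \subset edges G, #|F|%:R <= gamma * p * n%:R ^+ 2 &
    partite (chi H - 1)%N (del_edges G F)].
Proof.
move=> ck; set F := [set e in edges G | _] => hc; exists F; split=> //.
  by apply/subsetP => e; rewrite inE => /andP[].
exists c; first by move=> v _; rewrite subn1; exact: ck.
move=> x y; rewrite /edges /= inE => /andP[nF xy] E.
case/negP: nF; rewrite inE; apply/andP; split; first exact: xy.
apply/existsP; exists (Ordinal (ck x)); apply/subsetP => u ue.
have [_ /subsetP s] := sgraph_edge (H := G) xy.
by rewrite inE s //=; move: ue; rewrite !inE => /orP[/eqP ->|/eqP ->]; rewrite ?E.
Qed.

Lemma likely_adjacent (e1 e2 : {set T}) : e1 \in edges H -> e2 \in edges H -> e1 != e2 ->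
  ~~ [disjoint e1 & e2] -> likely H gamma.
Proof.
move=> h1 h2 ne nd; have m1 := m2_adjacent R h1 h2 ne nd.
have eH : edges H != set0 by apply/set0Pn; exists e1.
have E2 : (2 <= #|edges H|)%N by apply/card_gt1P; exists e1, e2.
have T0 : (0 < #|T|)%N.
  by have [x _] := edge_ends h1; apply/card_gt0P; exists x.
have r1 := chi_gt1 eH; have [f fH] := proper_ordinal r1.
have g01 : 0 < gamma <= 1 by rewrite g0.
have [eps [eta [eps0 eta0 stab]]] := stability_from_container r1 g01.
have [k k0 [n0 few]] := few_cliques fH T0 eps0.
pose eta' := Num.min eta 1.
have eta'0 : 0 < eta' by rewrite lt_min eta0 ltr01.
have eta'1 : eta' <= 1 by rewrite ge_min lexx orbT.
have eta'e : eta' <= eta by rewrite ge_min lexx.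
pose c0 : R := 16 * 2 ^+ #|edges H| * #|T|%:R ^+ #|T|.
have c00 : 0 < c0 by rewrite !mulr_gt0 ?exprn_gt0 // ltr0n.
pose delta := Num.min (1 / 2) (k ^+ 2 / c0).
have d0 : 0 < delta by rewrite lt_min !divr_gt0 // exprn_gt0.
have d1 : delta <= 1 / 2 by rewrite ge_min lexx.
have d2 : delta <= k ^+ 2 / c0 by rewrite ge_min lexx orbT.
have d01 : 0 < delta < 1 by rewrite d0 /=; apply: le_lt_trans d1 _; rewrite ltr_pdivrMr // mul1r ltr1n.
pose beta : R := eta' ^+ 4 / 4 ^+ 5.
have beta0 : 0 < beta by apply: divr_gt0; exact: exprn_gt0.
have beta1 : beta <= eta'.
  rewrite /beta ler_pdivrMr ?exprn_gt0 // exprS; apply: ler_wpM2l; first exact: ltW.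
  by apply: (@le_trans _ _ 1); [rewrite exprn_ile1 // ltW | rewrite exprn_ege1 // ler1n].
pose Ca := 48 / eta' ^+ 2; pose Cb := 2 / (delta * beta); pose Cc := (#|T|%:R + 1) ^+ 2 / gamma.
have Ca0 : 0 < Ca by rewrite divr_gt0 // exprn_gt0.
have Cb0 : 0 < Cb by rewrite divr_gt0 // mulr_gt0.
have Cc0 : 0 <= Cc by rewrite divr_ge0 ?exprn_ge0 ?addr_ge0 // ltW.
pose C := Ca + Cb + Cc.
have Ca1 : Ca <= C by rewrite /C -addrA lerDl addr_ge0 // ltW.
have Cb1 : Cb <= C by rewrite /C addrAC lerDr addr_ge0 // ltW.
have Cc1 : Cc <= C by rewrite /C lerDr addr_ge0 // ltW.
have C0 : 0 < C by apply: lt_le_trans Ca1.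
set mm := m2 R H in m1.
have mm0 : 0 < mm by apply: lt_le_trans m1.
pose N1 := (Num.truncn (2 `^ mm)).+1.
exists C, 1, (n0 + N1)%N; split=> // n p hn p01 hp; case/andP: (p01) => p0' p1.
have nn0 : (n0 <= n)%N by apply: leq_trans hn; exact: leq_addr.
have nN1 : (N1 <= n)%N by apply: leq_trans hn; exact: leq_addl.
have n1 : (0 < n)%N by apply: leq_trans nN1.
have nR1 : 1 <= n%:R :> R by rewrite ler1n.
have nR : 0 < n%:R :> R by rewrite ltr0n.
rewrite -/mm in hp; set q : R := n%:R `^ (- (1 / mm)) in hp.
have q0 : 0 < q by rewrite powR_gt0.
have p0 : 0 < p by apply: lt_le_trans hp; rewrite mulr_gt0.
have nq : n%:R^-1 <= q.
  rewrite -[n%:R in leLHS]powRr1 // -powRN; apply: ler_powR => //.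
  by rewrite lerN2 ler_pdivrMr // mul1r.
have q2 : q <= 1 / 2.
  rewrite /q powRN div1r div1r lef_pV2 ?posrE ?powR_gt0 //.
  have h : 2 `^ mm <= n%:R by apply/ltW/(lt_le_trans (truncnS_gt _)); rewrite ler_nat.
  have -> : (2 : R) = (2 `^ mm) `^ mm^-1 by rewrite -powRrM divff ?gt_eqF // powRr1.
  by apply: ge0_ler_powR => //; rewrite ?nnegrE ?powR_ge0 ?invr_ge0 // ltW.
have pnC : C <= p * n%:R.
  rewrite -ler_pdivrMr //; apply: le_trans hp; apply: ler_wpM2l nq; exact: ltW.
have pn2C : C <= p * n%:R ^+ 2.
  apply: (le_trans pnC); rewrite expr2 mulrA; apply: ler_peMr => //.
  by rewrite mulr_ge0 // ltW.
have hX : (0 < #|'I_n|)%N by rewrite card_ord.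
have hq (J : {set {set T}}) : J \subset edges H -> J != set0 ->
    #|'I_n|%:R ^+ 2 * q <= #|'I_n|%:R ^+ #|cover J| * q ^+ #|J|.
  by move=> JH J0; rewrite card_ord; apply: powR_density.
have [fc hfc] := graph_containers q0 hX hq T0 eH q2 d01.
have pnA : 48 / eta' ^+ 2 <= p * n%:R by apply: le_trans pnC.
apply: le_trans (gnp_prob_ge p01 (F := atypicality p eta' fc) _ _); first last.
- move=> G nG; apply: atypicality_ge1 => //; apply: contra_not nG => typ.
  move=> G' [_ sE] free mindeg.
  have [hv|hv] := leqP #|verts H| #|verts G'|; last first.
    by apply: delete_all => //; apply: (small_graph g0 (le_trans Cc1 pn2C) hv).
  have G2 e : e \in edges G' -> #|e| = 2%N by case/sgraph_edge.
  have nocopy phi : embedding H phi -> ~~ (copy H phi \subset edges G').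
    move=> ephi; apply/negP => /subsetP sub; apply: free.
    apply: (has_copy_extend (phi := phi)) => //.
      move=> x y xc yc; apply: (embeddingP _ _ ephi); exact: (subsetP (cover_edges_sub (subxx _))).
    by move=> e eE; apply: sub; apply: imset_f.
  have [S [SE cS dj fc2 [ES few']]] := hfc (edges G') G2 nocopy.
  have adm : admissible fc S.
    apply/and3P; split=> //; apply/subsetP => e.
      by move=> /(subsetP SE)/G2 c2; rewrite inE c2.
    by move=> /fc2 c2; rewrite inE c2.
  have cS' : #|S|%:R <= beta * (p * n%:R ^+ 2).
    rewrite -(ler_pM2r d0); apply: (le_trans cS); rewrite card_ord.
    have : Cb * q <= p by apply: le_trans hp; apply: ler_wpM2r => //; exact: ltW.
    rewrite /Cb mulrAC ler_pdivrMr ?mulr_gt0 // => hh.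
    have -> : beta * (p * n%:R ^+ 2) * delta = p * (delta * beta) * n%:R ^+ 2 by ring.
    by apply: ler_wpM2r => //; exact: exprn_ge0.
  have mp : 0 <= p * n%:R ^+ 2 by rewrite mulr_ge0 ?exprn_ge0.
  have typ2 (A B : {set 'I_n}) : #|edges G :&: (fc S :&: touching A B)|%:R <=
      p * #|fc S :&: touching A B|%:R + eta * p * n%:R ^+ 2.
    apply: le_trans (typ S adm _ cS' A B) _; first exact: subset_trans SE sE.
    by rewrite lerD2l -!mulrA; apply: ler_wpM2r.
  have cS2 : #|S|%:R <= eta * p * n%:R ^+ 2.
    by apply: (le_trans cS'); rewrite -mulrA; apply: ler_wpM2r => //; apply: le_trans beta1 _.
  have cliq : #|[set y : {ffun 'I_(chi H) -> 'I_n} | clique_tuple (adj (fc S)) y]|%:R <= eps * n%:R ^+ (chi H).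
    have := few 'I_n (fc S); rewrite card_ord; apply=> //.
    rewrite card_ord in few'; set N := #|_|%:R in few' *.
    have kn : 0 <= k * n%:R ^+ #|T| by rewrite mulr_ge0 ?exprn_ge0 // ltW.
    rewrite -ler_sqr ?nnegrE // exprMn; apply: (le_trans few').
    apply: ler_wpM2r; first by rewrite exprn_ge0 // exprn_ge0.
    by rewrite mulrC -ler_pdivlMr.
  have deg v : v \in verts G' -> (1 - 3 / (3 * (chi H)%:R - 4) + gamma) * p * n%:R <=
      #|[set e in edges G' | v \in e]|%:R.
    by move=> vG; apply: (le_trans mindeg); rewrite ler_nat; exact: min_degree_le.
  have EW e : e \in edges G' -> e \subset verts G' by case/sgraph_edge.
  have [c ck hc] := stab n (fc S) (edges G) S (edges G') (verts G') p n1 p0 fc2 G2 EW sE ES typ2 cS2 cliq deg.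
  exact: near_partite_of_colouring ck hc.
- exact: atypicality_ge0.
rewrite lerD2l lerN2; apply: (le_trans (ex_atypicality _ p0 p1 eta'0 eta'1 pnA)).
rewrite expRN div1r lef_pV2 ?posrE ?expR_gt0 ?ltr0n //.
by rewrite -natr1 addrC expR_ge1Dx.
Qed.

End LikelyAdjacent.

Lemma likely_all (R : realType) (T : finType) (H : sgraph T) (gamma : R) :
  0 < gamma -> gamma <= 1 -> likely H gamma.
Proof.
move=> g0 g1.
have [e1|e2] := leqP #|edges H| 1.
  have [K2|nK] := boolP (is_K2 H); last by apply: likely_vacuous; exact: m2_le0.
  have c1 : #|edges H| = 1%N by case/andP: K2 => _ /eqP.
  apply: likely_matching => //; first by rewrite -card_gt0 c1.
    have /cards1P[e E] : #|edges H| == 1%N by rewrite c1.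
    by rewrite E => a b /set1P -> /set1P ->; rewrite eqxx.
  by apply: m2_matching; [rewrite c1 | right].
have eH : edges H != set0 by rewrite -card_gt0 ltnW.
have [/exists_inP[a aH /exists_inP[b bH /andP[ne nd]]]|none] :=
  boolP [exists a in edges H, exists b in edges H, (a != b) && ~~ [disjoint a & b]].
  exact: likely_adjacent ne nd.
apply: likely_matching => //; last by apply: m2_matching; [exact: ltnW | left].
move=> a b aH bH ne; apply: contraNT none => nd.
by apply/exists_inP; exists a => //; apply/exists_inP; exists b; rewrite ?ne.
Qed.

Local Open Scope classical_set_scope.
Local Open Scope ring_scope.

Theorem theorem1p13 (R : realType) (T : finType) (H : sgraph T) (gamma : R) :
  0 < gamma ->
  exists2 C : R, 0 < C &
    forall p : nat -> R,
      (forall n, 0 <= p n <= 1) ->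
      (\forall n \near \oo, C * n%:R `^ (- (1 / m2 R H)) <= p n) ->
      (fun n : nat => gnp_prob (p n)
        [set G : sgraph 'I_n | forall G' : sgraph 'I_n,
           subgraph G' G ->
           graph_free H G' ->
           (1 - 3 / (3 * (chi H)%:R - 4) + gamma) * p n * n%:R
             <= (min_degree G')%:R ->
           exists F : {set {set 'I_n}},
             [/\ F \subset edges G',
                 #|F|%:R <= gamma * p n * n%:R ^+ 2 &
                 partite (chi H - 1)%N (del_edges G' F)]])
      @ \oo --> (1 : R).
Proof.
move=> gam0; pose g := Num.min gamma 1.
have g0 : 0 < g by rewrite lt_min gam0 ltr01.
have g1 : g <= 1 by rewrite ge_min lexx orbT.
have gg : g <= gamma by rewrite ge_min lexx.
have [C [K [N0 [C0 hlik]]]] := likely_all H g0 g1.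
exists C => // p p01 hp.
have cvgK : (fun n : nat => 1 - K / n.+1%:R : R) @ \oo --> (1 : R).
  rewrite -[X in _ --> X](_ : 1 - K * 0 = 1); last by rewrite mulr0 subr0.
  apply: cvgB; first exact: cvg_cst.
  apply: cvgM; first exact: cvg_cst.
  exact: cvg_harmonic.
apply: (squeeze_cvgr _ cvgK (cvg_cst (1 : R))).
near=> n; apply/andP; split; last exact: gnp_prob_le1.
have hn : (N0 <= n)%N by near: n; exists N0.
have hpn : C * n%:R `^ (- (1 / m2 R H)) <= p n by near: n.
apply: (le_trans (hlik n (p n) hn (p01 n) hpn)).
rewrite /gnp_prob big_mkcond [leRHS]big_mkcond /=; apply: ler_sum => G _.
have [nG|nG] := pselect (near_partite H g (p n) G); last first.
  by rewrite memNset //; case: ifP => // _; exact: gnp_weight_ge0.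
rewrite mem_set // mem_set // => G' sG free mindeg.
have p0 : 0 <= p n by case/andP: (p01 n).
have [|F [FE cF pF]] := nG G' sG free.
  apply: le_trans mindeg; apply: ler_wpM2r => //; apply: ler_wpM2r => //.
  by rewrite lerD2l.
exists F; split=> //; apply: (le_trans cF).
by apply: ler_wpM2r; [exact: exprn_ge0 | exact: ler_wpM2r].
Unshelve. all: by end_near.
Qed.
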